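(* Let $n$ be an integer, and let $L_{\ell,B}$ denote the algebraic-form Lamé operator with singular points $e_1,e_2,e_3,\infty$. 1. In the harmonic case ($J=1$): $G(L_{n+1/6,0})$ is octahedral if $n\equiv0\pmod 2$, and $G(L_{n-1/6,0})$ is octahedral if $n\equiv1\pmod 2$. 2. In the equianharmonic case ($J=0$): (a) $G(L_{n+1/4,0})$ is octahedral if $n\equiv0\pmod 3$, and $G(L_{n-1/4,0})$ is octahedral if $n\equiv2\pmod3$. (b) $G(L_{n+1/10,0})$ is icosahedral if $n\equiv0\pmod 3$, and $G(L_{n-1/10,0})$ is icosahedral if $n\equiv2\pmod3$. (c) $G(L_{n+3/10,0})$ and $G(L_{n-3/10,0})$ are icosahedral if $n\equiv1\pmod3$.
   Context: For $\ell,B\in\mathbf{C}$ and distinct $e_1,e_2,e_3\in\mathbf{C}$ with $e_1+e_2+e_3=0$, the algebraic-form Lamé operator on $\mathbf{P}^1(\mathbf{C})$ (coordinate $x$) is $$L_{\ell,B} = D^2 + \frac12\sum_{i=1}^3\frac{1}{x-e_i}\,D - \frac{\ell(\ell+1)x+B}{4\prod_{i=1}^3(x-e_i)},\qquad D=\frac{d}{dx}.$$ Define $g_2,g_3$ by $4x^3-g_2x-g_3=4\prod_{i=1}^3(x-e_i)$ and $J=g_2^3/(g_2^3-27g_3^2)$. The harmonic case is $J=1$, i.e., $g_3=0$, i.e., $\{e_1,e_2,e_3\}=\alpha\{-1,0,1\}$ for some $\alpha\ne0$. The equianharmonic case is $J=0$, i.e., $g_2=0$, i.e., $\{e_1,e_2,e_3\}=\alpha\{1,\omega,\omega^2\}$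 for some $\alpha\neq0$, with $\omega$ a primitive cube root of unity. In both cases $\alpha\ne0$ is arbitrary. Projective monodromy group $G(L_{\ell,B})$: choose an ordinary point $P$ and two independent local solutions at $P$. Analytic continuation along loops based at $P$ in $\mathbf{P}^1(\mathbf{C})\setminus\{e_1,e_2,e_3,\infty\}$ gives a representation of the fundamental group in $GL(2,\mathbf{C})$, and $G(L_{\ell,B})$ is the image of this monodromy group in $PGL(2,\mathbf{C})$ (well defined up to isomorphism). Octahedral means isomorphic to $S_4$; icosahedral means isomorphic to $A_5$. *)

(* Defs.v *)
From HB Require Import structures.
From mathcomp Require Import all_boot all_order all_algebra.
From mathcomp Require Import all_fingroup all_solvable complex.
From mathcomp Require Import ring.
From mathcomp Require Import all_classical all_reals all_analysis.

Set Implicit Arguments.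
Unset Strict Implicit.
Unset Printing Implicit Defensive.

Import Order.TTheory GRing.Theory Num.Theory.
Import numFieldNormedType.Exports.

Local Open Scope ring_scope.
Local Open Scope classical_set_scope.

(* MathComp provides {'GL_n[F]} as a group for finite F only, hence the       *)
(* definitions of GL and PGL as (possibly infinite) groupTypes.               *)
Section GeneralLinearGroup.
Variables (n : nat) (F : fieldType).

Definition GL : Type := {A : 'M[F]_n | A \in unitmx}.
HB.instance Definition _ := Choice.on GL.

Implicit Types A B : GL.

Lemma GL_one_subproof : (1%:M : 'M[F]_n) \in unitmx.
Proof. exact: unitmx1. Qed.

Lemma GL_mul_subproof A B : val A *m val B \in unitmx.
Proof. by rewrite unitmx_mul (valP A) (valP B). Qed.

Lemma GL_inv_subproof A : invmx (val A) \in unitmx.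
Proof. by rewrite unitmx_inv (valP A). Qed.

Definition GL_one : GL := exist _ 1%:M GL_one_subproof.
Definition GL_mul A B : GL := exist _ (val A *m val B) (GL_mul_subproof A B).
Definition GL_inv A : GL := exist _ (invmx (val A)) (GL_inv_subproof A).

Fact GL_mulA : associative GL_mul.
Proof. by move=> A B D; apply: val_inj; rewrite /= mulmxA. Qed.

Fact GL_mul1 : left_id GL_one GL_mul.
Proof. by move=> A; apply: val_inj; rewrite /= mul1mx. Qed.

Fact GL_mulr1 : right_id GL_one GL_mul.
Proof. by move=> A; apply: val_inj; rewrite /= mulmx1. Qed.

Fact GL_mulV : left_inverse GL_one GL_inv GL_mul.
Proof. by move=> A; apply: val_inj; rewrite /= mulVmx // (valP A). Qed.

Fact GL_mulrV : right_inverse GL_one GL_inv GL_mul.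
Proof. by move=> A; apply: val_inj; rewrite /= mulmxV // (valP A). Qed.

HB.instance Definition _ :=
  isGroup.Build GL GL_mulA GL_mul1 GL_mulr1 GL_mulV GL_mulrV.

Definition proportional A B : bool :=
  `[< exists2 c : F, c != 0 & val A = c *: val B >].

Lemma proportional_refl : reflexive proportional.
Proof. by move=> A; apply/asboolP; exists 1; rewrite ?oner_eq0 ?scale1r. Qed.

Lemma proportional_sym : symmetric proportional.
Proof.
have sym A B : proportional A B -> proportional B A.
  move=> /asboolP[c c0 AB]; apply/asboolP; exists c^-1; first by rewrite invr_eq0.
  by rewrite AB scalerA mulVf // scale1r.
by move=> A B; apply/idP/idP; apply: sym.
Qed.

Lemma proportional_trans : transitive proportional.
Proof.
move=> B A D /asboolP[c c0 AB] /asboolP[d d0 BD]; apply/asboolP.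
by exists (c * d); rewrite ?mulf_neq0 // AB BD scalerA.
Qed.

Canonical proportional_equiv :=
  EquivRel proportional proportional_refl proportional_sym proportional_trans.

End GeneralLinearGroup.

Section ProjectiveLinearGroup.
Local Open Scope quotient_scope.
Variables (n : nat) (F : fieldType).

Definition PGL : Type := {eq_quot @proportional n F}.
HB.instance Definition _ := Choice.on PGL.
HB.instance Definition _ := EqQuotient.on PGL.

Definition toPGL (A : GL n F) : PGL := \pi_PGL A.

Implicit Types (A B : GL n F) (x y : PGL).

Lemma toPGLP A B :
  toPGL A = toPGL B <-> exists2 c : F, c != 0 & val A = c *: val B.
Proof.
split; first by move/eqmodP => /asboolP.
by move=> AB; apply/eqmodP/asboolP.
Qed.

Lemma toPGL_repr x : toPGL (generic_quotient.repr x) = x.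
Proof. by rewrite /toPGL reprK. Qed.

Lemma repr_toPGL A :
  exists2 c : F, c != 0 & val (generic_quotient.repr (toPGL A)) = c *: val A.
Proof. by apply/toPGLP; rewrite toPGL_repr. Qed.

Definition PGL_one : PGL := toPGL (GL_one n F).
Definition PGL_mul x y : PGL :=
  toPGL (GL_mul (generic_quotient.repr x) (generic_quotient.repr y)).
Definition PGL_inv x : PGL := toPGL (GL_inv (generic_quotient.repr x)).

Lemma PGL_mulE A B : PGL_mul (toPGL A) (toPGL B) = toPGL (GL_mul A B).
Proof.
have [c c0 AE] := repr_toPGL A; have [d d0 BE] := repr_toPGL B.
apply/toPGLP; exists (c * d); first by rewrite mulf_neq0.
by rewrite /= AE BE -scalemxAl -scalemxAr scalerA.
Qed.

Fact PGL_mulA : associative PGL_mul.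
Proof.
move=> x y z; rewrite -(toPGL_repr x) -(toPGL_repr y) -(toPGL_repr z).
by rewrite !PGL_mulE GL_mulA.
Qed.

Fact PGL_mul1 : left_id PGL_one PGL_mul.
Proof. by move=> x; rewrite -(toPGL_repr x) PGL_mulE GL_mul1. Qed.

Fact PGL_mulr1 : right_id PGL_one PGL_mul.
Proof. by move=> x; rewrite -(toPGL_repr x) PGL_mulE GL_mulr1. Qed.

Fact PGL_mulV : left_inverse PGL_one PGL_inv PGL_mul.
Proof.
by move=> x; rewrite -{2}(toPGL_repr x) PGL_mulE GL_mulV.
Qed.

Fact PGL_mulrV : right_inverse PGL_one PGL_inv PGL_mul.
Proof.
by move=> x; rewrite -{1}(toPGL_repr x) PGL_mulE GL_mulrV.
Qed.

HB.instance Definition _ :=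
  isGroup.Build PGL PGL_mulA PGL_mul1 PGL_mulr1 PGL_mulV PGL_mulrV.

Lemma toPGLM : {morph toPGL : A B / (A * B)%g}.
Proof. by move=> A B; rewrite -[LHS]PGL_mulE. Qed.

End ProjectiveLinearGroup.

(* The set X, with the law of the ambient group G, is isomorphic to H.        *)
Definition isomorphic_to (G : groupType) (X : set G)
    (gT : finGroupType) (H : {group gT}) : Prop :=
  exists f : gT -> G,
    [/\ {in H &, {morph f : x y / (x * y)%g}}, {in H &, injective f}
      & f @` [set` H] = X].

Definition octahedral (G : groupType) (X : set G) : Prop :=
  isomorphic_to X ('Sym_'I_4)%G.

Definition icosahedral (G : groupType) (X : set G) : Prop :=
  isomorphic_to X ('Alt_'I_5)%G.

(* Below, C is meant to be R[i]; it is kept abstract so that its topology is  *)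
(* the one inferred for a numFieldType.                                       *)
Section AnalyticContinuation.
Variables (R : realType) (C : numFieldType).

Definition holomorphic_near (f : C -> C) (z : C) : Prop :=
  \forall w \near z, derivable f w 1.

(* F t is a function element at gamma t: only its germ there is relevant.     *)
Definition continuation_along (gamma : R -> C) (F : R -> C -> C) : Prop :=
  forall t : R, t \in `[0, 1]%R ->
    holomorphic_near (F t) (gamma t) /\
    \forall s \near t, s \in `[0, 1]%R -> {near gamma s, F s =1 F t}.

Definition continues_to (gamma : R -> C) (f g : C -> C) : Prop :=
  exists F : R -> C -> C,
    [/\ continuation_along gamma F, {near gamma 0, F 0 =1 f}
      & {near gamma 1, F 1 =1 g}].

Definition loop_in (D : set C) (P : C) (gamma : R -> C) : Prop :=
  [/\ {within `[0, 1], continuous gamma}, gamma 0 = P, gamma 1 = P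
    & forall t : R, t \in `[0, 1]%R -> D (gamma t)].

End AnalyticContinuation.

Section Lame.
Variables (R : realType) (C : numFieldType) (e : 'I_3 -> C) (l B : C).

Definition Lame_op (y : C -> C) (x : C) : C :=
  y^`(2)%classic x + 2^-1 * (\sum_i (x - e i)^-1) * y^`()%classic x
  - (l * (l + 1) * x + B) / (4 * \prod_i (x - e i)) * y x.

(* P^1(C) minus the singular points e_1, e_2, e_3 and infinity.               *)
Definition ordinary : set C := [set x | forall i, x != e i].

Definition local_solution (P : C) (y : C -> C) : Prop :=
  \forall x \near P,
    [/\ derivable y x 1, derivable y^`() x 1 & Lame_op y x = 0].

Definition solution_basis (P : C) (y : 'I_2 -> C -> C) : Prop :=
  (forall j, local_solution P (y j)) /\
  (forall c : 'I_2 -> C,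
     (\forall x \near P, \sum_j c j * y j x = 0) -> forall j, c j = 0).

(* Column j of the matrix holds the coordinates of the continuation of y j.   *)
Definition monodromy_group (P : C) (y : 'I_2 -> C -> C) : set (GL 2 C) :=
  [set M : GL 2 C | exists2 gamma : R -> C, loop_in ordinary P gamma &
     forall j, continues_to gamma (y j) (fun x => \sum_i val M i j * y i x)].

Definition projective_monodromy_group (P : C) (y : 'I_2 -> C -> C)
    : set (PGL 2 C) :=
  @toPGL 2 C @` monodromy_group P y.

End Lame.

(* The isomorphism class of the projective monodromy group does not depend on *)
(* the base point and the local basis, so a property of it is required for    *)
(* all choices of these.                                                      *)
Definition octahedral_Lame (R : realType) (e : 'I_3 -> R[i]) (l B : R[i]) :=
  forall (P : R[i]) (y : 'I_2 -> R[i] -> R[i]),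
    ordinary e P -> solution_basis e l B P y ->
    octahedral (projective_monodromy_group R e P y).

Definition icosahedral_Lame (R : realType) (e : 'I_3 -> R[i]) (l B : R[i]) :=
  forall (P : R[i]) (y : 'I_2 -> R[i] -> R[i]),
    ordinary e P -> solution_basis e l B P y ->
    icosahedral (projective_monodromy_group R e P y).

Section Invariants.
Variables (C : numFieldType) (e : 'I_3 -> C).

Definition Lame_cubic : {poly C} := 4 *: \prod_i ('X - (e i)%:P).

Definition g2 : C := - Lame_cubic`_1.
Definition g3 : C := - Lame_cubic`_0.

Lemma Lame_cubicE : \sum_i e i = 0 ->
  Lame_cubic = 4 *: 'X^3 - g2 *: 'X - g3%:P.
Proof.
rewrite !big_ord_recl big_ord0 addr0 => e0.
have {e0} eE : e ord0 = - (e (lift ord0 ord0) + e (lift ord0 (lift ord0 ord0))).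
  by apply/eqP; rewrite -addr_eq0 e0.
have [a [b pE]] : exists a b, Lame_cubic = 4 *: 'X^3 + a *: 'X + b%:P.
  rewrite /Lame_cubic !big_ord_recl big_ord0 mulr1 eE.
  move: (e _) (e _) => u v.
  exists (4 * (u * v - (u + v) ^+ 2)), (4 * (u * v * (u + v))).
  rewrite -!mul_polyC !(rmorphM, rmorphB, rmorphXn, rmorphD, rmorphN).
  ring.
rewrite /g2 /g3 pE !(coefD, coefZ, coefX, coefXn, coefC) /=.
by rewrite !(mulr0, mulr1, add0r, addr0) polyCN scaleNr !opprK.
Qed.

Definition J_invariant : C := g2 ^+ 3 / (g2 ^+ 3 - 27 * g3 ^+ 2).

End Invariants.

(* Main.v *)
(** Put m' = 2 in the harmonic and m' = 3 in the equianharmonic case, and let a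
    be a nonzero e_i. The substitution x = a e^(u/m') turns the Lamé equation
    (with B = 0) into the hypergeometric equation in z = e^u = (x/a)^m' whose
    exponent differences at 0, 1, infinity are 1/m, 1/2 and (l + 1/2)/m' = p/r,
    where m = 4, r = 3 resp. m = 3, r = 4 or 5. The singular points are the
    u = 2 pi i k.  Let [b] be the action of u |-> u + 2 pi i on a basis of
    solutions on Re u < 0 and [a] the monodromy of that basis around u = 0. In
    PGL_2 they satisfy a^2 = b^m = (a b)^r = 1; here a^2 = 1 since the
    determinant of a is -1 and some solution is holomorphic at u = 0.

    Upper bound: continuing a germ of the form (standard basis) * h along a path
    in the x-plane multiplies h on the left by elements of <a, b>. By the
    identity theorem this is a locally constant property along the path, so that
    no homotopy is needed; as function elements are only assumed to be complex
    differentiable, the identity theorem rests on Goursat's lemma.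
    Lower bound: loops around 2 pi i k yield b^-k a b^k, and the product of
    b^k a b^-k for k < r is (a b)^r b^-r = b^-r, where r is prime to m.

    So the projective monodromy group is conjugate to <a, b>, a quotient of the
    triangle group (2, m, r), which is S_4 or A_5. A normal-closure computation
    in that finite group shows that the quotient map is injective. *)
Require Import Defs.
From HB Require Import structures.
From mathcomp Require Import all_boot all_order all_algebra.
From mathcomp Require Import all_fingroup all_solvable complex.
From mathcomp Require Import ring lra.
From mathcomp Require Import all_classical all_reals all_analysis.
Set Implicit Arguments.
Unset Strict Implicit.
Unset Printing Implicit Defensive.
Import Order.TTheory GRing.Theory Num.Theory.
Import numFieldNormedType.Exports.
Local Open Scope ring_scope.
Local Open Scope classical_set_scope.

(** * Complex numbers over a real field *)

(** The congruence on n makes (l + 1/2)/m' equal to p/r with an integer p: for l = n + 1/6 and m' =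
    2 it is n/2 + 1/3, whose denominator is 3 exactly when n is even. The hypergeometric parameters
    are al = -l/(2m') and be = (l + 1)/(2m'). No connection coefficient is ever computed. The
    transition matrix [N0] from z = 0 to z = infinity is only known to exist; the eigenvalues at
    these two points, one determinant and one holomorphic solution at z = 1 give the relations, and
    the finite group theory does the rest. Two obstacles shape the passage to the x-plane. The shift
    of u by 2 pi i is a rotation of the x-plane by the angle 2 pi/m' and not a loop, so that b is
    not visibly a monodromy and has to be recovered from conjugates of a. Moreover, the exponential
    misses x = 0. This point is singular in the harmonic case but ordinary in the equianharmonic
    case, where base points and paths may meet it; germs at x = 0 therefore get a treatment of their
    own. *)

(* R[i] with the topology inferred for a numFieldType. It is sealed below, as is *)
(* its embedding in R x R, so that unification does not unfold it.            *)
Definition Cx (R : realType) : numFieldType := R[i].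

Section Complex.
Variable R : realType.
Local Notation C := (Cx R).

Definition emb (x : R) : C := x%:C%C.
Definition cre (z : C) : R := complex.Re z.
Definition cim (z : C) : R := complex.Im z.
Definition ci : C := 'i%C.
Definition cN (z : C) : R := Normc.normc z.

Lemma emb_is_zmod_morphism : zmod_morphism emb.
Proof. exact: (raddfB (@real_complex R)). Qed.
Lemma emb_is_monoid_morphism : monoid_morphism emb.
Proof. exact: (conj (rmorph1 (@real_complex R)) (rmorphM (@real_complex R))). Qed.
HB.instance Definition _ := GRing.isZmodMorphism.Build R C emb emb_is_zmod_morphism.
HB.instance Definition _ := GRing.isMonoidMorphism.Build R C emb emb_is_monoid_morphism.

Lemma cre_is_zmod_morphism : zmod_morphism cre.
Proof. by move=> [a b] [c d]. Qed.
HB.instance Definition _ := GRing.isZmodMorphism.Build C R cre cre_is_zmod_morphism.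
Lemma cim_is_zmod_morphism : zmod_morphism cim.
Proof. by move=> [a b] [c d]. Qed.
HB.instance Definition _ := GRing.isZmodMorphism.Build C R cim cim_is_zmod_morphism.

Lemma creM z w : cre (z * w) = cre z * cre w - cim z * cim w.
Proof. by case: z w => [a b] [c d]. Qed.
Lemma cimM z w : cim (z * w) = cre z * cim w + cim z * cre w.
Proof. by case: z w => [a b] [c d]. Qed.
Lemma cre_emb x : cre (emb x) = x. Proof. by []. Qed.
Lemma cim_emb x : cim (emb x) = 0. Proof. by []. Qed.
Lemma cre_ci : cre ci = 0. Proof. by []. Qed.
Lemma cim_ci : cim ci = 1. Proof. by []. Qed.
Lemma ci2 : ci ^+ 2 = -1. Proof. exact: sqr_i. Qed.
Lemma cext (z w : C) : cre z = cre w -> cim z = cim w -> z = w.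
Proof. by case: z w => [a b] [c d] /= -> ->. Qed.
Lemma cNE (z : C) : cN z = Num.sqrt (cre z ^+ 2 + cim z ^+ 2).
Proof. by case: z. Qed.
Lemma norm_cN (z : C) : `|z| = emb (cN z).
Proof. by rewrite [LHS]normc_def cNE. Qed.
Lemma emb_le x y : (emb x <= emb y) = (x <= y). Proof. exact: lecR. Qed.
Lemma emb_lt x y : (emb x < emb y) = (x < y). Proof. exact: ltcR. Qed.
Lemma emb_gt0 (z : C) : 0 < z -> exists2 r : R, 0 < r & z = emb r.
Proof.
rewrite [0 < z]ltcE => /andP[/eqP h z0]; exists (cre z) => //.
by apply: cext; rewrite ?cre_emb ?cim_emb.
Qed.
End Complex.
Opaque Cx.
#[global] Opaque emb cre cim ci cN.

Section ComplexNorm.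
Variable R : realType.
Local Notation C := (Cx R).
Implicit Types (z w : C) (x y : R).

Lemma creB z w : cre (z - w) = cre z - cre w. Proof. exact: raddfB. Qed.
Lemma cimB z w : cim (z - w) = cim z - cim w. Proof. exact: raddfB. Qed.
Lemma creD z w : cre (z + w) = cre z + cre w. Proof. exact: raddfD. Qed.
Lemma cimD z w : cim (z + w) = cim z + cim w. Proof. exact: raddfD. Qed.
Lemma creN z : cre (- z) = - cre z. Proof. exact: raddfN. Qed.

Lemma cE z : z = emb (cre z) + ci R * emb (cim z).
Proof.
apply: cext; rewrite raddfD /= ?creM ?cimM cre_ci cim_ci ?cre_emb ?cim_emb; ring.
Qed.

Lemma cN_ge0 z : 0 <= cN z.
Proof. by rewrite cNE sqrtr_ge0. Qed.
Lemma cNM z w : cN (z * w) = cN z * cN w.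
Proof. by apply: (@fmorph_inj _ _ (@emb R)); rewrite rmorphM /= -!norm_cN normrM. Qed.
Lemma cN0 : cN (0 : C) = 0.
Proof. by apply: (@fmorph_inj _ _ (@emb R)); rewrite /= -norm_cN normr0 rmorph0. Qed.
Lemma cN1 : cN (1 : C) = 1.
Proof. by apply: (@fmorph_inj _ _ (@emb R)); rewrite /= -norm_cN normr1 rmorph1. Qed.
Lemma cN_eq0 z : (cN z == 0) = (z == 0).
Proof. by rewrite -(fmorph_eq0 (@emb R)) /= -norm_cN normr_eq0. Qed.
Lemma cN_gt0 z : (0 < cN z) = (z != 0).
Proof. by rewrite lt_neqAle cN_ge0 andbT eq_sym cN_eq0. Qed.
Lemma cND z w : cN (z + w) <= cN z + cN w.
Proof. by rewrite -emb_le rmorphD /= -!norm_cN ler_normD. Qed.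
Lemma cNN z : cN (- z) = cN z.
Proof. by apply: (@fmorph_inj _ _ (@emb R)); rewrite /= -!norm_cN normrN. Qed.
Lemma cNB z w : cN (z - w) <= cN z + cN w.
Proof. by rewrite (le_trans (cND _ _)) // cNN. Qed.
Lemma cNBC z w : cN (z - w) = cN (w - z).
Proof. by rewrite -cNN opprB. Qed.
Lemma cNDB z w u : cN (z - w) <= cN (z - u) + cN (u - w).
Proof. by rewrite (le_trans _ (cND _ _)) // addrA subrK. Qed.
Lemma cN_emb x : cN (emb x) = `|x|.
Proof. by rewrite cNE cre_emb cim_emb expr0n addr0 sqrtr_sqr. Qed.
Lemma cN_ci : cN (ci R) = 1.
Proof. by rewrite cNE cre_ci cim_ci expr0n add0r expr1n sqrtr1. Qed.
Lemma cNX z n : cN (z ^+ n) = cN z ^+ n.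
Proof. by elim: n => [|n IH]; rewrite ?expr0 ?cN1 // !exprS cNM IH. Qed.
Lemma cNV z : cN (z^-1) = (cN z)^-1.
Proof. by apply: (@fmorph_inj _ _ (@emb R)); rewrite fmorphV /= -!norm_cN normfV. Qed.
Lemma cN_nat n : cN (n%:R : C) = n%:R.
Proof. by apply: (@fmorph_inj _ _ (@emb R)); rewrite rmorph_nat /= -!norm_cN normr_nat. Qed.
Lemma cre_le z : `|cre z| <= cN z.
Proof. by rewrite cNE -sqrtr_sqr ler_wsqrtr // lerDl sqr_ge0. Qed.
Lemma cim_le z : `|cim z| <= cN z.
Proof. by rewrite cNE -sqrtr_sqr ler_wsqrtr // lerDr sqr_ge0. Qed.
Lemma cN_le z : cN z <= `|cre z| + `|cim z|.
Proof.
rewrite {1}[z]cE (le_trans (cND _ _)) // cNM cN_ci mul1r !cN_emb; exact: lexx.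
Qed.
Lemma cN_sum (I : Type) (r : seq I) (P : pred I) (F : I -> C) :
  cN (\sum_(i <- r | P i) F i) <= \sum_(i <- r | P i) cN (F i).
Proof.
elim/big_ind2 : _ => //; first by rewrite cN0.
by move=> x1 x2 y1 y2 h1 h2; rewrite (le_trans (cND _ _)) // lerD.
Qed.

Lemma nbhsC z (A : set C) :
  nbhs z A <-> exists2 r : R, 0 < r & forall w, cN (w - z) < r -> A w.
Proof.
rewrite -nbhs_ballE; split=> [[e /= e0 zA]|[r r0 zA]].
  have [r r0 er] := emb_gt0 e0; exists r => // w wr; apply: zA.
  by rewrite /ball /= er distrC norm_cN emb_lt.
exists (emb r); first by rewrite /= -(rmorph0 (@emb R)) /= emb_lt.
by move=> w; rewrite /ball /= distrC norm_cN emb_lt => /zA.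
Qed.

Lemma nearC z (P : C -> Prop) :
  (\forall w \near z, P w) <-> exists2 r : R, 0 < r & forall w, cN (w - z) < r -> P w.
Proof. exact: nbhsC. Qed.

Definition hd (f : C -> C) z (d : C) : Prop := is_derive (z : C) (1 : C) f d.

Lemma cvgC (F : C -> C) (a l : C) : F @ a^' --> l <->
  forall e : R, 0 < e -> exists2 d : R, 0 < d & forall w, w != a -> cN (w - a) < d ->
    cN (F w - l) < e.
Proof.
split=> [Fl e e0|H].
  have /Fl : nbhs l [set w | cN (w - l) < e] by apply/nbhsC; exists e.
  rewrite /nbhs /= /dnbhs /within /= => /nbhsC[d d0 dP]; exists d => // w wa wd.
  exact: dP.
move=> A /nbhsC[e e0 eA]; have [d d0 dP] := H e e0.
by apply/nbhsC; exists d => // w wd wa; apply: eA; apply: dP.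
Qed.

(** The remainder form allows h = 0, which spares the later estimates any punctured
    neighbourhood. *)
Lemma hdP (f : C -> C) z d : hd f z d <->
  forall e : R, 0 < e -> exists2 dl : R, 0 < dl &
    forall h, cN h < dl -> cN (f (z + h) - f z - h * d) <= e * cN h.
Proof.
have E h : h != 0 ->
    cN (h^-1 *: ((f \o shift z) (h *: (1 : C)) - f z) - d) * cN h =
    cN (f (z + h) - f z - h * d).
  move=> h0; rewrite -cNM /shift /= /GRing.scale /= mulr1 [h + z]addrC.
  by congr cN; rewrite mulrBl mulrAC mulVf // mul1r [d * h]mulrC.
have key : ((fun h => h^-1 *: ((f \o shift z) (h *: (1 : C)) - f z)) @ (0 : C)^' --> d) <->
  (forall e : R, 0 < e -> exists2 dl : R, 0 < dl &
    forall h, cN h < dl -> cN (f (z + h) - f z - h * d) <= e * cN h).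
  rewrite cvgC; split=> H e e0.
    have [dl dl0 dP] := H e e0; exists dl => // h hd.
    have [->|h0] := eqVneq h 0; first by rewrite addr0 subrr mul0r subr0 cN0 mulr0.
    by rewrite -E // ler_pM2r ?cN_gt0 // ltW // dP // subr0.
  have [dl dl0 dP] := H (e / 2) (divr_gt0 e0 (ltr0n _ 2)); exists dl => // h h0.
  rewrite subr0 => hd; rewrite -(@ltr_pM2r _ (cN h)) ?cN_gt0 // E //.
  rewrite (le_lt_trans (dP h hd)) // ltr_pM2r ?cN_gt0 //.
  by rewrite ltr_pdivrMr // ltr_pMr // ltr1n.
split=> [[df dv]|/key H].
  apply/key; have := df; rewrite /derivable => /cvg_ex[l /= Hl].
  suff <- : l = d by [].
  by rewrite -dv /derive; apply/esym/(cvg_lim (@norm_hausdorff _ _)).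
split; first by apply/cvg_ex; exists d.
exact/(cvg_lim (@norm_hausdorff _ _)).
Qed.
End ComplexNorm.

(** * Rules for complex derivatives *)

Section ComplexDerivative.
Variable R : realType.
Local Notation C := (Cx R).
Implicit Types (z w : C) (x y : R) (f g : C -> C).

Lemma hd_derivable f z d : hd f z d -> derivable f z 1.
Proof. by case. Qed.
Lemma hd_val f z d : hd f z d -> 'D_1 f z = d.
Proof. by case. Qed.
Lemma derivable_hd f z : derivable f z 1 -> hd f z (f^`()%classic z).
Proof. by move=> df; rewrite derive1E; split. Qed.
Lemma hd_uniq f z d d' : hd f z d -> hd f z d' -> d = d'.
Proof. by move=> [_ <-] [_ <-]. Qed.

Lemma hd_cst c z : hd (fun=> c) z 0.
Proof. exact: is_derive_cst. Qed.
Lemma hd_id z : hd (fun w => w) z 1.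
Proof. exact: is_derive_id. Qed.
Lemma hdD f g z a b : hd f z a -> hd g z b -> hd (fun w => f w + g w) z (a + b).
Proof. exact: is_deriveD. Qed.
Lemma hdN f z a : hd f z a -> hd (fun w => - f w) z (- a).
Proof. exact: is_deriveN. Qed.
Lemma hdB f g z a b : hd f z a -> hd g z b -> hd (fun w => f w - g w) z (a - b).
Proof. by move=> fa gb; apply: hdD => //; apply: hdN. Qed.
Lemma hd_eq f z a b : hd f z a -> a = b -> hd f z b.
Proof. by move=> ? <-. Qed.
Lemma hdM f g z a b : hd f z a -> hd g z b ->
  hd (fun w => f w * g w) z (a * g z + f z * b).
Proof.
move=> fa gb; apply: hd_eq (is_deriveM fa gb) _.
by rewrite /GRing.scale /= addrC [g z * a]mulrC.
Qed.
Lemma hdZ c f z a : hd f z a -> hd (fun w => c * f w) z (c * a).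
Proof. by move=> fa; apply: hd_eq (hdM (hd_cst c z) fa) _; rewrite mul0r add0r. Qed.
Lemma hdV f z a : hd f z a -> f z != 0 -> hd (fun w => (f w)^-1) z (- a / f z ^+ 2).
Proof.
move=> fa f0; split; first by apply: derivableV => //; case: fa.
rewrite deriveV //; last by case: fa.
by rewrite (hd_val fa) /GRing.scale /=; ring.
Qed.
Lemma hdX f z a n : hd f z a -> hd (fun w => f w ^+ n) z (n%:R * f z ^+ n.-1 * a).
Proof.
move=> fa; elim: n => [|n IH]; first by rewrite !mul0r; apply: hd_cst.
rewrite (_ : (fun w => f w ^+ n.+1) = fun w => f w * f w ^+ n); last first.
  by apply/funext => w; rewrite exprS.
apply: hd_eq (hdM fa IH) _; case: n {IH} => [|n] /=.
  by rewrite !expr0 !mul0r !mulr0 addr0 mulr1 !mul1r.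
by rewrite -[n.+2%:R]natr1 !exprS; ring.
Qed.

Lemma hd_comp f g z a b : hd f z a -> hd g (f z) b -> hd (fun w => g (f w)) z (b * a).
Proof.
move=> /hdP fa /hdP gb; apply/hdP => e e0.
pose K := cN a + 1; have K0 : 0 < K by rewrite ltr_wpDl ?cN_ge0.
pose L := cN b + 1; have L0 : 0 < L by rewrite ltr_wpDl ?cN_ge0.
have [d1 d10 D1] := gb (e / (2 * K)) (divr_gt0 e0 (mulr_gt0 (ltr0n _ 2) K0)).
have [d2 d20 D2] := fa (Num.min 1 (e / (2 * L)))
  (ltac:(by rewrite lt_min ltr01 divr_gt0 ?mulr_gt0)).
have dK0 : 0 < d1 / K by rewrite divr_gt0.
exists (Num.min d2 (d1 / K)); first by rewrite lt_min d20.
move=> h; rewrite lt_min => /andP[h2 h1].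
have {}D2 := D2 h h2; set k := f (z + h) - f z.
have D2a : cN (k - h * a) <= cN h.
  rewrite (le_trans D2) // ler_piMl ?cN_ge0 //; by rewrite ge_min lexx.
have D2b : cN (k - h * a) <= e / (2 * L) * cN h.
  rewrite (le_trans D2) // ler_wpM2r ?cN_ge0 //; by rewrite ge_min lexx orbT.
have kK : cN k <= K * cN h.
  rewrite -[k](subrK (h * a)) (le_trans (cND _ _)) // /K mulrDl mul1r addrC.
  by rewrite lerD // cNM mulrC.
have kd : cN k < d1.
  by rewrite (le_lt_trans kK) // mulrC -ltr_pdivlMr.
have {}D1 := D1 k kd.
have fk : f (z + h) = f z + k by rewrite /k [RHS]addrC subrK.
rewrite fk (_ : _ - _ = (g (f z + k) - g (f z) - k * b) + (k - h * a) * b); last by ring.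
rewrite (le_trans (cND _ _)) // [X in _ <= X * _]splitr [leRHS]mulrDl lerD //.
  rewrite (le_trans D1) //.
  rewrite (_ : e / 2 * cN h = e / (2 * K) * (K * cN h)).
    by rewrite ler_wpM2l // ltW // divr_gt0 ?mulr_gt0.
  by field; rewrite gt_eqF.
rewrite cNM; apply: (@le_trans _ _ (e / (2 * L) * cN h * L)).
  by rewrite ler_pM ?cN_ge0 // /L lerDl.
by rewrite le_eqVlt; apply/orP; left; apply/eqP; field; rewrite gt_eqF.
Qed.

Lemma hd_near f g z d : hd f z d -> (\forall w \near z, f w = g w) -> hd g z d.
Proof.
by move=> fd fg; apply: near_eq_is_derive fg fd.
Qed.

Lemma hd_cont f z d : hd f z d -> forall e : R, 0 < e -> exists2 dl : R, 0 < dl &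
  forall w, cN (w - z) < dl -> cN (f w - f z) < e.
Proof.
move=> /hdP/(_ 1 ltr01)[d1 d10 D1] e e0.
pose K := cN d + 2; have K0 : 0 < K by rewrite ltr_wpDl ?cN_ge0.
exists (Num.min d1 (e / K)); first by rewrite lt_min d10 divr_gt0.
move=> w; rewrite lt_min => /andP[w1 w2].
have := D1 _ w1; rewrite [z + _]addrC subrK mul1r => H.
have [->|wz] := eqVneq w z; first by rewrite subrr cN0.
rewrite -[f w - _](subrK ((w - z) * d)) (le_lt_trans (cND _ _)) //.
apply: (@lt_trans _ _ (K * cN (w - z))); last by rewrite mulrC -ltr_pdivlMr.
apply: (@le_lt_trans _ _ (cN (w - z) + cN (w - z) * cN d)); first by rewrite cNM lerD2r.
rewrite /K mulrDl [X in _ < X]addrC mulrC ltrD2r mulr2n mulrDl mul1r ltrDl.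
by rewrite cN_gt0 subr_eq0.
Qed.

Lemma rdP (f : R -> R) (t d : R) : is_derive t (1 : R) f d <->
  forall e : R, 0 < e -> exists2 dl : R, 0 < dl &
    forall h, `|h| < dl -> `|f (t + h) - f t - h * d| <= e * `|h|.
Proof.
have E h : h != 0 ->
    `|h^-1 *: ((f \o shift t) (h *: (1 : R)) - f t) - d| * `|h| =
    `|f (t + h) - f t - h * d|.
  move=> h0; rewrite -normrM /shift /= /GRing.scale /= mulr1 [h + t]addrC.
  by congr `| _ |; rewrite mulrBl mulrAC mulVf // mul1r [d * h]mulrC.
have key : ((fun h => h^-1 *: ((f \o shift t) (h *: (1 : R)) - f t)) @ (0 : R)^' --> d) <->
  (forall e : R, 0 < e -> exists2 dl : R, 0 < dl &
    forall h, `|h| < dl -> `|f (t + h) - f t - h * d| <= e * `|h|).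
  split=> [/cvgr_dist_lt H e e0|H].
    have := H e e0; rewrite near_withinE => /nbhs_normP[dl /= dl0 dP]; exists dl => // h hd.
    have [->|h0] := eqVneq h 0; first by rewrite addr0 subrr mul0r subr0 normr0 mulr0.
    rewrite -E // ler_pM2r ?normr_gt0 // ltW // distrC; apply: dP => //=.
    by rewrite sub0r normrN.
  apply/cvgrPdist_le => e e0; have [dl dl0 dP] := H e e0.
  rewrite near_withinE; apply/nbhs_normP; exists dl => //= h /=.
  rewrite sub0r normrN => hd h0.
  by rewrite distrC -(@ler_pM2r _ `|h|) ?normr_gt0 // E // dP.
split=> [[df dv]|/key H].
  apply/key; have := df; rewrite /derivable => /cvg_ex[l /= Hl].
  suff <- : l = d by [].
  by rewrite -dv /derive; apply/esym/(cvg_lim (@norm_hausdorff _ _)).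
split; first by apply/cvg_ex; exists d.
exact/(cvg_lim (@norm_hausdorff _ _)).
Qed.

Lemma hd_line_re f p v t a : hd f (p + emb t * v) a ->
  is_derive t (1 : R) (fun s => cre (f (p + emb s * v))) (cre (a * v)).
Proof.
move=> /hdP fa; apply/rdP => e e0.
pose K := cN v + 1; have K0 : 0 < K by rewrite ltr_wpDl ?cN_ge0.
have [d d0 dP] := fa (e / K) (divr_gt0 e0 K0).
exists (d / K) => [|h hh]; first exact: divr_gt0.
have hv : cN (emb h * v) <= `|h| * K by rewrite cNM cN_emb ler_wpM2l // /K lerDl.
have hd : cN (emb h * v) < d by rewrite (le_lt_trans hv) // -ltr_pdivlMr.
have := dP _ hd; rewrite (_ : p + _ + _ = p + emb (t + h) * v); last first.
  by rewrite rmorphD /=; ring.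
move=> H; have := le_trans (cre_le _) H; rewrite !raddfB /=.
rewrite (_ : cre (emb h * v * a) = h * cre (a * v)); last first.
  by rewrite !creM !cimM cre_emb cim_emb; ring.
move=> H2; rewrite (le_trans H2) // mulrAC ler_pdivrMr //.
by rewrite -mulrA ler_wpM2l // ltW.
Qed.

Lemma hd0_cst f p q :
  (forall t : R, 0 <= t <= 1 -> hd f (p + emb t * (q - p)) 0) -> f q = f p.
Proof.
move=> H.
(* The mean value theorem needs real values, so it is applied to the real part of c f along the
   segment; c = 1 and c = i recover f. *)
have key (c : C) : cre (c * f q) = cre (c * f p).
  pose g (s : R) := cre (c * f (p + emb s * (q - p))).
  have gd (t : R) : 0 <= t <= 1 -> is_derive t (1 : R) g 0.
    move=> t01; have := hd_line_re (hdZ c (H t t01)).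
    by rewrite mulr0 mul0r raddf0.
  have [||x _] := @MVT_segment _ g (fun=> 0) 0 1 ler01.
  - by move=> x; rewrite in_itv /= => /andP[x0 x1]; apply: gd; rewrite !ltW.
  - apply: derivable_within_continuous => x; rewrite in_itv /= => /gd[gx _].
    exact: gx.
  rewrite mul0r /g rmorph1 rmorph0 mul1r mul0r addr0 [p + _]addrC subrK.
  by move=> /eqP; rewrite subr_eq0 => /eqP.
apply: cext; first by have := key 1; rewrite !mul1r.
have := key (ci R); rewrite !creM cre_ci cim_ci !mul0r !mul1r !sub0r.
exact: oppr_inj.
Qed.
End ComplexDerivative.

(** * Integrals along segments and the identity theorem *)

Section RealIntegral.
Variable R : realType.
Implicit Types (f g : R -> R) (a b c : R).
Local Notation mu := (@lebesgue_measure R).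

(** Differentiability on the closed interval replaces continuity as the working hypothesis: function
    elements provide it, and it yields integrability. *)
Definition dgood f a b := forall x, a <= x <= b -> derivable f x 1.
Definition rI f a b : R := \int[mu]_(x in `[a, b]) f x.

Lemma dgoodZ c f a b : dgood f a b -> dgood (fun x => c * f x) a b.
Proof. by move=> H x /H fx; exact: (derivableZ fx). Qed.

Lemma dgood_cont f a b : dgood f a b -> {within `[a, b], continuous f}.
Proof.
by move=> H; apply: derivable_within_continuous => x; rewrite in_itv /= => /H.
Qed.

Lemma dgood_int f a b : dgood f a b -> mu.-integrable `[a, b] (EFin \o f).
Proof.
move=> H; apply: continuous_compact_integrable; first exact: segment_compact.
exact: dgood_cont.
Qed.

Lemma rI_split f a b c : dgood f a b -> a <= c -> c <= b ->
  rI f a b = rI f a c + rI f c b.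
Proof.
move=> H ac cb; have := @Rintegral_itvB _ f (BLeft a) (BRight b) c (dgood_int H).
rewrite !bnd_simp => /(_ ac cb) /eqP; rewrite subr_eq => /eqP.
rewrite /rI => ->; rewrite addrC; congr (_ + _).
apply: Rintegral_itv_obnd_cbnd; apply: (integrableS _ _ _ (dgood_int H)) => //.
by move=> x /=; rewrite !in_itv /= => /andP[/ltW cx ->]; rewrite (le_trans ac cx).
Qed.

Lemma rI_D f g a b : dgood f a b -> dgood g a b ->
  rI (fun x => f x + g x) a b = rI f a b + rI g a b.
Proof. by move=> fg gg; apply: RintegralD => //; apply: dgood_int. Qed.

Lemma rI_Z c f a b : dgood f a b -> rI (fun x => c * f x) a b = c * rI f a b.
Proof. by move=> fg; apply: RintegralZl => //; apply: dgood_int. Qed.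

Lemma eq_rI f g a b : (forall x, a <= x <= b -> f x = g x) -> rI f a b = rI g a b.
Proof.
by move=> H; apply: eq_Rintegral => x; rewrite inE /= in_itv /= => /H.
Qed.

Lemma rI_cst c a b : a <= b -> rI (fun=> c) a b = c * (b - a).
Proof.
move=> ab; rewrite /rI Rintegral_cst //= lebesgue_measure_itv /= lte_fin.
by case: ltgtP ab => //= -> _; rewrite subrr.
Qed.

Lemma rI_le f g a b : dgood f a b -> dgood g a b ->
  (forall x, a <= x <= b -> f x <= g x) -> rI f a b <= rI g a b.
Proof.
move=> fg gg H; apply: le_Rintegral => //; exact: dgood_int.
Qed.

Lemma dgood_cst c a b : dgood (fun=> c) a b.
Proof. by move=> x _; apply: derivable_cst. Qed.

Lemma rI_bound f a b M : a <= b -> dgood f a b ->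
  (forall x, a <= x <= b -> `|f x| <= M) -> `|rI f a b| <= M * (b - a).
Proof.
move=> ab fg H; rewrite ler_norml; apply/andP; split.
  rewrite -mulNr -rI_cst //; apply: rI_le fg _; first exact: dgood_cst.
  by move=> x /H; rewrite ler_norml => /andP[].
rewrite -rI_cst //; apply: rI_le fg _ _; first exact: dgood_cst.
by move=> x /H; rewrite ler_norml => /andP[].
Qed.

Lemma rI_FTC f F a b : a <= b -> dgood f a b ->
  (forall x, a <= x <= b -> is_derive x (1 : R) F (f x)) ->
  rI f a b = F b - F a.
Proof.
move=> ab fg Fd; have [<-|ab'] := eqVneq a b.
  by rewrite /rI set_itv1 Rintegral_set1 subrr.
have {ab'}ab' : a < b by rewrite lt_neqAle ab' ab.
have Fg : dgood F a b by move=> x /Fd[].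
rewrite /rI /Rintegral (@continuous_FTC2 _ f F) //; first exact: dgood_cont.
  have [_ Fa Fb] := (continuous_within_itvP F ab').1 (dgood_cont Fg).
  split => //; move=> x; rewrite in_itv /= => /andP[x1 x2].
  by apply: Fg; rewrite !ltW.
move=> x; rewrite in_itv /= => /andP[x1 x2]; rewrite derive1E.
by have [|_ ->] := Fd x; rewrite ?ltW.
Qed.

Lemma dgood_bounded f a b : a <= b -> dgood f a b ->
  exists M, forall x, a <= x <= b -> `|f x| <= M.
Proof.
move=> ab fg.
have [c _ cP] := EVT_max ab (dgood_cont fg).
have [d _ dP] := EVT_min ab (dgood_cont fg).
exists (`|f c| + `|f d|) => x xab.
have /cP h1 : x \in `[a, b]%R by rewrite in_itv.
have /dP h2 : x \in `[a, b]%R by rewrite in_itv.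
rewrite ler_norml; apply/andP; split.
  by rewrite (le_trans _ h2) // lerNl (le_trans (ler_norm _)) // normrN lerDr normr_ge0.
by rewrite (le_trans h1) // (le_trans (ler_norm _)) // lerDl normr_ge0.
Qed.
End RealIntegral.

Section SegmentIntegral.
Variable R : realType.
Local Notation C := (Cx R).
Implicit Types (z w p v : C) (f g : C -> C) (a b c : R).

Lemma hd_line_im f p v t d : hd f (p + emb t * v) d ->
  is_derive t (1 : R) (fun s => cim (f (p + emb s * v))) (cim (d * v)).
Proof.
move=> H; have E z : cim z = cre (- ci R * z).
  by rewrite mulNr raddfN /= creM cre_ci cim_ci; ring.
rewrite E mulrA; have := hd_line_re (hdZ (- ci R) H).
by rewrite (_ : (fun s : R => _) = fun s => cim (f (p + emb s * v))) //; apply/funext => s; rewrite E.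
Qed.

Definition sgood f p v a b := forall s : R, a <= s <= b -> exists d, hd f (p + emb s * v) d.
(** The integral with respect to the parameter s: the factor v = dz/ds is left out and reappears in
    [sI_FTC]. *)
Definition sI f p v a b : C :=
  emb (rI (fun s => cre (f (p + emb s * v))) a b)
  + ci R * emb (rI (fun s => cim (f (p + emb s * v))) a b).

Lemma sgood_re f p v a b : sgood f p v a b -> dgood (fun s => cre (f (p + emb s * v))) a b.
Proof. by move=> H x /H[d /hd_line_re[]]. Qed.
Lemma sgood_im f p v a b : sgood f p v a b -> dgood (fun s => cim (f (p + emb s * v))) a b.
Proof. by move=> H x /H[d /hd_line_im[]]. Qed.

Lemma sI_split f p v a b c : sgood f p v a b -> a <= c -> c <= b ->
  sI f p v a b = sI f p v a c + sI f p v c b.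
Proof.
move=> H ac cb; rewrite /sI (rI_split (sgood_re H) ac cb) (rI_split (sgood_im H) ac cb).
by rewrite !rmorphD /=; ring.
Qed.

Lemma sI_D f g p v a b : sgood f p v a b -> sgood g p v a b ->
  sI (fun z => f z + g z) p v a b = sI f p v a b + sI g p v a b.
Proof.
move=> fg gg; rewrite /sI.
have -> : (fun s => cre (f (p + emb s * v) + g (p + emb s * v))) =
  (fun s => cre (f (p + emb s * v)) + cre (g (p + emb s * v))).
  by apply/funext => s; rewrite raddfD.
have -> : (fun s => cim (f (p + emb s * v) + g (p + emb s * v))) =
  (fun s => cim (f (p + emb s * v)) + cim (g (p + emb s * v))).
  by apply/funext => s; rewrite raddfD.
rewrite (rI_D (sgood_re fg) (sgood_re gg)) (rI_D (sgood_im fg) (sgood_im gg)).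
by rewrite !rmorphD /=; ring.
Qed.

(** The factor 2 comes from bounding the real and the imaginary part separately. *)
Lemma sI_bound f p v a b M : a <= b -> sgood f p v a b ->
  (forall s, a <= s <= b -> cN (f (p + emb s * v)) <= M) ->
  cN (sI f p v a b) <= 2 * M * (b - a).
Proof.
move=> ab fg H; rewrite (le_trans (cND _ _)) // cNM cN_ci mul1r !cN_emb.
rewrite mulr2n -mulrA mulrDl mul1r lerD //; apply: rI_bound => //.
- exact: sgood_re.
- by move=> x /H; apply: le_trans (cre_le _).
- exact: sgood_im.
- by move=> x /H; apply: le_trans (cim_le _).
Qed.

Lemma sgoodZ (c : C) f p v a b : sgood f p v a b -> sgood (fun z => c * f z) p v a b.
Proof. by move=> H s /H[d /(hdZ c) ?]; exists (c * d). Qed.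

Lemma sI_FTC f F p v a b : a <= b -> sgood f p v a b ->
  (forall s, a <= s <= b -> hd F (p + emb s * v) (f (p + emb s * v))) ->
  v * sI f p v a b = F (p + emb b * v) - F (p + emb a * v).
Proof.
move=> ab fg Fd; have vfg := sgoodZ v fg.
have E : forall s, cre (f (p + emb s * v) * v) = cre (v * f (p + emb s * v)).
  by move=> s; rewrite mulrC.
have h1 : rI (fun s => cre (v * f (p + emb s * v))) a b =
    cre (F (p + emb b * v)) - cre (F (p + emb a * v)).
  apply: (@rI_FTC _ _ (fun s => cre (F (p + emb s * v)))) => //; first exact: sgood_re vfg.
  by move=> x /Fd /hd_line_re; rewrite mulrC.
have h2 : rI (fun s => cim (v * f (p + emb s * v))) a b =
    cim (F (p + emb b * v)) - cim (F (p + emb a * v)).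
  apply: (@rI_FTC _ _ (fun s => cim (F (p + emb s * v)))) => //; first exact: sgood_im vfg.
  by move=> x /Fd /hd_line_im; rewrite mulrC.
have G1 := sgood_re fg; have G2 := sgood_im fg.
have e1 : rI (fun s => cre (v * f (p + emb s * v))) a b =
    cre v * rI (fun s => cre (f (p + emb s * v))) a b +
    (- cim v) * rI (fun s => cim (f (p + emb s * v))) a b.
  rewrite -!rI_Z // -rI_D; [|exact: dgoodZ|exact: dgoodZ].
  by apply: eq_rI => s _; rewrite creM mulNr.
have e2 : rI (fun s => cim (v * f (p + emb s * v))) a b =
    cre v * rI (fun s => cim (f (p + emb s * v))) a b +
    cim v * rI (fun s => cre (f (p + emb s * v))) a b.
  rewrite -!rI_Z // -rI_D; [|exact: dgoodZ|exact: dgoodZ].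
  by apply: eq_rI => s _; rewrite cimM.
apply: cext; rewrite raddfB /= -?h1 -?h2 ?e1 ?e2 /sI ?creM ?cimM !raddfD /=;
  by rewrite !creM !cimM !cre_ci !cim_ci !cre_emb !cim_emb; ring.
Qed.

Lemma sgood_bounded f p v a b : a <= b -> sgood f p v a b ->
  exists M, forall s, a <= s <= b -> cN (f (p + emb s * v)) <= M.
Proof.
move=> ab fg; have [M1 H1] := dgood_bounded ab (sgood_re fg).
have [M2 H2] := dgood_bounded ab (sgood_im fg).
by exists (M1 + M2) => s sab; rewrite (le_trans (cN_le _)) // lerD ?H1 ?H2.
Qed.
End SegmentIntegral.

(** * Goursat's lemma for rectangles *)

Section Goursat.
Variable R : realType.
Local Notation C := (Cx R).
Implicit Types (z w : C) (f g F : C -> C) (a b c d x y m M : R).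

Definition pt x y : C := emb x + ci R * emb y.
Definition hI f y a b := sI f (ci R * emb y) 1 a b.
Definition vI f x c d := sI f (emb x) (ci R) c d.
(** The integral of f dz counterclockwise around a rectangle, with dz = i dy on the vertical
    sides. *)
Definition bd f a b c d : C :=
  hI f c a b - hI f d a b + ci R * vI f b c d - ci R * vI f a c d.
Definition Rgood f a b c d :=
  forall x y, a <= x <= b -> c <= y <= d -> exists D, hd f (pt x y) D.

Lemma ptH y s : ci R * emb y + emb s * 1 = pt s y.
Proof. by rewrite /pt mulr1 addrC. Qed.
Lemma ptV x s : emb x + emb s * ci R = pt x s.
Proof. by rewrite /pt mulrC. Qed.
Lemma cre_pt x y : cre (pt x y) = x.
Proof. by rewrite raddfD /= creM !cre_emb cre_ci cim_ci cim_emb; ring. Qed.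
Lemma cim_pt x y : cim (pt x y) = y.
Proof. by rewrite raddfD /= cimM cre_ci cim_ci !cim_emb !cre_emb; ring. Qed.

Lemma RgoodH f a b c d y : Rgood f a b c d -> c <= y <= d -> sgood f (ci R * emb y) 1 a b.
Proof. by move=> H yc s sa; rewrite ptH; apply: H. Qed.
Lemma RgoodV f a b c d x : Rgood f a b c d -> a <= x <= b -> sgood f (emb x) (ci R) c d.
Proof. by move=> H yc s sa; rewrite ptV; apply: H. Qed.
Lemma RgoodS f a b c d a' b' c' d' : Rgood f a b c d ->
  a <= a' -> b' <= b -> c <= c' -> d' <= d -> Rgood f a' b' c' d'.
Proof.
move=> H h1 h2 h3 h4 x y /andP[x1 x2] /andP[y1 y2].
by apply: H; rewrite ?(le_trans h1) ?(le_trans x2) ?(le_trans h3) ?(le_trans y2).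
Qed.

(** Only the sides are constrained, so that additivity and bounds also apply to integrands with a
    singularity inside. *)
Definition Bgood f a b c d := [/\ sgood f (ci R * emb c) 1 a b,
  sgood f (ci R * emb d) 1 a b, sgood f (emb a) (ci R) c d & sgood f (emb b) (ci R) c d].

Lemma Rgood_Bgood f a b c d : a <= b -> c <= d -> Rgood f a b c d -> Bgood f a b c d.
Proof.
move=> ab cd H; split; [apply: RgoodH H _|apply: RgoodH H _|apply: RgoodV H _|
  apply: RgoodV H _]; by rewrite ?lexx ?ab ?cd.
Qed.

Lemma bd_hsplit f a b c d m : Bgood f a b c d -> a <= m <= b ->
  bd f a b c d = bd f a m c d + bd f m b c d.
Proof.
move=> [Hc Hd _ _] /andP[am mb]; rewrite /bd /hI.
by rewrite (sI_split Hc am mb) (sI_split Hd am mb); ring.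
Qed.

Lemma bd_vsplit f a b c d m : Bgood f a b c d -> c <= m <= d ->
  bd f a b c d = bd f a b c m + bd f a b m d.
Proof.
move=> [_ _ Ha Hb] /andP[cm md]; rewrite /bd /vI.
by rewrite (sI_split Ha cm md) (sI_split Hb cm md); ring.
Qed.

Lemma bd_bound f a b c d M : a <= b -> c <= d -> Bgood f a b c d ->
  (forall x y, a <= x <= b -> c <= y <= d -> (y == c) || (y == d) || (x == a) || (x == b) ->
    cN (f (pt x y)) <= M) -> cN (bd f a b c d) <= 4 * M * ((b - a) + (d - c)).
Proof.
move=> ab cd [Hc Hd Ha Hb] HM.
have e (y : R) : c <= y <= d -> (y == c) || (y == d) -> cN (hI f y a b) <= 2 * M * (b - a).
  move=> yc yy; apply: sI_bound => //; first by case/orP: yy => /eqP ->.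
  by move=> s sa; rewrite ptH; apply: HM => //; rewrite yy.
have e' (x : R) : a <= x <= b -> (x == a) || (x == b) -> cN (ci R * vI f x c d) <= 2 * M * (d - c).
  move=> yc yy; rewrite cNM cN_ci mul1r; apply: sI_bound => //; first by case/orP: yy => /eqP ->.
  by move=> s sa; rewrite ptV; apply: HM => //; rewrite -orbA yy orbT.
rewrite /bd (le_trans (cNB _ _)) //.
have -> : 4 * M * (b - a + (d - c)) = 2 * M * (b - a) + 2 * M * (b - a) + 2 * M * (d - c)
  + 2 * M * (d - c) by ring.
rewrite lerD ?e' ?lexx ?ab ?eqxx ?orbT // (le_trans (cND _ _)) //.
rewrite lerD ?e' ?lexx ?ab ?eqxx ?orbT // (le_trans (cNB _ _)) //.
by rewrite lerD ?e ?lexx ?cd ?eqxx ?orbT.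
Qed.

Lemma bd_D f g a b c d : Bgood f a b c d -> Bgood g a b c d ->
  bd (fun z => f z + g z) a b c d = bd f a b c d + bd g a b c d.
Proof.
move=> [fc fd' fa fb] [gc gd ga gb]; rewrite /bd /hI /vI.
rewrite (sI_D fc gc) (sI_D fd' gd).
by rewrite (sI_D fa ga) (sI_D fb gb); ring.
Qed.

Lemma bd_prim f F a b c d : a <= b -> c <= d -> Rgood f a b c d ->
  (forall x y, a <= x <= b -> c <= y <= d -> hd F (pt x y) (f (pt x y))) ->
  bd f a b c d = 0.
Proof.
move=> ab cd H HF.
have e (y : R) : c <= y <= d -> hI f y a b = F (pt b y) - F (pt a y).
  move=> yc; rewrite /hI -[LHS]mul1r (@sI_FTC _ _ F) //.
  - by rewrite !ptH.
  - exact: RgoodH H _.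
  - by move=> s sa; rewrite ptH; apply: HF.
have e' (x : R) : a <= x <= b -> ci R * vI f x c d = F (pt x d) - F (pt x c).
  move=> yc; rewrite /vI (@sI_FTC _ _ F) //.
  - by rewrite !ptV.
  - exact: RgoodV H _.
  - by move=> s sa; rewrite ptV; apply: HF.
rewrite /bd !e' ?lexx ?ab // !e ?lexx ?cd //; ring.
Qed.

(** Bisection by contradiction. If the integral is nonzero, it exceeds e L^2 for some e > 0, where L
    is the half-perimeter. This inequality is inherited by one quarter at each step, and fails near
    the limit point because f is differentiable there. *)
Lemma Goursat f a b c d : a <= b -> c <= d -> Rgood f a b c d -> bd f a b c d = 0.
Proof.
move=> ab cd H; apply/eqP; apply: contraT => bd0.
pose L0 := (b - a) + (d - c).
have L00 : 0 <= L0 by rewrite addr_ge0 ?subr_ge0.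
have L01 : 0 < L0 ^+ 2 + 1 by rewrite ltr_wpDl // sqr_ge0.
(* The summand 1 makes the initial inequality strict and covers the degenerate rectangle with [L0] =
   0. *)
pose e := cN (bd f a b c d) / (L0 ^+ 2 + 1).
have e0 : 0 < e by rewrite divr_gt0 // cN_gt0.
pose half (l r : R) (s : bool) := if s then (l, (l + r) / 2) else ((l + r) / 2, r).
pose big l r u v := e * ((r - l) + (v - u)) ^+ 2 < cN (bd f l r u v).
pose ok (q : (R * R) * (R * R)) := [/\ q.1.1 <= q.1.2, q.2.1 <= q.2.2,
  a <= q.1.1 /\ q.1.2 <= b & c <= q.2.1 /\ q.2.2 <= d] /\ big q.1.1 q.1.2 q.2.1 q.2.2.
have hl l r s : l <= r -> [/\ (half l r s).1 <= (half l r s).2,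
    l <= (half l r s).1, (half l r s).2 <= r &
    (half l r s).2 - (half l r s).1 = (r - l) / 2].
  by move=> lr; rewrite /half; case: s => /=; split; lra.
have step (q : (R * R) * (R * R)) : exists s : bool * bool, ok q ->
    ok (half q.1.1 q.1.2 s.1, half q.2.1 q.2.2 s.2).
  have [okq|] := pselect (ok q); last by exists (true, true).
  case: q okq => [[a1 b1] [c1 d1]] okq.
  have [[/= ab1 cd1 [aa1 bb1] [cc1 dd1]] bigq] := okq.
  have [[s sP]|no] := pselect (exists s : bool * bool,
     big (half a1 b1 s.1).1 (half a1 b1 s.1).2 (half c1 d1 s.2).1 (half c1 d1 s.2).2).
    exists s => _; have [h1 h2 h3 _] := hl a1 b1 s.1 ab1.
    have [k1 k2 k3 _] := hl c1 d1 s.2 cd1.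
    by split=> //; split=> //=; split; lra.
  (* If no quarter were big, four bounds e L^2 / 4 would add up to e L^2, against the bigness of the
     whole rectangle. *)
  exfalso; pose m := (a1 + b1) / 2; pose n := (c1 + d1) / 2.
  have am : a1 <= m by rewrite /m; lra.
  have mb : m <= b1 by rewrite /m; lra.
  have cn : c1 <= n by rewrite /n; lra.
  have nd : n <= d1 by rewrite /n; lra.
  have H1 := RgoodS H aa1 bb1 cc1 dd1.
  have amb : a1 <= m <= b1 by rewrite am mb.
  have cnd : c1 <= n <= d1 by rewrite cn nd.
  have le4 s1 s2 : cN (bd f (half a1 b1 s1).1 (half a1 b1 s1).2 (half c1 d1 s2).1 (half c1 d1 s2).2)
      <= e * ((b1 - a1) + (d1 - c1)) ^+ 2 / 4.
    rewrite leNgt; apply/negP => h; apply: no; exists (s1, s2); rewrite /big /=.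
    have [_ _ _ ->] := hl a1 b1 s1 ab1; have [_ _ _ ->] := hl c1 d1 s2 cd1.
    by rewrite (le_lt_trans _ h) // le_eqVlt; apply/orP; left; apply/eqP; field.
  have := bigq; rewrite /big /= (bd_hsplit (Rgood_Bgood ab1 cd1 H1) amb).
  rewrite (bd_vsplit (Rgood_Bgood am cd1 (RgoodS H1 (lexx _) mb (lexx _) (lexx _))) cnd).
  rewrite (bd_vsplit (Rgood_Bgood mb cd1 (RgoodS H1 am (lexx _) (lexx _) (lexx _))) cnd).
  have h1 := le4 true true; have h2 := le4 true false.
  have h3 := le4 false true; have h4 := le4 false false.
  move: h1 h2 h3 h4; rewrite /half /= -/m -/n => h1 h2 h3 h4.
  rewrite ltNge => /negP; apply; rewrite (le_trans (cND _ _)) //.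
  rewrite [leRHS](_ : _ = e * (b1 - a1 + (d1 - c1)) ^+ 2 / 4 + e * (b1 - a1 + (d1 - c1)) ^+ 2 / 4
    + (e * (b1 - a1 + (d1 - c1)) ^+ 2 / 4 + e * (b1 - a1 + (d1 - c1)) ^+ 2 / 4)); last by field.
  by apply: lerD; rewrite (le_trans (cND _ _)) // lerD.
have [sel selP] := choice step.
pose nx (q : (R * R) * (R * R)) := (half q.1.1 q.1.2 (sel q).1, half q.2.1 q.2.2 (sel q).2).
pose Q n := iter n nx ((a, b), (c, d)).
have okQ n : ok (Q n).
  elim: n => [|n IH]; last exact: selP.
  split; first by split.
  rewrite /big /= -/L0 /e mulrAC ltr_pdivrMr // ltr_pM2l ?cN_gt0 //.
  by rewrite ltrDl ltr01.
have QS n : [/\ (Q n).1.1 <= (Q n.+1).1.1, (Q n.+1).1.2 <= (Q n).1.2,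
     (Q n).2.1 <= (Q n.+1).2.1 & (Q n.+1).2.2 <= (Q n).2.2] /\
   ((Q n.+1).1.2 - (Q n.+1).1.1 = ((Q n).1.2 - (Q n).1.1) / 2 /\
    (Q n.+1).2.2 - (Q n.+1).2.1 = ((Q n).2.2 - (Q n).2.1) / 2).
  have [[i1 i2 _ _] _] := okQ n.
  have [_ h1 h2 h3] := hl _ _ (sel (Q n)).1 i1; have [_ k1 k2 k3] := hl _ _ (sel (Q n)).2 i2.
  by split.
have QL n : ((Q n).1.2 - (Q n).1.1) + ((Q n).2.2 - (Q n).2.1) = L0 / 2 ^+ n.
  elim: n => [|n IH]; first by rewrite expr0 divr1.
  have [_ [-> ->]] := QS n; rewrite -mulrDl IH exprS invfM; ring.
have nested (l r : nat -> R) : (forall n, l n <= l n.+1) -> (forall n, r n.+1 <= r n) ->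
    (forall n, l n <= r n) -> exists x, forall n, l n <= x <= r n.
  move=> hlm hrm lr.
  have lm (m n : nat) : (m <= n)%N -> l m <= l n.
    by move=> /subnK <-; elim: (n - m)%N => // k IH; rewrite addSn (le_trans IH).
  have rm (m n : nat) : (m <= n)%N -> r n <= r m.
    by move=> /subnK <-; elim: (n - m)%N => // k IH; rewrite addSn (le_trans _ IH).
  have lr2 (m n : nat) : l m <= r n.
    rewrite (le_trans (lm _ _ (leq_maxl m n))) // (le_trans (lr _)) //.
    by rewrite rm // leq_maxr.
  exists (sup (range l)) => n; apply/andP; split.
    apply: ub_le_sup; last by exists n.
    by exists (r 0%N) => _ [m _ <-].
  by apply: ge_sup; [exists (l 0%N); exists 0%N|move=> _ [m _ <-]].
have [x xP] : exists x, forall n, (Q n).1.1 <= x <= (Q n).1.2.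
  by apply: nested => n; [have [[]] := QS n|have [[]] := QS n|have [[]] := okQ n].
have [y yP] : exists y, forall n, (Q n).2.1 <= y <= (Q n).2.2.
  by apply: nested => n; [have [[]] := QS n|have [[]] := QS n|have [[]] := okQ n].
have [D fD] := H x y (xP 0%N) (yP 0%N).
have [dl dl0 dlP] := (hdP _ _ _).1 fD (e / 4) (divr_gt0 e0 (ltr0n _ 4)).
have [n nP] : exists n, L0 / 2 ^+ n < dl.
  have := @cvg_geometric R L0 2^-1; rewrite ger0_norm ?invr_ge0 // => /(_ _)/cvgrPdist_lt.
  have h : 2^-1 < 1 :> R by lra.
  move=> /(_ h dl dl0) [n _ /(_ n (leqnn n))]; rewrite sub0r normrN /geometric /=.
  rewrite exprVn => hh; exists n; exact: le_lt_trans (ler_norm _) hh.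
have [[i1 i2 [i3 i4] [i5 i6]]] := okQ n; rewrite /big.
have Hn := RgoodS H i3 i4 i5 i6.
pose z0 := pt x y.
(* Minus the first-order Taylor polynomial of f at [z0]. Since it has the primitive [Lin], adding it
   to f does not change the integral. *)
pose lin z := - f z0 + (- D) * (z - z0).
pose Lin z := - f z0 * z + (- D) * (2^-1 * (z - z0) ^+ 2).
have LinD z : hd Lin z (lin z).
  rewrite /Lin /lin; apply: hd_eq (hdD (hdZ _ (hd_id z)) (hdZ _ (hdZ _ (hdX 2 (hdB (hd_id z) (hd_cst z0 z)))))) _.
  by rewrite /= expr1 subr0 mulr1; field.
have linD z : hd lin z (- D).
  by apply: hd_eq (hdD (hd_cst _ z) (hdZ _ (hdB (hd_id z) (hd_cst z0 z)))) _; ring.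
have lg : Rgood lin (Q n).1.1 (Q n).1.2 (Q n).2.1 (Q n).2.2 by move=> *; exists (- D).
have -> : bd f (Q n).1.1 (Q n).1.2 (Q n).2.1 (Q n).2.2 =
   bd (fun z => f z + lin z) (Q n).1.1 (Q n).1.2 (Q n).2.1 (Q n).2.2.
  by rewrite bd_D ?(@bd_prim lin Lin) ?addr0 //; apply: Rgood_Bgood.
have xn := xP n; have yn := yP n.
rewrite ltNge => /negP[].
have flg : Rgood (fun z => f z + lin z) (Q n).1.1 (Q n).1.2 (Q n).2.1 (Q n).2.2.
  by move=> s t sa ta; have [d1 h1] := Hn s t sa ta; exists (d1 - D); apply: hdD.
rewrite [X in _ <= e * X ^+ 2]QL.
rewrite (le_trans (@bd_bound _ _ _ _ _ (e / 4 * (L0 / 2 ^+ n)) i1 i2 (Rgood_Bgood i1 i2 flg) _)) //; last first.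
  by rewrite QL le_eqVlt; apply/orP; left; apply/eqP; field; rewrite expf_neq0.
move=> s t sa ta _.
have dst : cN (pt s t - z0) <= L0 / 2 ^+ n.
  rewrite (le_trans (cN_le _)) // !raddfB /= !cre_pt !cim_pt -QL lerD // ler_norml; lra.
have := dlP (pt s t - z0) (le_lt_trans dst nP).
rewrite [z0 + _]addrC subrK => hh.
rewrite (_ : f _ + lin _ = f (pt s t) - f z0 - (pt s t - z0) * D); last by rewrite /lin; ring.
by rewrite (le_trans hh) // ler_wpM2l // ltW // divr_gt0.
Qed.
End Goursat.

(** * Integrals around squares *)

Section CauchyInequality.
Variable R : realType.
Local Notation C := (Cx R).
Implicit Types (z w c : C) (f g h k : C -> C) (a b e x y M : R).

Lemma cinvE z : z != 0 -> z^-1 =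
  pt (cre z / (cre z ^+ 2 + cim z ^+ 2)) (- cim z / (cre z ^+ 2 + cim z ^+ 2)).
Proof.
move=> z0; have n0 : cre z ^+ 2 + cim z ^+ 2 != 0.
  by apply: contraNN z0 => /eqP n0; rewrite -cN_eq0 cNE n0 sqrtr0.
apply: (mulfI z0); rewrite mulfV //; apply: cext.
  rewrite creM cre_pt cim_pt -(rmorph1 (@emb R)) cre_emb; by field.
by rewrite cimM cre_pt cim_pt -(rmorph1 (@emb R)) cim_emb; field.
Qed.

Definition sq f w a := bd f (cre w - a) (cre w + a) (cim w - a) (cim w + a).
Definition inQ w a z := (`|cre z - cre w| <= a) && (`|cim z - cim w| <= a).

Lemma inQ_pt w a x y : inQ w a (pt x y) =
  (cre w - a <= x <= cre w + a) && (cim w - a <= y <= cim w + a).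
Proof. by rewrite /inQ cre_pt cim_pt !ler_distl. Qed.

Definition Agood f w a := forall z, inQ w a z -> z != w -> exists D, hd f z D.

Lemma Agood_Bgood f w a e : Agood f w a -> 0 < e -> e <= a ->
  Bgood f (cre w - e) (cre w + e) (cim w - e) (cim w + e).
Proof.
move=> H e0 ea; split=> s sab.
- rewrite ptH; apply: H; first by rewrite inQ_pt; lra.
  by apply/eqP => E; have := congr1 (@cim R) E; rewrite cim_pt; lra.
- rewrite ptH; apply: H; first by rewrite inQ_pt; lra.
  by apply/eqP => E; have := congr1 (@cim R) E; rewrite cim_pt; lra.
- rewrite ptV; apply: H; first by rewrite inQ_pt; lra.
  by apply/eqP => E; have := congr1 (@cre R) E; rewrite cre_pt; lra.
- rewrite ptV; apply: H; first by rewrite inQ_pt; lra.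
  by apply/eqP => E; have := congr1 (@cre R) E; rewrite cre_pt; lra.
Qed.

(** Left, right, bottom and top strips are cut off in turn; each is a rectangle that avoids w and
    contributes 0 by [Goursat]. *)
Lemma sq_shrink f w a e : Agood f w a -> 0 < e -> e <= a -> sq f w a = sq f w e.
Proof.
move=> H e0 ea; rewrite /sq.
have HP x y : inQ w a (pt x y) -> (x != cre w) || (y != cim w) -> exists D, hd f (pt x y) D.
  move=> xyQ ne; apply: H => //; apply/eqP => E.
  by move: ne; rewrite -E cre_pt cim_pt !eqxx.
have B1 := Agood_Bgood H (lt_le_trans e0 ea) (lexx a).
rewrite (bd_hsplit (m := cre w - e) B1); last by lra.
rewrite (@Goursat _ f _ (cre w - e)) ?add0r; [|lra|lra|]; last first.
  by move=> x y hx hy; apply: HP; rewrite ?inQ_pt; [lra|apply/orP; left; rewrite lt_eqF //; lra].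
have B2 : Bgood f (cre w - e) (cre w + a) (cim w - a) (cim w + a).
  split=> s sab; rewrite ?ptH ?ptV.
  - by apply: HP; rewrite ?inQ_pt; [lra|apply/orP; right; rewrite lt_eqF //; lra].
  - by apply: HP; rewrite ?inQ_pt; [lra|apply/orP; right; rewrite gt_eqF //; lra].
  - by apply: HP; rewrite ?inQ_pt; [lra|apply/orP; left; rewrite lt_eqF //; lra].
  - by apply: HP; rewrite ?inQ_pt; [lra|apply/orP; left; rewrite gt_eqF //; lra].
rewrite (bd_hsplit (m := cre w + e) B2); last by lra.
rewrite (@Goursat _ f (cre w + e)) ?addr0; [|lra|lra|]; last first.
  by move=> x y hx hy; apply: HP; rewrite ?inQ_pt; [lra|apply/orP; left; rewrite gt_eqF //; lra].
have B3 : Bgood f (cre w - e) (cre w + e) (cim w - a) (cim w + a).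
  split=> s sab; rewrite ?ptH ?ptV.
  - by apply: HP; rewrite ?inQ_pt; [lra|apply/orP; right; rewrite lt_eqF //; lra].
  - by apply: HP; rewrite ?inQ_pt; [lra|apply/orP; right; rewrite gt_eqF //; lra].
  - by apply: HP; rewrite ?inQ_pt; [lra|apply/orP; left; rewrite lt_eqF //; lra].
  - by apply: HP; rewrite ?inQ_pt; [lra|apply/orP; left; rewrite gt_eqF //; lra].
rewrite (bd_vsplit (m := cim w - e) B3); last by lra.
rewrite (@Goursat _ f _ _ _ (cim w - e)) ?add0r; [|lra|lra|]; last first.
  by move=> x y hx hy; apply: HP; rewrite ?inQ_pt; [lra|apply/orP; right; rewrite lt_eqF //; lra].
have B4 : Bgood f (cre w - e) (cre w + e) (cim w - e) (cim w + a).
  split=> s sab; rewrite ?ptH ?ptV.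
  - by apply: HP; rewrite ?inQ_pt; [lra|apply/orP; right; rewrite lt_eqF //; lra].
  - by apply: HP; rewrite ?inQ_pt; [lra|apply/orP; right; rewrite gt_eqF //; lra].
  - by apply: HP; rewrite ?inQ_pt; [lra|apply/orP; left; rewrite lt_eqF //; lra].
  - by apply: HP; rewrite ?inQ_pt; [lra|apply/orP; left; rewrite gt_eqF //; lra].
rewrite (bd_vsplit (m := cim w + e) B4); last by lra.
rewrite (@Goursat _ f _ _ (cim w + e)) ?addr0 //; [lra|lra|].
by move=> x y hx hy; apply: HP; rewrite ?inQ_pt; [lra|apply/orP; right; rewrite gt_eqF //; lra].
Qed.

End CauchyInequality.

(** * Cauchy's formula and the identity theorem *)

Section CauchyFormula.
Variable R : realType.
Local Notation C := (Cx R).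
Implicit Types (z w c : C) (f g h k : C -> C) (a b e x y M : R).

Lemma inv_Agood w a : Agood (fun z => (z - w)^-1) w a.
Proof.
move=> z _ zw; exists (- 1 / (z - w) ^+ 2); apply: (hdV (f := fun z => z - w)).
  by apply: hd_eq (hdB (hd_id z) (hd_cst w z)) _; rewrite subr0.
by rewrite subr_eq0.
Qed.

(** The integral is 2 pi i, but a lower bound for its modulus is enough below. Each side has length
    2a and its integrand a / (t^2 + a^2) is at least 1 / (2a), so every side contributes at least
    1. *)
Lemma sq_inv w a : 0 < a -> 4 <= cim (sq (fun z => (z - w)^-1) w a).
Proof.
move=> a0; pose f z := (z - w)^-1.
have [Bc Bd Ba Bb] := Agood_Bgood (@inv_Agood w a) a0 (lexx a).
have E z : cim (ci R * z) = cre z by rewrite cimM cre_ci cim_ci; ring.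
have im (u v : R) : cim (emb u + ci R * emb v) = v by rewrite -/(pt u v) cim_pt.
have re (u v : R) : cre (emb u + ci R * emb v) = u by rewrite -/(pt u v) cre_pt.
have cimE (p q r s : C) : cim (p - q + ci R * r - ci R * s) = cim p - cim q + cre r - cre s.
  by rewrite raddfB raddfD raddfB /= !E.
rewrite /sq /bd /hI /vI cimE /sI !im !re.
have low (g : R -> R) (l r : R) : r - l = 2 * a -> dgood g l r ->
    (forall s, l <= s <= r -> (2 * a)^-1 <= g s) -> 1 <= rI g l r.
  move=> lr gg gl; have lr0 : l <= r by lra.
  rewrite [X in X <= _](_ : _ = rI (fun=> (2 * a)^-1) l r); last first.
    by rewrite rI_cst // lr; field; rewrite gt_eqF.
  by apply: rI_le gg gl; exact: dgood_cst.
have q (t : R) : `|t| <= a -> (2 * a)^-1 <= a / (t ^+ 2 + a ^+ 2).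
  move=> ta; have ta2 : t ^+ 2 <= a ^+ 2 by rewrite -[X in X <= _]real_normK ?num_real // lerXn2r ?nnegrE // ltW.
  have p : 0 < t ^+ 2 + a ^+ 2 by rewrite ltr_wpDl ?sqr_ge0 // exprn_gt0.
  by rewrite ler_pdivlMr // mulrC ler_pdivrMr ?mulr_gt0 // -[a * (2 * a)]/(a * (2 * a)); nra.
have neg (g : R -> R) (l r : R) : dgood g l r -> - rI g l r = rI (fun s => - g s) l r.
  move=> gg; rewrite -mulN1r -rI_Z //; apply: eq_rI => s _; exact: mulN1r.
have ndg (g : R -> R) (l r : R) : dgood g l r -> dgood (fun s => - g s) l r.
  by move=> H s /H; apply: derivableN.
rewrite !neg; [|exact: sgood_re Ba|exact: sgood_im Bd].
have pne x y : (x != cre w) || (y != cim w) -> pt x y - w != 0.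
  by move=> H; rewrite subr_eq0; apply/eqP => E'; move: H; rewrite -E' cre_pt cim_pt !eqxx.
have -> : 4 = 1 + 1 + 1 + 1 :> R by ring.
have width (c : R) : c + a - (c - a) = 2 * a by ring.
apply: lerD; [apply: lerD; [apply: lerD|]|].
- apply: low; [exact: width|exact: sgood_im Bc|] => s hs; rewrite ptH cinvE ?cim_pt; last first.
    by apply: pne; apply/orP; right; rewrite lt_eqF //; lra.
  rewrite !creB !cimB cre_pt cim_pt; rewrite (_ : - (_ - a - _) = a); last by ring.
  rewrite (_ : cim w - a - cim w = - a); last by ring.
  by rewrite sqrrN q // ler_distl; lra.
- apply: low; [exact: width|apply: ndg; exact: sgood_im Bd|] => s hs; rewrite ptH cinvE ?cim_pt; last first.
    by apply: pne; apply/orP; right; rewrite gt_eqF //; lra.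
  rewrite !creB !cimB cre_pt cim_pt mulNr opprK (_ : cim w + a - cim w = a); last by ring.
  by rewrite q // ler_distl; lra.
- apply: low; [exact: width|exact: sgood_re Bb|] => s hs; rewrite ptV cinvE ?cre_pt; last first.
    by apply: pne; apply/orP; left; rewrite gt_eqF //; lra.
  rewrite !creB !cimB cre_pt cim_pt (_ : cre w + a - cre w = a); last by ring.
  by rewrite [a ^+ 2 + _]addrC q // ler_distl; lra.
- apply: low; [exact: width|apply: ndg; exact: sgood_re Ba|] => s hs; rewrite ptV cinvE ?cre_pt; last first.
    by apply: pne; apply/orP; left; rewrite lt_eqF //; lra.
  rewrite !creB !cimB cre_pt cim_pt -mulNr (_ : - (cre w - a - cre w) = a); last by ring.
  rewrite (_ : cre w - a - cre w = - a); last by ring.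
  by rewrite sqrrN [a ^+ 2 + _]addrC q // ler_distl; lra.
Qed.

Lemma inQ_cN w e z : inQ w e z -> cN (z - w) <= 2 * e.
Proof.
move=> /andP[h1 h2]; rewrite (le_trans (cN_le _)) // !raddfB /= mulr2n mulrDl mul1r.
exact: lerD.
Qed.

(** The difference quotient of k at w is bounded near w, so its integral around small squares tends
    to 0; by [sq_shrink] it does not depend on the square. Keeping the integral of 1 / (z - w) as a
    factor avoids evaluating it. *)
Lemma Cauchy_formula k w a : 0 < a -> (forall z, inQ w a z -> exists D, hd k z D) ->
  sq (fun z => k z / (z - w)) w a = k w * sq (fun z => (z - w)^-1) w a.
Proof.
move=> a0 kg.
have wQ : inQ w a w by rewrite /inQ !subrr normr0 (ltW a0).
pose g1 z := k z / (z - w).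
pose g2 z := (- k w) * (z - w)^-1.
have A1 : Agood g1 w a.
  move=> z zQ zw; have [D1 k1] := kg z zQ; have [D2 k2] := inv_Agood zQ zw.
  by exists (D1 * (z - w)^-1 + k z * D2); apply: hdM.
have A2 : Agood g2 w a.
  by move=> z zQ zw; have [D2 k2] := inv_Agood zQ zw; exists (- k w * D2); apply: hdZ.
have A12 : Agood (fun z => g1 z + g2 z) w a.
  move=> z zQ zw; have [D1 k1] := A1 z zQ zw; have [D2 k2] := A2 z zQ zw.
  by exists (D1 + D2); apply: hdD.
have B1 := Agood_Bgood A1 a0 (lexx a).
have B2 := Agood_Bgood A2 a0 (lexx a).
have E2 : sq g2 w a = - k w * sq (fun z => (z - w)^-1) w a.
  have [Bc Bd Ba Bb] := Agood_Bgood (@inv_Agood w a) a0 (lexx a).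
  have sZ p v l r : sgood (fun z => (z - w)^-1) p v l r ->
      sI g2 p v l r = - k w * sI (fun z => (z - w)^-1) p v l r.
    move=> H; set u := - k w; rewrite /sI.
    have G1 := sgood_re H; have G2 := sgood_im H.
    have -> : rI (fun s => cre (g2 (p + emb s * v))) l r =
       cre u * rI (fun s => cre ((p + emb s * v - w)^-1)) l r +
       (- cim u) * rI (fun s => cim ((p + emb s * v - w)^-1)) l r.
      rewrite -!rI_Z // -rI_D; [|exact: dgoodZ|exact: dgoodZ].
      by apply: eq_rI => s _; rewrite creM mulNr.
    have -> : rI (fun s => cim (g2 (p + emb s * v))) l r =
       cre u * rI (fun s => cim ((p + emb s * v - w)^-1)) l r +
       cim u * rI (fun s => cre ((p + emb s * v - w)^-1)) l r.
      rewrite -!rI_Z // -rI_D; [|exact: dgoodZ|exact: dgoodZ].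
      by apply: eq_rI => s _; rewrite cimM.
    rewrite !rmorphD !rmorphM !rmorphN /=.
    rewrite [X in _ = X * _](cE u); have := ci2 R; rewrite expr2 => i2.
    by ring: i2.
  have lin (u A B D E : C) : u * A - u * B + ci R * (u * D) - ci R * (u * E) =
      u * (A - B + ci R * D - ci R * E) by ring.
  by rewrite /sq /bd /hI /vI !sZ //; exact: lin.
have : sq (fun z => g1 z + g2 z) w a = sq g1 w a + sq g2 w a by exact: bd_D.
suff -> : sq (fun z => g1 z + g2 z) w a = 0.
  by rewrite E2 mulNr => /esym/eqP; rewrite subr_eq0 => /eqP.
apply/eqP; rewrite -cN_eq0; apply/negPn/negP => ne.
have {ne} pos : 0 < cN (sq (fun z => g1 z + g2 z) w a) by rewrite lt_neqAle eq_sym ne cN_ge0.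
have [D kD] := kg w wQ.
have [d d0 dP] := (hdP _ _ _).1 kD 1 ltr01.
pose M := 1 + cN D.
have M0 : 0 < M by rewrite ltr_wpDr ?cN_ge0.
pose P := cN (sq (fun z => g1 z + g2 z) w a).
(* The bound d / 4 puts the square into the disc where the difference quotient is at most M; the
   last bound gives 16 M e < P. *)
pose e := Num.min a (Num.min (d / 4) (P / (32 * M))).
have e0 : 0 < e by rewrite !lt_min a0 !divr_gt0 ?mulr_gt0.
have ea : e <= a by rewrite ge_min lexx.
have ed : e <= d / 4 by rewrite !ge_min lexx orbT.
have eP : e <= P / (32 * M) by rewrite !ge_min lexx !orbT.
have bnd : forall z, inQ w e z -> z != w -> cN (g1 z + g2 z) <= M.
  move=> z zQ zw; have zw0 : z - w != 0 by rewrite subr_eq0.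
  have := dP (z - w); rewrite [w + _]addrC subrK mul1r => /(_ _) H.
  have {}H : cN (k z - k w - (z - w) * D) <= cN (z - w).
    by apply: H; rewrite (le_lt_trans (inQ_cN zQ)) //; lra.
  rewrite /g1 /g2 -mulrDl cNM cNV ler_pdivrMr ?cN_gt0 //.
  rewrite -[k z - k w](subrK ((z - w) * D)) (le_trans (cND _ _)) //.
  rewrite cNM /M [leRHS]mulrDl mul1r.
  by rewrite lerD // mulrC.
have := @bd_bound _ (fun z => g1 z + g2 z) (cre w - e) (cre w + e) (cim w - e) (cim w + e) M.
move=> /(_ _ _ (Agood_Bgood A12 e0 ea) _).
rewrite -[bd _ _ _ _ _]/(sq _ w e) -(sq_shrink A12 e0 ea) => H.
have : P <= 4 * M * (cre w + e - (cre w - e) + (cim w + e - (cim w - e))).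
  apply: H; [lra|lra|] => x y hx hy bdr; apply: bnd; first by rewrite inQ_pt hx hy.
  apply/eqP => E; move: bdr; rewrite -E cre_pt cim_pt => bdr.
  case/orP: bdr => [/orP[/orP[]|]|] /eqP; lra.
rewrite (_ : 4 * M * _ = 16 * M * e); last by ring.
rewrite leNgt => /negP; apply.
rewrite mulrC -ltr_pdivlMr ?mulr_gt0 // (le_lt_trans eP) //.
rewrite ltr_pM2l // ltf_pV2 ?posrE ?mulr_gt0 // ltr_pM2r // ltr_nat //.
Qed.

(** Since h vanishes near c, h / (z - c)^n is still differentiable there. Cauchy's formula for it at
    w bounds h w by a constant times (|w - c| / d)^n for every n, which tends to 0. No power series
    expansion of h is involved. *)
Lemma holo_zero h w c a : 0 < a -> (forall z, inQ w a z -> exists D, hd h z D) ->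
  (\forall z \near c, h z = 0) -> cN (w - c) < a / 4 -> h w = 0.
Proof.
move=> a0 hg hc wc; apply/eqP; apply: contraT => hw.
have wnc : w != c.
  apply: contra hw => /eqP ->; have /nearC[r r0 rP] := hc.
  by rewrite rP // subrr cN0.
have [Bc Bd Ba Bb] : Bgood h (cre w - a) (cre w + a) (cim w - a) (cim w + a).
  by apply: Agood_Bgood a0 (lexx _) => z zQ _; exact: hg.
have a2 : cre w - a <= cre w + a by lra.
have a3 : cim w - a <= cim w + a by lra.
have [M1 H1] := sgood_bounded a2 Bc; have [M2 H2] := sgood_bounded a2 Bd.
have [M3 H3] := sgood_bounded a3 Ba; have [M4 H4] := sgood_bounded a3 Bb.
pose M := `|M1| + `|M2| + `|M3| + `|M4|.
have M0 : 0 <= M by rewrite !addr_ge0.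
have MP x y : cre w - a <= x <= cre w + a -> cim w - a <= y <= cim w + a ->
   (y == cim w - a) || (y == cim w + a) || (x == cre w - a) || (x == cre w + a) ->
   cN (h (pt x y)) <= M.
  move=> hx hy bdr; rewrite /M.
  have [n1 n2 n3 n4] : [/\ M1 <= `|M1|, M2 <= `|M2|, M3 <= `|M3| & M4 <= `|M4|].
    by split; exact: ler_norm.
  have p1 := normr_ge0 M1; have p2 := normr_ge0 M2; have p3 := normr_ge0 M3.
  have p4 := normr_ge0 M4.
  case/orP: bdr => [/orP[/orP[]|]|] /eqP E.
  - by have := H1 _ hx; rewrite ptH -E; lra.
  - by have := H2 _ hx; rewrite ptH -E; lra.
  - by have := H3 _ hy; rewrite ptV -E; lra.
  - by have := H4 _ hy; rewrite ptV -E; lra.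
(* On the boundary |z - c| is at least a - a / 4 = d, while |w - c| < a / 4. *)
pose d := 3 * a / 4.
have d0 : 0 < d by rewrite /d; lra.
have far x y : (y == cim w - a) || (y == cim w + a) || (x == cre w - a) || (x == cre w + a) ->
    a <= cN (pt x y - w).
  case/orP => [/orP[/orP[]|]|] /eqP E.
  - rewrite (le_trans _ (cim_le _)) // raddfB /= cim_pt E (_ : _ - _ = - a); last by ring.
    by rewrite normrN ler_norm.
  - rewrite (le_trans _ (cim_le _)) // raddfB /= cim_pt E (_ : _ - _ = a); last by ring.
    by rewrite ler_norm.
  - rewrite (le_trans _ (cre_le _)) // raddfB /= cre_pt E (_ : _ - _ = - a); last by ring.
    by rewrite normrN ler_norm.
  - rewrite (le_trans _ (cre_le _)) // raddfB /= cre_pt E (_ : _ - _ = a); last by ring.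
    by rewrite ler_norm.
pose K := cN (w - c).
have K0 : 0 < K by rewrite cN_gt0 subr_eq0.
have est n : cN (h w) * 4 <= 32 * M * (K / d) ^+ n.
  pose k z := h z * ((z - c) ^+ n)^-1.
  have kg z : inQ w a z -> exists D, hd k z D.
    move=> zQ; have [->|zc] := eqVneq z c.
      exists 0; apply: hd_near (hd_cst 0 c) _.
      have /nearC[r r0 rP] := hc; apply/nearC; exists r => // u ur.
      by rewrite /k rP // mul0r.
    have [D hD] := hg z zQ; eexists; apply: hdM hD _.
    apply: (hdV (f := fun z => (z - c) ^+ n)).
      exact: (hdX n (hdB (hd_id z) (hd_cst c z))).
    by rewrite expf_neq0 // subr_eq0.
  have CF := Cauchy_formula a0 kg.
  have Bk : Bgood (fun z => k z / (z - w)) (cre w - a) (cre w + a) (cim w - a) (cim w + a).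
    apply: Agood_Bgood a0 (lexx _) => z zQ zw.
    have [D1 k1] := kg z zQ; have [D2 k2] := inv_Agood zQ zw.
    by exists (D1 * (z - w)^-1 + k z * D2); apply: hdM.
  have := @bd_bound _ _ _ _ _ _ (M * (d ^+ n)^-1 * a^-1) a2 a3 Bk.
  rewrite -[bd _ _ _ _ _]/(sq _ w a) CF cNM {1}/k cNM cNV cNX -/K => H.
  have {H} : cN (h w) * (K ^+ n)^-1 * cN (sq (fun z : C => (z - w)^-1) w a) <=
      4 * (M * (d ^+ n)^-1 * a^-1) * (cre w + a - (cre w - a) + (cim w + a - (cim w - a))).
    apply: H => x y hx hy bdr; rewrite cNM cNV /k cNM cNV cNX.
    have f1 := far x y bdr.
    have f2 : d <= cN (pt x y - c).
      have := cNDB (pt x y) w c; rewrite (cNBC c w) -/K => ?.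
      by move: f1 wc; rewrite -/K /d; lra.
    apply: ler_pM; rewrite ?invr_ge0 ?mulr_ge0 ?cN_ge0 ?invr_ge0 ?exprn_ge0 ?cN_ge0 //.
      apply: ler_pM; rewrite ?invr_ge0 ?exprn_ge0 ?cN_ge0 ?MP //.
      rewrite lef_pV2 ?posrE ?exprn_gt0 ?(lt_le_trans d0) //.
      by rewrite lerXn2r ?nnegrE ?cN_ge0 ?(ltW d0).
    by rewrite lef_pV2 ?posrE ?(lt_le_trans a0).
  rewrite (_ : 4 * _ * _ = 16 * M / d ^+ n); last by field; rewrite ?expf_neq0 ?gt_eqF.
  have kap : 4 <= cN (sq (fun z : C => (z - w)^-1) w a).
    by rewrite (le_trans (sq_inv w a0)) // (le_trans (ler_norm _)) // cim_le.
  move=> H; have {}H : cN (h w) * (K ^+ n)^-1 * 4 <= 16 * M / d ^+ n.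
    by rewrite (le_trans _ H) // ler_wpM2l // mulr_ge0 ?cN_ge0 // invr_ge0 exprn_ge0 // ltW.
  have Kn : 0 < K ^+ n by rewrite exprn_gt0.
  rewrite mulrAC -ler_pdivlMr ?invr_gt0 // invrK in H.
  rewrite (le_trans H) // (expr_div_n K d n).
  rewrite [leRHS](_ : _ = 2 * (16 * M / d ^+ n * K ^+ n)); last by ring.
  rewrite ler_peMl ?ler1n //; apply: mulr_ge0; last exact: ltW.
  by apply: divr_ge0; [exact: mulr_ge0|rewrite exprn_ge0 // ltW].
have hw0 : 0 < cN (h w) by rewrite cN_gt0.
have q1 : `|K / d| < 1.
  have Kd : 0 <= K / d by apply: divr_ge0; exact: ltW.
  rewrite (ger0_norm Kd) (ltr_pdivrMr _ _ d0) mul1r.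
  by move: wc; rewrite -/K /d; lra.
have := @cvg_geometric R (32 * M) (K / d) q1 => /cvgrPdist_lt /(_ (cN (h w)) hw0).
move=> [n _ /(_ n (leqnn n))]; rewrite sub0r normrN /geometric /= => hn.
have := est n; have := le_lt_trans (ler_norm _) hn; lra.
Qed.

Lemma identity_theorem h p q (r : R) :
  (forall z, cN (z - p) < r -> exists D, hd h z D) -> cN (q - p) < r / 40 ->
  (\forall z \near q, h z = 0) -> forall z, cN (z - p) < r / 40 -> h z = 0.
Proof.
move=> hg qp hq z zp.
have r0 : 0 < r by move: (cN_ge0 (z - p)) zp; lra.
(* The square of half-side r / 4 around z lies within r / 2 + r / 40 < r of p, and |z - q| < r / 20
   < (r / 4) / 4. *)
apply: (@holo_zero h z q (r / 4)) => //; first by rewrite divr_gt0.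
  move=> u /inQ_cN uz; apply: hg; have := cNDB u p z; lra.
by have := cNDB z q p; rewrite (cNBC p q); lra.
Qed.
End CauchyFormula.

(** * Power series *)

Section PowerSeries.
Variable R : realType.
Local Notation C := (Cx R).
Implicit Types (z w h : C) (u v a b : nat -> C) (q r x K : R).

Definition is_csum u (s : C) := forall e : R, 0 < e -> exists N : nat,
  forall n, (N <= n)%N -> cN (\sum_(k < n) u k - s) < e.

Lemma is_csum_uniq u s t : is_csum u s -> is_csum u t -> s = t.
Proof.
move=> us ut; apply/eqP; rewrite -subr_eq0 -cN_eq0; apply/negPn/negP => ne.
have e0 : 0 < cN (s - t) / 2 by rewrite divr_gt0 // lt_neqAle eq_sym ne cN_ge0.
have [N1 H1] := us _ e0; have [N2 H2] := ut _ e0.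
have := H1 _ (leq_maxl N1 N2); have := H2 _ (leq_maxr N1 N2).
set S := \sum_(k < _) _; have := cNDB s t S; rewrite (cNBC s S); lra.
Qed.

Lemma is_csumD u v s t : is_csum u s -> is_csum v t -> is_csum (fun n => u n + v n) (s + t).
Proof.
move=> us vt e e0; have e2 : 0 < e / 2 by rewrite divr_gt0.
have [N1 H1] := us _ e2; have [N2 H2] := vt _ e2; exists (maxn N1 N2) => n.
rewrite geq_max => /andP[/H1 n1 /H2 n2]; rewrite big_split /=.
rewrite (_ : _ - _ = (\sum_(k < n) u k - s) + (\sum_(k < n) v k - t)); last by ring.
by rewrite (le_lt_trans (cND _ _)) // [e]splitr ltrD.
Qed.

Lemma is_csumZ c u s : is_csum u s -> is_csum (fun n => c * u n) (c * s).
Proof.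
move=> us e e0; have K0 : 0 < cN c + 1 by rewrite ltr_wpDl ?cN_ge0.
have [N H] := us _ (divr_gt0 e0 K0); exists N => n /H n1.
rewrite -mulr_sumr -mulrBr cNM; apply: (@le_lt_trans _ _ ((cN c + 1) * cN (\sum_(k < n) u k - s))).
  by rewrite ler_wpM2r ?cN_ge0 // lerDl.
by rewrite mulrC -ltr_pdivlMr.
Qed.

Lemma is_csumS u s : is_csum (fun n => u n.+1) s -> is_csum u (u 0%N + s).
Proof.
move=> us e /us[N H]; exists N.+1 => -[//|n] /H.
by rewrite big_ord_recl /= opprD addrACA subrr add0r.
Qed.

Lemma is_csum0 : is_csum (fun=> 0) 0.
Proof. by move=> e e0; exists 0%N => n _; rewrite big1 // subrr cN0. Qed.

Definition gb u q K := forall n, cN (u n) <= K * q ^+ n.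

Lemma gb_sum u q K n : 0 <= q < 1 -> gb u q K -> \sum_(k < n) cN (u k) <= K / (1 - q).
Proof.
move=> /andP[q0 q1] H; have K0 : 0 <= K by have := H 0%N; rewrite expr0 mulr1; apply: le_trans; exact: cN_ge0.
apply: (@le_trans _ _ (\sum_(k < n) K * q ^+ k)); first by apply: ler_sum => k _.
rewrite -mulr_sumr ler_wpM2l //.
have q10 : 0 < 1 - q by rewrite subr_gt0.
have E : (1 - q) * (\sum_(k < n) q ^+ k) = 1 - q ^+ n.
  by rewrite -opprB mulNr -subrX1 opprB.
by rewrite -(ler_pM2l q10) E mulfV ?gt_eqF // lerBlDr lerDl exprn_ge0.
Qed.

Lemma csum_le u q K s : 0 <= q < 1 -> gb u q K -> is_csum u s -> cN s <= K / (1 - q).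
Proof.
move=> q01 H us; rewrite leNgt; apply/negP => lt.
have [N HN] := us (cN s - K / (1 - q)) (ltac:(by rewrite subr_gt0)).
have := HN N (leqnn N); have := cND (\sum_(k < N) u k) (s - \sum_(k < N) u k).
rewrite addrC subrK (cNBC s) => h1 h2.
have := le_trans (@cN_sum _ _ (index_enum 'I_N) xpredT (fun k => u k)) (gb_sum N q01 H).
lra.
Qed.

Lemma real_csum (f : nat -> R) q K : 0 <= q < 1 -> (forall n, `|f n| <= K * q ^+ n) ->
  exists s, forall e, 0 < e -> exists N : nat, forall n, (N <= n)%N ->
    `|\sum_(k < n) f k - s| < e.
Proof.
move=> /andP[q0 q1] H.
have /cvg_ex[s] : cvgn (series f).
  apply: normed_cvg; apply: (@series_le_cvg _ _ (geometric K q)).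
  - by move=> n; exact: normr_ge0.
  - by move=> n; rewrite /geometric /=; apply: le_trans (H n).
  - by move=> n; exact: H.
  - by apply: is_cvg_geometric_series; rewrite ger0_norm.
move=> /cvgrPdist_lt fs; exists s => e /fs[N _ NP]; exists N => n /NP /=.
by rewrite distrC /series /= big_mkord.
Qed.

Lemma gb_csum u q K : 0 <= q < 1 -> gb u q K -> exists s, is_csum u s.
Proof.
move=> q01 H.
have [s1 H1] := @real_csum (fun n => cre (u n)) _ _ q01 (fun n => le_trans (cre_le _) (H n)).
have [s2 H2] := @real_csum (fun n => cim (u n)) _ _ q01 (fun n => le_trans (cim_le _) (H n)).
exists (pt s1 s2) => e e0; have e2 : 0 < e / 2 by rewrite divr_gt0.
have [N1 P1] := H1 _ e2; have [N2 P2] := H2 _ e2; exists (maxn N1 N2) => n.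
rewrite geq_max => /andP[/P1 n1 /P2 n2].
rewrite (le_lt_trans (cN_le _)) // creB cimB cre_pt cim_pt [e]splitr !raddf_sum /=.
exact: ltrD.
Qed.

Definition csum u : C := xget 0 [set s | is_csum u s].

Lemma csumE u s : is_csum u s -> csum u = s.
Proof.
by move=> us; rewrite /csum; case: xgetP => [t _ /is_csum_uniq|/(_ s)//]; apply.
Qed.
Lemma csumP u q K : 0 <= q < 1 -> gb u q K -> is_csum u (csum u).
Proof. by move=> q01 /(gb_csum q01)[s us]; rewrite (csumE us). Qed.

(* [rad a r]: the radius of convergence of [a] is at least [r]. *)
Definition rad a r := forall x, 0 < x -> x < r -> exists K, forall n, cN (a n) * x ^+ n <= K.
Definition ps a z : C := csum (fun n => a n * z ^+ n).
Definition dps a n : C := n.+1%:R * a n.+1.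

Lemma rad_gb a r z : rad a r -> cN z < r ->
  exists q K, 0 <= q < 1 /\ gb (fun n => a n * z ^+ n) q K.
Proof.
move=> ar zr; have z0 := cN_ge0 z.
pose x := (cN z + r) / 2.
have x0 : 0 < x by rewrite /x; lra.
have [||K KP] := ar x; [exact: x0|by rewrite /x; lra|].
exists (cN z / x), K; split.
  by rewrite divr_ge0 ?(ltW x0) //= ltr_pdivrMr // mul1r /x; lra.
move=> n; rewrite cNM cNX.
have := KP n; rewrite -(ler_pM2r (_ : 0 < (x ^+ n)^-1)) ?invr_gt0 ?exprn_gt0 //.
rewrite mulfK ?expf_neq0 ?gt_eqF // => h.
rewrite expr_div_n [leRHS]mulrCA mulrC ler_wpM2l ?exprn_ge0 // (le_trans h) //.
Qed.

Lemma psP a r z : rad a r -> cN z < r -> is_csum (fun n => a n * z ^+ n) (ps a z).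
Proof. by move=> ar /(rad_gb ar)[q [K [q01 H]]]; apply: csumP q01 H. Qed.

Lemma ps0 a : ps a 0 = a 0%N.
Proof.
apply: csumE; rewrite -[a 0%N]addr0 -[X in X + 0]mulr1 -(expr0 0); apply: is_csumS.
by move=> e e0; exists 0%N => n _; rewrite big1 ?subrr ?cN0 // => k _; rewrite exprS mul0r mulr0.
Qed.

Definition shift_seq a n : C := if n is m.+1 then a m else 0.

Lemma bernoulli x n : 0 <= x -> 1 + n%:R * x <= (1 + x) ^+ n.
Proof.
move=> x0; elim: n => [|n IH]; first by rewrite mul0r addr0.
have x1 : 0 <= 1 + x by rewrite addr_ge0.
rewrite exprS (le_trans _ (ler_wpM2l x1 IH)) // -natr1.
by have n0 : 0 <= n%:R :> R by []; nra.
Qed.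

(** Bernoulli's inequality with 1 + y = 1 / x gives n y <= x^-n. *)
Lemma nat_geom x : 0 < x < 1 -> exists2 K, 0 < K & forall n, n%:R * x ^+ n <= K.
Proof.
move=> /andP[x0 x1]; pose y := x^-1 - 1.
have y0 : 0 < y by rewrite subr_gt0 invf_gt1.
exists y^-1; first by rewrite invr_gt0.
have yE : 1 + y = x^-1 by rewrite /y addrC subrK.
move=> n; have := bernoulli n (ltW y0); rewrite yE exprVn => h.
have X0 : 0 < x ^+ n by rewrite exprn_gt0.
move: h; rewrite -(ler_pM2r X0) mulVf ?gt_eqF // => h.
rewrite -(ler_pM2r y0) mulVf ?gt_eqF // (le_trans _ h) //.
by rewrite mulrAC mulrDl mul1r lerDr ltW.
Qed.

Lemma rad_dps a r : rad a r -> rad (dps a) r.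
Proof.
move=> ar x x0 xr; pose y := (x + r) / 2.
have y0 : 0 < y by rewrite /y; lra.
have xy : x < y by rewrite /y; lra.
have [|K KP] := ar y y0; first by rewrite /y; lra.
have [|K1 K10 K1P] := @nat_geom (x / y); first by rewrite divr_gt0 //= ltr_pdivrMr // mul1r.
exists (K1 * (K / x)) => n; rewrite /dps cNM cN_nat.
have := K1P n.+1; rewrite expr_div_n => h1; have h2 := KP n.+1.
have K0 : 0 <= K by apply: le_trans h2; rewrite mulr_ge0 ?cN_ge0 // exprn_ge0 // ltW.
rewrite [leLHS](_ : _ = n.+1%:R * (x ^+ n.+1 / y ^+ n.+1) * (cN (a n.+1) * y ^+ n.+1 / x)).
  apply: ler_pM => //.
  - by rewrite mulr_ge0 // divr_ge0 // exprn_ge0 // ltW.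
  - by rewrite divr_ge0 ?(ltW x0) // mulr_ge0 ?cN_ge0 // exprn_ge0 // ltW.
  - by rewrite ler_pM2r ?invr_gt0.
by rewrite exprS; field; rewrite expf_neq0 gt_eqF.
Qed.

(** The crude factor n^2 replaces a binomial coefficient, and the quotient x^n / x^2 avoids a
    truncated exponent n - 2. *)
Lemma pow_taylor z h x n : cN z <= x -> cN (z + h) <= x -> 0 < x ->
  cN ((z + h) ^+ n - z ^+ n - h * (n%:R * z ^+ n.-1)) <= n%:R ^+ 2 * cN h ^+ 2 * (x ^+ n / x ^+ 2).
Proof.
move=> zx zhx x0; elim: n => [|n IH].
  by rewrite !expr0 subrr mul0r mulr0 subrr cN0 expr0n /= !mul0r.
have -> : (z + h) ^+ n.+1 - z ^+ n.+1 - h * (n.+1%:R * z ^+ n.+1.-1) =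
  (z + h) * ((z + h) ^+ n - z ^+ n - h * (n%:R * z ^+ n.-1)) + h ^+ 2 * (n%:R * z ^+ n.-1).
  case: n {IH} => [|n] /=; first by rewrite !expr0; ring.
  by rewrite -[n.+2%:R]natr1 !exprS; ring.
rewrite (le_trans (cND _ _)) // cNM.
have h1 : cN (z + h) * cN ((z + h) ^+ n - z ^+ n - h * (n%:R * z ^+ n.-1)) <=
   x * (n%:R ^+ 2 * cN h ^+ 2 * (x ^+ n / x ^+ 2)) by rewrite ler_pM ?cN_ge0.
have h2 : cN (h ^+ 2 * (n%:R * z ^+ n.-1)) <= n%:R * cN h ^+ 2 * (x ^+ n.+1 / x ^+ 2).
  rewrite cNM (cNX h 2) cNM cN_nat cNX mulrCA -mulrA.
  case: n {IH h1} => [|n] /=; first by rewrite !mul0r.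
  rewrite ler_wpM2l // ler_wpM2l ?sqr_ge0 //.
  rewrite -addn2 exprD mulfK ?expf_neq0 ?gt_eqF //.
  by rewrite lerXn2r ?nnegrE ?cN_ge0 ?(ltW x0).
apply: le_trans (lerD h1 h2) _; rewrite (exprS x n).
set A := cN h ^+ 2; set B := x ^+ n / x ^+ 2.
have A0 : 0 <= A by rewrite sqr_ge0.
have B0 : 0 <= x * B by rewrite mulr_ge0 ?divr_ge0 ?exprn_ge0 // ltW.
rewrite -[x * _ / _]mulrA -/B [leLHS](_ : _ = (n%:R ^+ 2 + n%:R) * (A * (x * B))); last by ring.
rewrite [leRHS](_ : _ = n.+1%:R ^+ 2 * (A * (x * B))); last by ring.
apply: ler_wpM2r; first exact: mulr_ge0.
rewrite -natr1.
have n0 : 0 <= n%:R :> R by []; nra.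
Qed.

Lemma ps_hd a r z : rad a r -> cN z < r -> hd (ps a) z (ps (dps a) z).
Proof.
move=> ar zr; have z0 := cN_ge0 z.
pose x := (cN z + r) / 2; pose y := (x + r) / 2.
have x0 : 0 < x by rewrite /x; lra.
have zx : cN z < x by rewrite /x; lra.
have xr : x < r by rewrite /x; lra.
have y0 : 0 < y by rewrite /y; lra.
have xy : x < y by rewrite /y; lra.
have [|K KP] := ar y y0; first by rewrite /y; lra.
have K0 : 0 <= K by have := KP 0%N; rewrite expr0 mulr1; apply: le_trans; exact: cN_ge0.
pose t := x / y.
have t01 : 0 < t < 1 by rewrite divr_gt0 //= ltr_pdivrMr // mul1r.
have /andP[t0 t1] := t01.
pose s := (1 + t) / 2.
have s01 : 0 <= s < 1 by rewrite /s; lra.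
have s0 : 0 < s by rewrite /s; lra.
have st : 0 < t / s < 1.
  by apply/andP; split; [exact: divr_gt0|rewrite ltr_pdivrMr // mul1r /s; lra].
pose w := (1 + t / s) / 2.
have w01 : 0 < w < 1 by rewrite /w; lra.
have w0 : 0 < w by rewrite /w; lra.
have wt : 0 < t / s / w < 1.
  apply/andP; split; first by apply: divr_gt0 => //; case/andP: st.
  by rewrite ltr_pdivrMr // mul1r /w; case/andP: st; lra.
have s10 : 0 < 1 - s by case/andP: s01; lra.
have tE : t * y = x by rewrite /t divfK // gt_eqF.
clearbody w; clearbody s; clearbody t.
have [K1 K10 K1P] := nat_geom w01; have [K2 K20 K2P] := nat_geom wt.
(* Dominates the second-order remainders by a geometric series: t^n = w^n (t / s / w)^n s^n, and
   each factor n of n^2 is absorbed by one of the first two powers. *)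
have key n : n%:R ^+ 2 * t ^+ n <= K1 * K2 * s ^+ n.
  have := ler_pM _ _ (K1P n) (K2P n).
  have h1 : 0 <= n%:R * w ^+ n by rewrite mulr_ge0 ?exprn_ge0 // ltW.
  have h2 : 0 <= n%:R * (t / s / w) ^+ n by apply: mulr_ge0 => //; apply: exprn_ge0; case/andP: wt => /ltW.
  move=> /(_ h1 h2) h; rewrite -ler_pdivrMr ?exprn_gt0 // (le_trans _ h) //.
  by rewrite !expr_div_n le_eqVlt; apply/orP; left; apply/eqP; field; rewrite !expf_neq0 ?gt_eqF.
pose KK := K * (K1 * K2) / x ^+ 2.
apply/hdP => e e0.
have KK0 : 0 <= KK by rewrite divr_ge0 ?sqr_ge0 // mulr_ge0 // mulr_ge0 ?ltW.
pose d := Num.min (x - cN z) (e * (1 - s) / (KK + 1)).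
have d0 : 0 < d by rewrite lt_min subr_gt0 zx divr_gt0 ?mulr_gt0 // ltr_wpDl.
exists d => // h; rewrite lt_min => /andP[h1 h2].
have zhx : cN (z + h) <= x by rewrite (le_trans (cND _ _)) //; lra.
have zhr : cN (z + h) < r by exact: le_lt_trans zhx xr.
have S1 := psP ar zhr; have S2 := psP ar zr; have S3 := psP (rad_dps ar) zr.
have S3' : is_csum (fun n => a n * (n%:R * z ^+ n.-1)) (ps (dps a) z).
  rewrite -[ps _ _]add0r -(mulr0 (a 0%N)) -(mul0r (z ^+ 0.-1)).
  apply: (@is_csumS (fun n => a n * (n%:R * z ^+ n.-1))).
  by under eq_fun do rewrite /= mulrA [a _ * _]mulrC.
have S4 := is_csumD (is_csumD S1 (is_csumZ (-1) S2)) (is_csumZ (- h) S3').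
have lin (x1 x2 x3 : C) : x1 - x2 - h * x3 = x1 + -1 * x2 + - h * x3 by ring.
rewrite lin.
have G : gb (fun n => a n * (z + h) ^+ n + -1 * (a n * z ^+ n) + - h * (a n * (n%:R * z ^+ n.-1)))
   s (KK * cN h ^+ 2).
  move=> n; rewrite (_ : _ + _ + _ = a n * ((z + h) ^+ n - z ^+ n - h * (n%:R * z ^+ n.-1))); last by ring.
  rewrite cNM; apply: (@le_trans _ _ (cN (a n) * (n%:R ^+ 2 * cN h ^+ 2 * (x ^+ n / x ^+ 2)))).
    by rewrite ler_wpM2l ?cN_ge0 // pow_taylor // ltW.
  have xn : x ^+ n = t ^+ n * y ^+ n by rewrite -exprMn tE.
  rewrite xn [leLHS](_ : _ = cN h ^+ 2 / x ^+ 2 * ((cN (a n) * y ^+ n) * (n%:R ^+ 2 * t ^+ n))); last by ring.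
  rewrite [leRHS](_ : _ = cN h ^+ 2 / x ^+ 2 * (K * (K1 * K2 * s ^+ n))); last by rewrite /KK; ring.
  rewrite ler_wpM2l ?divr_ge0 ?sqr_ge0 //; apply: ler_pM => //.
    by rewrite mulr_ge0 ?cN_ge0 // exprn_ge0 // ltW.
  by rewrite mulr_ge0 ?sqr_ge0 // exprn_ge0 // ltW.
apply: le_trans (csum_le s01 G S4) _; rewrite expr2 mulrA mulrAC ler_wpM2r ?cN_ge0 //.
rewrite ler_pdivrMr //.
have : (KK + 1) * cN h <= e * (1 - s) by rewrite mulrC -ler_pdivlMr ?ltr_wpDl // ltW.
have := cN_ge0 h; lra.
Qed.
End PowerSeries.

(** * Power series solutions of linear equations *)

Section SeriesODE.
Variable R : realType.
Local Notation C := (Cx R).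
Implicit Types (z w : C) (a b : nat -> C) (r x K : R).

Lemma is_csum_shift a z s : is_csum (fun n => a n * z ^+ n) s ->
  is_csum (fun n => shift_seq a n * z ^+ n) (z * s).
Proof.
move=> H; rewrite -[z * _]add0r -(mul0r (z ^+ 0)).
apply: (@is_csumS _ (fun n => shift_seq a n * z ^+ n)) => /=.
under eq_fun do rewrite exprS mulrCA; exact: is_csumZ H.
Qed.

(** The recurrence states that every coefficient of the left-hand side vanishes. General p0, ..., s
    cover the hypergeometric equation expanded at z = 0 as well as at an ordinary point. *)
Lemma ps_ode (p0 p1 p2 q0 q1 s : C) a r z : rad a r -> cN z < r ->
  (forall n, p0 * (n.+2%:R * n.+1%:R) * a n.+2 + n.+1%:R * (p1 * n%:R + q0) * a n.+1 +
    (p2 * (n%:R * (n%:R - 1)) + q1 * n%:R + s) * a n = 0) ->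
  (p0 + p1 * z + p2 * z ^+ 2) * ps (dps (dps a)) z + (q0 + q1 * z) * ps (dps a) z
    + s * ps a z = 0.
Proof.
move=> ar zr rec; have S0 := psP ar zr.
have S1 := psP (rad_dps ar) zr; have S2 := psP (rad_dps (rad_dps ar)) zr.
have T2 := is_csum_shift S2; have U2 := is_csum_shift T2; have T1 := is_csum_shift S1.
have H := is_csumD (is_csumD (is_csumD (is_csumZ p0 S2) (is_csumZ p1 T2)) (is_csumZ p2 U2))
  (is_csumD (is_csumD (is_csumZ q0 S1) (is_csumZ q1 T1)) (is_csumZ s S0)).
move: H; set u := (X in is_csum X _); set v := (X in is_csum _ X).
have -> : u = fun=> 0.
  apply/funext => n /=; rewrite -[RHS](mul0r (z ^+ n)) -(rec n) /u /dps.
  case: n => [|[|n]] /=; rewrite -?[n.+4%:R]natr1 -?[n.+3%:R]natr1 -?[n.+2%:R]natr1 -?[n.+1%:R]natr1;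
  by rewrite ?exprS; ring.
move=> H; rewrite -[RHS](is_csum_uniq H (@is_csum0 R)) /v; ring.
Qed.

Lemma rad_geom a r K : 0 < r -> (forall n, cN (a n) * r ^+ n <= K) -> rad a r.
Proof.
move=> r0 H x x0 xr; exists K => n; rewrite (le_trans _ (H n)) //.
by rewrite ler_wpM2l ?cN_ge0 // lerXn2r ?nnegrE ?ltW.
Qed.

Fixpoint hgc (al be ga : C) n : C :=
  if n is m.+1 then hgc al be ga m * ((m%:R + al) * (m%:R + be) / (m.+1%:R * (m%:R + ga))) else 1.

(** Ratio test with an explicit rank N: from N on, A n + B <= (1 - x) n^2, which gives (n + |al|)(n
    + |be|) x <= n (n - |ga|), so that the terms decrease. *)
Lemma rad_hgc al be ga : (forall n, n%:R + ga != 0) -> rad (hgc al be ga) 1.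
Proof.
move=> ga0 x x0 x1.
pose A := cN al + cN be + cN ga; pose B := cN al * cN be.
have A0 : 0 <= A by rewrite !addr_ge0 ?cN_ge0.
have B0 : 0 <= B by rewrite mulr_ge0 ?cN_ge0.
have x10 : 0 < 1 - x by rewrite subr_gt0.
pose N := (Num.trunc ((A + B) / (1 - x))).+1.
have NP n : (N <= n)%N -> A * n%:R + B <= (1 - x) * n%:R ^+ 2.
  move=> Nn; have h : (A + B) / (1 - x) <= n%:R.
    rewrite ltW // (lt_le_trans (truncnS_gt _)) // ler_nat //.
  have n1 : 1 <= n%:R :> R by rewrite ler1n (leq_trans _ Nn).
  rewrite ler_pdivrMr // in h.
  apply: (@le_trans _ _ ((A + B) * n%:R)); first by rewrite [leRHS]mulrDl lerD2l ler_peMr.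
  by rewrite expr2 mulrA ler_wpM2r ?(le_trans ler01) // mulrC.
pose t n := cN (hgc al be ga n) * x ^+ n.
have t0 n : 0 <= t n by rewrite mulr_ge0 ?cN_ge0 // exprn_ge0 // ltW.
have tS n : (N <= n)%N -> t n.+1 <= t n.
  move=> Nn; pose q := cN ((n%:R + al) * (n%:R + be) / (n.+1%:R * (n%:R + ga))).
  have -> : t n.+1 = t n * (q * x) by rewrite /t /q /= cNM exprS; ring.
  rewrite ler_piMr // /q.
  have G0 : 0 < cN (n%:R + ga) by rewrite cN_gt0.
  rewrite cNM cNV !cNM cN_nat mulrAC ler_pdivrMr ?mulr_gt0 // mul1r.
  have h1 : cN (n%:R + al) <= n%:R + cN al by rewrite -(cN_nat R) cND.
  have h2 : cN (n%:R + be) <= n%:R + cN be by rewrite -(cN_nat R) cND.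
  have h3 : n%:R - cN ga <= cN (n%:R + ga).
    by have := cNB (n%:R + ga) ga; rewrite addrK cN_nat; lra.
  have := NP n Nn; have n0 : 0 <= n%:R :> R by [].
  have h4 : cN (n%:R + al) * cN (n%:R + be) <= (n%:R + cN al) * (n%:R + cN be).
    by rewrite ler_pM ?cN_ge0.
  have a0 := cN_ge0 al; have b0 := cN_ge0 be; have g0 := cN_ge0 ga.
  move=> hN; rewrite -natr1; apply: (@le_trans _ _ ((n%:R + cN al) * (n%:R + cN be) * x)).
    by rewrite ler_wpM2r // ltW.
  apply: (@le_trans _ _ (n%:R * (n%:R - cN ga))); last first.
    apply: (@le_trans _ _ (n%:R * cN (n%:R + ga))); first by rewrite ler_wpM2l.
    by rewrite ler_wpM2r ?cN_ge0 // lerDl.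
  have hx : (n%:R + cN al) * (n%:R + cN be) * x <= n%:R ^+ 2 * x + (cN al + cN be) * n%:R + B.
    have : (n%:R * (cN al + cN be) + cN al * cN be) * x <= n%:R * (cN al + cN be) + cN al * cN be.
      by rewrite ler_piMr ?(ltW x1) // addr_ge0 ?mulr_ge0 ?addr_ge0.
    rewrite /B; move: x x0 x1 {x10 NP t t0 hN N Nn} => x _ _; nra.
  by move: hN hx; rewrite /A; nra.
exists (\sum_(k < N.+1) t k) => n; rewrite -/(t n).
have tN n' : (n' <= N)%N -> t n' <= \sum_(k < N.+1) t k.
  by move=> n'N; rewrite (bigD1 (Ordinal (n'N : (n' < N.+1)%N))) //= lerDl sumr_ge0.
have [/tN//|Nn] := leqP n N.
rewrite (le_trans _ (tN N _)) //.
move: (ltnW Nn) => /subnK <-; elim: (n - N)%N => [|k IH]; first by rewrite add0n.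
by rewrite addSn (le_trans (tS _ _)) // leq_addl.
Qed.

Definition hgF al be ga := ps (hgc al be ga).
Definition hgF1 al be ga := ps (dps (hgc al be ga)).
Definition hgF2 al be ga := ps (dps (dps (hgc al be ga))).

Lemma hgF_hd al be ga z : (forall n, n%:R + ga != 0) -> cN z < 1 ->
  hd (hgF al be ga) z (hgF1 al be ga z).
Proof. by move=> g z1; apply: ps_hd z1; apply: rad_hgc. Qed.
Lemma hgF1_hd al be ga z : (forall n, n%:R + ga != 0) -> cN z < 1 ->
  hd (hgF1 al be ga) z (hgF2 al be ga z).
Proof. by move=> g z1; apply: ps_hd z1; apply: rad_dps; apply: rad_hgc. Qed.
Lemma hgF0 al be ga : hgF al be ga 0 = 1.
Proof. by rewrite /hgF ps0. Qed.

Lemma hgF_ode al be ga z : (forall n, n%:R + ga != 0) -> cN z < 1 ->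
  z * (1 - z) * hgF2 al be ga z + (ga - (al + be + 1) * z) * hgF1 al be ga z
    - al * be * hgF al be ga z = 0.
Proof.
move=> g z1.
have := @ps_ode 0 1 (-1) ga (- (al + be + 1)) (- (al * be)) _ _ _ (rad_hgc al be g) z1 _.
rewrite -/(hgF2 al be ga) -/(hgF1 al be ga) -/(hgF al be ga).
move=> <-; first by ring.
move=> n /=; have n1 : n.+1%:R != 0 :> C by rewrite pnatr_eq0.
rewrite -[n.+1%:R]natr1 in n1 *.
have g1 : n%:R + 1 + ga != 0 by rewrite natr1.
have n2 : 2 + n%:R != 0 :> C by rewrite -natrD pnatr_eq0.
by field; rewrite g n1 g1 n2.
Qed.

(** Solving for a(n+2) gives a recurrence whose two coefficients are bounded by some M for all n,
    hence a(n) = O((2M)^n). The radius precedes the initial values, so that two basis solutions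
    share one disc. *)
Lemma ps_regular (p0 p1 p2 q0 q1 s : C) : p0 != 0 -> exists2 r, 0 < r &
  forall a0 a1 : C, exists a, [/\ a 0%N = a0, a 1%N = a1, rad a r &
   forall n, p0 * (n.+2%:R * n.+1%:R) * a n.+2 + n.+1%:R * (p1 * n%:R + q0) * a n.+1 +
    (p2 * (n%:R * (n%:R - 1)) + q1 * n%:R + s) * a n = 0].
Proof.
move=> p00.
pose M := 1 + (cN p1 + cN q0 + cN p2 + cN q1 + cN s) / cN p0.
have P0 : 0 < cN p0 by rewrite cN_gt0.
have M1 : 1 <= M by rewrite lerDl divr_ge0 ?(ltW P0) // !addr_ge0 ?cN_ge0.
exists (2 * M)^-1; first by rewrite invr_gt0; lra.
move=> a0 a1.
pose c1 (n : nat) : C := - (n.+1%:R * (p1 * n%:R + q0)) / (p0 * (n.+2%:R * n.+1%:R)).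
pose c0 (n : nat) : C := - (p2 * (n%:R * (n%:R - 1)) + q1 * n%:R + s) / (p0 * (n.+2%:R * n.+1%:R)).
pose st := fix st (n : nat) : C * C :=
  if n is m.+1 then ((st m).2, c1 m * (st m).2 + c0 m * (st m).1) else (a0, a1).
pose a n := (st n).1.
have aS n : (st n).2 = a n.+1 by [].
have rec n : a n.+2 = c1 n * a n.+1 + c0 n * a n by rewrite /a /= aS.
have n0 (n : nat) : n.+1%:R != 0 :> C by rewrite pnatr_eq0.
exists a; split=> //; last first.
  move=> n; have m1 : n%:R + 1 != 0 :> C by rewrite natr1.
  have m2 : n%:R + 1 + 1 != 0 :> C by rewrite !natr1.
  rewrite rec /c1 /c0 -[n.+2%:R]natr1 -natr1; by field; rewrite p00 m1 m2.
have nn (n : nat) : 0 <= n%:R :> R by [].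
have D0 (n : nat) : 0 < cN p0 * (n.+2%:R * n.+1%:R) by rewrite !mulr_gt0.
pose S := cN p1 + cN q0 + cN p2 + cN q1 + cN s.
have MS : M * cN p0 = cN p0 + S by rewrite /M mulrDl mul1r divfK // gt_eqF.
have Gp1 := cN_ge0 p1; have Gq0 := cN_ge0 q0; have Gp2 := cN_ge0 p2.
have Gq1 := cN_ge0 q1; have Gs := cN_ge0 s.
have bd (n : nat) (u : C) : cN u <= S * (n.+2%:R * n.+1%:R) ->
    cN (- u / (p0 * (n.+2%:R * n.+1%:R))) <= M.
  move=> h; rewrite cNM cNN cNV !cNM !cN_nat ler_pdivrMr // [leRHS]mulrA MS (le_trans h) //.
  by rewrite ler_wpM2r ?mulr_ge0 // lerDr ltW.
have b1 n : cN (c1 n) <= M.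
  apply: bd; rewrite cNM cN_nat [leRHS](_ : _ = n.+1%:R * (S * n.+2%:R)); last by ring.
  rewrite ler_wpM2l //.
  rewrite (le_trans (cND _ _)) // cNM cN_nat /S -[n.+2%:R]natr1 -natr1.
  have := mulr_ge0 Gq0 (nn n); have := mulr_ge0 Gp2 (nn n).
  have := mulr_ge0 Gq1 (nn n); have := mulr_ge0 Gs (nn n); lra.
have b0 n : cN (c0 n) <= M.
  apply: bd; rewrite (le_trans (cND _ _)) // /S.
  have h1 : cN (p2 * (n%:R * (n%:R - 1)) + q1 * n%:R) <= cN p2 * (n%:R * (n%:R + 1)) + cN q1 * n%:R.
    rewrite (le_trans (cND _ _)) // !cNM !cN_nat lerD // ler_wpM2l // ler_wpM2l //.
    by rewrite (le_trans (cNB _ _)) // cN1 cN_nat.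
  rewrite (le_trans (lerD h1 (lexx _))) // -[n.+2%:R]natr1 -natr1.
  have nn2 : 0 <= n%:R ^+ 2 :> R by exact: sqr_ge0.
  have := mulr_ge0 Gp1 (nn n); have := mulr_ge0 Gp1 nn2.
  have := mulr_ge0 Gq0 (nn n); have := mulr_ge0 Gq0 nn2.
  have := mulr_ge0 Gp2 (nn n); have := mulr_ge0 Gp2 nn2.
  have := mulr_ge0 Gq1 (nn n); have := mulr_ge0 Gq1 nn2.
  have := mulr_ge0 Gs (nn n); have := mulr_ge0 Gs nn2; lra.
pose A := cN a0 + cN a1.
have Ga0 := cN_ge0 a0; have Ga1 := cN_ge0 a1.
have A0 : 0 <= A by rewrite addr_ge0 ?cN_ge0.
have M2 : 1 <= 2 * M by lra.
have est n : cN (a n) <= A * (2 * M) ^+ n /\ cN (a n.+1) <= A * (2 * M) ^+ n.+1.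
  elim: n => [|n [IH1 IH2]].
    rewrite expr0 expr1 mulr1; split; first by rewrite /A lerDl.
    by rewrite (le_trans _ (ler_wpM2l A0 M2)) // mulr1 /A lerDr.
  split=> //; rewrite rec (le_trans (cND _ _)) // (cNM (c1 n)) (cNM (c0 n)).
  have h1 : cN (c1 n) * cN (a n.+1) <= M * (A * (2 * M) ^+ n.+1) by rewrite ler_pM ?cN_ge0.
  have h2 : cN (c0 n) * cN (a n) <= M * (A * (2 * M) ^+ n) by rewrite ler_pM ?cN_ge0.
  have h3 : A * (2 * M) ^+ n <= A * (2 * M) ^+ n.+1.
    by rewrite ler_wpM2l // exprS ler_peMl // exprn_ge0 // (le_trans ler01).
  rewrite (le_trans (lerD h1 h2)) //.
  rewrite [leRHS](_ : _ = M * (A * (2 * M) ^+ n.+1) + M * (A * (2 * M) ^+ n.+1)); last first.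
    by rewrite exprS; ring.
  by rewrite lerD2l ler_wpM2l // (le_trans ler01).
apply: (rad_geom (K := A)); first by rewrite invr_gt0; lra.
move=> n; rewrite exprVn ler_pdivrMr ?exprn_gt0 //; last by lra.
by have [] := est n.
Qed.
End SeriesODE.

(** * Complex exponential and logarithm *)

Section ComplexExp.
Variable R : realType.
Local Notation C := (Cx R).
Implicit Types (u v w z h : C) (x y t : R).

Definition expc u : C := locked (emb (expR (cre u)) * pt (cos (cim u)) (sin (cim u))).

Lemma cre_expc u : cre (expc u) = expR (cre u) * cos (cim u).
Proof. by rewrite /expc -lock creM cre_pt cre_emb cim_emb mul0r subr0. Qed.
Lemma cim_expc u : cim (expc u) = expR (cre u) * sin (cim u).
Proof. by rewrite /expc -lock cimM cim_pt cre_emb cim_emb mul0r addr0. Qed.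

Lemma cN_expc u : cN (expc u) = expR (cre u).
Proof.
rewrite /expc -lock cNM cN_emb ger0_norm ?expR_ge0 // cNE cre_pt cim_pt cos2Dsin2 sqrtr1.
exact: mulr1.
Qed.
Lemma expcD u v : expc (u + v) = expc u * expc v.
Proof.
apply: cext; rewrite ?creM ?cimM !cre_expc !cim_expc !creD !cimD expRD ?cosD ?sinD; ring.
Qed.
Lemma expc0 : expc 0 = 1.
Proof.
apply: cext; rewrite ?cre_expc ?cim_expc !raddf0 expR0 ?cos0 ?sin0 -(rmorph1 (@emb R)).
  by rewrite cre_emb mulr1.
by rewrite cim_emb mulr0.
Qed.
Lemma expc_neq0 u : expc u != 0.
Proof. by rewrite -cN_gt0 cN_expc expR_gt0. Qed.
Lemma expcN u : expc (- u) = (expc u)^-1.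
Proof. by apply: (mulfI (expc_neq0 u)); rewrite -expcD subrr expc0 mulfV ?expc_neq0. Qed.
Lemma expcMn u n : expc (n%:R * u) = expc u ^+ n.
Proof.
elim: n => [|n IH]; first by rewrite mul0r expc0.
by rewrite -natr1 mulrDl mul1r expcD IH exprSr.
Qed.

Lemma small_bounds (e : R) : 0 < e -> exists2 d, 0 < d & forall x, `|x| < d ->
  [/\ `|expR x - 1 - x| <= e * `|x|, `|cos x - 1| <= e * `|x|, `|sin x - x| <= e * `|x|
    & `|expR x| <= 3].
Proof.
move=> e0.
have [d1 d10 D1] := (@rdP R expR 0 1).1 (ltac:(rewrite -[X in is_derive _ _ _ X](@expR0 R); exact: is_derive_expR)) e e0.
have [d2 d20 D2] := (@rdP R cos 0 0).1 (ltac:(rewrite -[X in is_derive _ _ _ X](@oppr0 R) -[X in - X](@sin0 R); exact: is_derive_cos)) e e0.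
have [d3 d30 D3] := (@rdP R sin 0 1).1 (ltac:(rewrite -[X in is_derive _ _ _ X](@cos0 R); exact: is_derive_sin)) e e0.
have [d4 d40 D4] := (@rdP R expR 0 1).1 (ltac:(rewrite -[X in is_derive _ _ _ X](@expR0 R); exact: is_derive_expR)) 1 ltr01.
exists (Num.min (Num.min d1 d2) (Num.min d3 (Num.min d4 1))).
  by rewrite !lt_min d10 d20 d30 d40 ltr01.
move=> x; rewrite !lt_min => /andP[/andP[x1 x2] /and3P[x3 x4 x5]].
have := D1 x x1; have := D2 x x2; have := D3 x x3; have := D4 x x4.
rewrite !add0r expR0 cos0 sin0 !mulr1 mulr0 !subr0 mul1r => h4 h3 h2 h1; split=> //.
rewrite -[expR x](subrK x) -[_ - x](subrK 1) (le_trans (ler_normD _ _)) //.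
rewrite (le_trans (lerD (ler_normD _ _) (lexx _))) // normr1.
rewrite (_ : expR x - x - 1 = expR x - 1 - x); last by ring.
by lra.
Qed.

Lemma hd_expc u : hd expc u (expc u).
Proof.
apply/hdP => e e0.
have K0 : 0 < cN (expc u) by rewrite cN_gt0 expc_neq0.
pose e' := e / (16 * cN (expc u)).
have e'0 : 0 < e' by rewrite divr_gt0 // mulr_gt0.
pose e1 := Num.min e' 1.
have e10 : 0 < e1 by rewrite lt_min e'0 ltr01.
have [d d0 dP] := small_bounds e10.
exists (Num.min d e') => [|h]; first by rewrite lt_min d0.
rewrite lt_min => /andP[hd he].
have [a1 a2 a3 a4] := dP _ (le_lt_trans (cre_le h) hd).
have [b1 b2 b3 b4] := dP _ (le_lt_trans (cim_le h) hd).
rewrite expcD (_ : _ - _ - _ = expc u * (expc h - 1 - h)); last by ring.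
rewrite cNM.
suff : cN (expc h - 1 - h) <= 16 * e' * cN h.
  move=> H; rewrite (le_trans (ler_wpM2l (cN_ge0 _) H)) // /e' le_eqVlt.
  by apply/orP; left; apply/eqP; field; rewrite gt_eqF.
set x := cre h in a1 a2 a3 a4 *; set y := cim h in b1 b2 b3 b4 *.
have xh : `|x| <= cN h := cre_le h.
have yh : `|y| <= cN h := cim_le h.
have e1e : e1 <= e' by rewrite ge_min lexx.
have e11 : e1 <= 1 by rewrite ge_min lexx orbT.
have nx : 0 <= `|x| by []. have ny : 0 <= `|y| by [].
rewrite (le_trans (cN_le _)) // !creB !cimB -(rmorph1 (@emb R)) cre_emb cim_emb cre_expc cim_expc subr0 -/x -/y.
have E1 : `|expR x * cos y - 1 - x| <= 3 * (e1 * `|y|) + e1 * `|x|.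
  rewrite (_ : _ - _ - _ = expR x * (cos y - 1) + (expR x - 1 - x)); last by ring.
  by rewrite (le_trans (ler_normD _ _)) // lerD // normrM ler_pM.
have ex : `|expR x - 1| <= 2 * `|x|.
  rewrite -[_ - 1](subrK x) (le_trans (ler_normD _ _)) // [leRHS]mulrDl mul1r lerD2r (le_trans a1) //.
  by rewrite ler_piMl.
have E2 : `|expR x * sin y - y| <= 3 * (e1 * `|y|) + 2 * `|x| * `|y|.
  rewrite (_ : _ - _ = expR x * (sin y - y) + (expR x - 1) * y); last by ring.
  by rewrite (le_trans (ler_normD _ _)) // lerD // normrM ler_pM.
rewrite (le_trans (lerD E1 E2)) //.
have m1 : e1 * `|y| <= e' * cN h by rewrite ler_pM // ltW.
have m2 : e1 * `|x| <= e' * cN h by rewrite ler_pM // ltW.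
have m3 : `|x| * `|y| <= e' * cN h by rewrite ler_pM // (le_trans xh) // ltW.
have m4 : 0 <= e' * cN h by rewrite mulr_ge0 ?cN_ge0 // ltW.
rewrite -[16 * e' * _]mulrA -[2 * _ * _]mulrA.
move: (e1 * `|y|) (e1 * `|x|) (`|x| * `|y|) (e' * cN h) m1 m2 m3 m4 => A B D E; lra.
Qed.

Lemma hd_expcZ (c : C) u : hd (fun w => expc (c * w)) u (expc (c * u) * c).
Proof. by apply: hd_eq (hd_comp (hdZ c (hd_id u)) (hd_expc _)) _; rewrite mulr1. Qed.

Definition tpi : R := pi *+ 2.
Definition tpii : C := ci R * emb tpi.

Lemma tpi_gt0 : 0 < tpi. Proof. by rewrite mulrn_wgt0 // pi_gt0. Qed.
Lemma cre_tpii : cre tpii = 0.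
Proof. by rewrite creM cre_ci cim_ci cre_emb cim_emb; ring. Qed.
Lemma cim_tpii : cim tpii = tpi.
Proof. by rewrite cimM cre_ci cim_ci cre_emb cim_emb; ring. Qed.

Lemma expc_tpii : expc tpii = 1.
Proof.
apply: cext; rewrite ?cre_expc ?cim_expc cre_tpii cim_tpii expR0 mul1r -(rmorph1 (@emb R)).
  by rewrite cre_emb cos2pi.
by rewrite cim_emb sin2pi.
Qed.

Lemma expc_int (k : int) : expc (k%:~R * tpii) = 1.
Proof.
case: k => n; first by rewrite -[_%:~R]/(n%:R) expcMn expc_tpii expr1n.
by rewrite NegzE rmorphN /= mulNr expcN -[_%:~R]/(n.+1%:R) expcMn expc_tpii expr1n invr1.
Qed.

Lemma expc_eq1 u : expc u = 1 -> exists k : int, u = k%:~R * tpii.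
Proof.
move=> H.
have x0 : cre u = 0.
  have := congr1 (@cN R) H; rewrite cN_expc cN1 => /(congr1 (@ln R)).
  by rewrite expRK ln1.
(* Removing this multiple of the period leaves an imaginary part in [0, 2 pi). There cos = 1 forces
   0, by injectivity of cos on [0, pi], after a reflection in the second half. *)
pose k := Num.floor (cim u / tpi).
pose w := u - k%:~R * tpii.
have wH : expc w = 1 by rewrite /w expcD expcN expc_int invr1 mulr1.
have cret : cim (k%:~R * tpii) = k%:~R * tpi.
  by rewrite -(rmorph_int (@emb R)) cimM cre_emb cim_emb cim_tpii mul0r addr0.
have [t0 t1] : 0 <= cim w /\ cim w < tpi.
  have := real_floor_le (num_real (cim u / tpi)); rewrite ler_pdivlMr ?tpi_gt0 // -/k.
  have := real_floorD1_gt (num_real (cim u / tpi)); rewrite ltr_pdivrMr ?tpi_gt0 // -/k.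
  rewrite intrD mulrDl mul1r /w cimB cret => h1 h2.
  by split; lra.
have w0 : cre w = 0.
  have := congr1 (@cN R) wH; rewrite cN_expc cN1 => /(congr1 (@ln R)).
  by rewrite expRK ln1.
have := congr1 (@cre R) wH; have := congr1 (@cim R) wH.
rewrite cre_expc cim_expc w0 expR0 !mul1r -(rmorph1 (@emb R)) cre_emb cim_emb => sw cw.
have cw0 : cim w = 0.
  have [wpi|wpi] := leP (cim w) pi.
    apply: (@cos_inj R); rewrite ?in_itv /= ?t0 ?lexx ?pi_ge0 // cos0; exact: cw.
  have : cos (cim w - pi *+ 2) = 1 by rewrite -cw -{2}[cim w](subrK (pi *+ 2)) cosD2pi.
  rewrite -cosN opprB => h.
  have : pi *+ 2 - cim w = 0.
    move: t1; rewrite /tpi => t1; have := pi_ge0 R => p0.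
    apply: (@cos_inj R); rewrite ?in_itv /= ?lexx ?pi_ge0 //; last by rewrite cos0.
    by move: t1 wpi; rewrite mulr2n => *; lra.
  by move: t1; rewrite /tpi => ? /eqP; rewrite subr_eq0 => /eqP ?; lra.
exists k; apply/eqP; rewrite -subr_eq0 -/w; apply/eqP; apply: cext; by rewrite ?w0 ?cw0 raddf0.
Qed.

Lemma expc_inj u v : expc u = expc v -> exists k : int, u = v + k%:~R * tpii.
Proof.
move=> H; have /expc_eq1[k kE] : expc (u - v) = 1.
  by rewrite expcD expcN H mulfV ?expc_neq0.
by exists k; rewrite -kE addrC subrK.
Qed.

Lemma polar z : z != 0 -> exists u, expc u = z /\ cre u = ln (cN z).
Proof.
move=> z0; have n0 : 0 < cN z by rewrite cN_gt0.
have [th [c s]] : exists th, cos th = cre z / cN z /\ sin th = cim z / cN z.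
  pose x := cre z / cN z; pose y := cim z / cN z.
  have xy : x ^+ 2 + y ^+ 2 = 1.
    rewrite /x /y !expr_div_n -mulrDl cNE sqr_sqrtr ?addr_ge0 ?sqr_ge0 //.
    rewrite mulfV // gt_eqF // -sqrtr_gt0 -cNE //.
  have x1 : -1 <= x <= 1.
    have : `|x| <= 1 by rewrite -(@ler_pXn2r _ 2) ?nnegrE // expr1n real_normK ?num_real // -xy lerDl sqr_ge0.
    by rewrite ler_norml.
  have cx : cos (acos x) = x by apply: acosK; rewrite in_itv.
  have sx : sin (acos x) = `|y|.
    by rewrite sin_acos // -sqrtr_sqr; congr Num.sqrt; rewrite -xy; ring.
  have [y0|y0] := lerP 0 y.
    by exists (acos x); rewrite cx sx ger0_norm.
  by exists (- acos x); rewrite cosN sinN cx sx ltr0_norm // opprK.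
exists (pt (ln (cN z)) th); rewrite cre_pt; split=> //.
apply: cext; rewrite ?cre_expc ?cim_expc cre_pt cim_pt lnK ?posrE // ?c ?s mulrC divfK ?gt_eqF //.
Qed.

Definition logc_seq (n : nat) : C := if n is m.+1 then (-1) ^+ m / m.+1%:R else 0.
Definition logc z : C := ps logc_seq (z - 1).

Lemma dps_logc n : dps logc_seq n = (-1) ^+ n.
Proof. by rewrite /dps /= mulrC divfK // pnatr_eq0. Qed.

Lemma rad_logc : rad logc_seq 1.
Proof.
apply: (rad_geom (K := 1)) => // n; rewrite expr1n mulr1; case: n => [|n]; first by rewrite cN0.
rewrite cNM cNX cNN cN1 expr1n mul1r cNV cN_nat invf_le1 ?ler1n //.
Qed.

Lemma logc_hd z : cN (z - 1) < 1 -> hd logc z z^-1.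
Proof.
move=> z1; have z0 : z != 0.
  by apply: contraTneq z1 => ->; rewrite sub0r cNN cN1 ltxx.
have H := ps_hd rad_logc z1.
have E : z * ps (dps logc_seq) (z - 1) = 1.
  have S1 := psP (rad_dps rad_logc) z1.
  have S2 := is_csum_shift S1.
  have := is_csumD S1 S2; rewrite (_ : ps (dps logc_seq) (z - 1) + _ = z * ps (dps logc_seq) (z - 1)); last by ring.
  move/is_csum_uniq; apply.
  pose F n := dps logc_seq n * (z - 1) ^+ n + shift_seq (dps logc_seq) n * (z - 1) ^+ n.
  have FS : (fun n => F n.+1) = fun=> 0.
    by apply/funext => n; rewrite /F /= !dps_logc !exprS; ring.
  have FS0 : is_csum (fun n => F n.+1) 0 by rewrite FS; exact: is_csum0.
  have := is_csumS FS0; rewrite {2}/F dps_logc /= !expr0 mul0r !addr0 mulr1; exact.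
have -> : z^-1 = ps (dps logc_seq) (z - 1) * 1 by apply: (mulfI z0); rewrite mulfV // mulr1.
apply: (hd_comp (f := fun w => w - 1) (g := ps logc_seq) _ H).
by apply: hd_eq (hdB (hd_id z) (hd_cst 1 z)) _; exact: subr0.
Qed.

Lemma logc1 : logc 1 = 0.
Proof. by rewrite /logc subrr ps0. Qed.

(** The function exp(log w) / w has derivative 0 along the segment from 1 to z. *)
Lemma logcK z : cN (z - 1) < 1 -> expc (logc z) = z.
Proof.
move=> z1.
pose f w := expc (logc w) / w.
have : f z = f 1.
  apply: (hd0_cst (f := f)) => t /andP[t0 t1]; set w := 1 + _.
  have w1 : cN (w - 1) < 1.
    rewrite /w addrAC subrr add0r cNM cN_emb ger0_norm // (le_lt_trans _ z1) //.
    by rewrite ler_piMl ?cN_ge0.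
  have w0 : w != 0 by apply: contraTneq w1 => ->; rewrite sub0r cNN cN1 ltxx.
  apply: hd_eq (hdM (hd_comp (logc_hd w1) (hd_expc _)) (hdV (hd_id w) w0)) _.
  by field.
have z0 : z != 0 by apply: contraTneq z1 => ->; rewrite sub0r cNN cN1 ltxx.
by rewrite /f logc1 expc0 divr1 => /(congr1 (fun w => w * z)); rewrite divfK // mul1r.
Qed.
End ComplexExp.

(** * Second order linear equations *)

Lemma det_mx2 (F : comNzRingType) (M : 'M[F]_2) :
  \det M = M 0 0 * M 1 1 - M 0 1 * M 1 0.
Proof.
rewrite (expand_det_row _ ord0) !big_ord_recl big_ord0 addr0 /cofactor !det_mx11 !mxE /=.
rewrite !expr0 mul1r expr1 mulN1r mulrN.
by congr (M _ _ * M _ _ - M _ _ * M _ _); exact/val_inj.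
Qed.

Section LinearODE.
Variable R : realType.
Local Notation C := (Cx R).
Variables p q : C -> C.
Implicit Types (u v w : C) (D : C -> Prop) (Y Z : C -> C).

Definition convexC D := forall u v, D u -> D v ->
  forall t : R, 0 <= t <= 1 -> D (u + emb t * (v - u)).

(** The derivative is carried along as a second function, which turns the equation into a
    first-order system for the pair. *)
Definition lsol D Y Y' := forall u, D u -> hd Y u (Y' u) /\ hd Y' u (p u * Y' u + q u * Y u).
Definition wr Y Y' Z Z' u := Y u * Z' u - Y' u * Z u.

Lemma lsolS D D' Y Y' : lsol D Y Y' -> (forall u, D' u -> D u) -> lsol D' Y Y'.
Proof. by move=> H DD u /DD/H. Qed.

Lemma lsolD D Y Y' Z Z' : lsol D Y Y' -> lsol D Z Z' ->
  lsol D (fun u => Y u + Z u) (fun u => Y' u + Z' u).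
Proof.
move=> HY HZ u Du; have [y1 y2] := HY u Du; have [z1 z2] := HZ u Du.
by split; [exact: hdD|apply: hd_eq (hdD y2 z2) _; ring].
Qed.

Lemma lsolZ D c Y Y' : lsol D Y Y' -> lsol D (fun u => c * Y u) (fun u => c * Y' u).
Proof.
move=> HY u Du; have [y1 y2] := HY u Du.
by split; [exact: hdZ|apply: hd_eq (hdZ c y2) _; ring].
Qed.

Lemma wr_hd D Y Y' Z Z' u : lsol D Y Y' -> lsol D Z Z' -> D u ->
  hd (wr Y Y' Z Z') u (p u * wr Y Y' Z Z' u).
Proof.
move=> HY HZ Du; have [y1 y2] := HY u Du; have [z1 z2] := HZ u Du.
by apply: hd_eq (hdB (hdM y1 z2) (hdM y2 z1)) _; rewrite /wr; ring.
Qed.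

Implicit Types (B : 'I_2 -> C -> C) (M N : 'M[C]_2).

Definition lbasis D B B' := (forall j, lsol D (B j) (B' j)) /\
  (forall u, D u -> wr (B 0) (B' 0) (B 1) (B' 1) u != 0).

(** B is a row vector multiplied by M from the right, the convention of [monodromy_group]. *)
Definition comb B M : 'I_2 -> C -> C := fun j u => \sum_i M i j * B i u.

Lemma combE B M j u : comb B M j u = M 0 j * B 0 u + M 1 j * B 1 u.
Proof. by rewrite /comb !big_ord_recl big_ord0 addr0; congr (_ + M _ _ * B _ _); exact/val_inj. Qed.

Lemma combM B M N j u : comb (comb B M) N j u = comb B (M *m N) j u.
Proof.
rewrite /comb; under eq_bigr do rewrite mulr_sumr.
rewrite exchange_big; apply: eq_bigr => i _; rewrite mxE mulr_suml.
by apply: eq_bigr => k _; ring.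
Qed.

Lemma comb1 B j u : comb B 1%:M j u = B j u.
Proof.
rewrite /comb (bigD1 j) //= big1 ?addr0 ?mxE ?eqxx ?mul1r // => i ij.
by rewrite mxE (negPf ij) mul0r.
Qed.

Lemma eq_comb B1 B2 M j u v : (forall i, B1 i u = B2 i v) -> comb B1 M j u = comb B2 M j v.
Proof. by move=> H; apply: eq_bigr => i _; rewrite H. Qed.

Lemma lsol_comb D B B' M j : (forall j, lsol D (B j) (B' j)) ->
  lsol D (comb B M j) (comb B' M j).
Proof.
move=> H; have -> : comb B M j = fun u => M 0 j * B 0 u + M 1 j * B 1 u.
  by apply/funext => u; rewrite combE.
have -> : comb B' M j = fun u => M 0 j * B' 0 u + M 1 j * B' 1 u.
  by apply/funext => u; rewrite combE.
by apply: lsolD; apply: lsolZ.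
Qed.

Lemma wr_comb B B' M u : wr (comb B M 0) (comb B' M 0) (comb B M 1) (comb B' M 1) u =
  \det M * wr (B 0) (B' 0) (B 1) (B' 1) u.
Proof. by rewrite /wr !combE det_mx2; ring. Qed.

(** By Cramer's rule the coordinates are quotients of Wronskians. All Wronskians satisfy W' = p W,
    so the quotients have derivative 0. *)
Lemma coord_cst D B B' Z Z' : convexC D -> lbasis D B B' -> lsol D Z Z' ->
  exists c : 'I_2 -> C, forall u, D u ->
    Z u = c 0 * B 0 u + c 1 * B 1 u /\ Z' u = c 0 * B' 0 u + c 1 * B' 1 u.
Proof.
move=> cD [sB wB] sZ.
have [[u0 Du0]|no] := pselect (exists u, D u); last first.
  by exists (fun=> 0) => u Du; case: no; exists u.
pose W := wr (B 0) (B' 0) (B 1) (B' 1).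
pose c0 u := wr Z Z' (B 1) (B' 1) u / W u.
pose c1 u := wr (B 0) (B' 0) Z Z' u / W u.
have cst u : D u -> c0 u = c0 u0 /\ c1 u = c1 u0.
  move=> Du; split; apply: hd0_cst => t t01; have Dt := cD _ _ Du0 Du t t01.
    apply: hd_eq (hdM (wr_hd sZ (sB 1) Dt) (hdV (wr_hd (sB 0) (sB 1) Dt) (wB _ Dt))) _.
    by rewrite -/(W _); field; exact: wB.
  apply: hd_eq (hdM (wr_hd (sB 0) sZ Dt) (hdV (wr_hd (sB 0) (sB 1) Dt) (wB _ Dt))) _.
  by rewrite -/(W _); field; exact: wB.
exists (fun j => if j == 0 then c0 u0 else c1 u0) => u Du /=.
have [<- <-] := cst u Du; rewrite /c0 /c1 /W.
have := wB u Du; rewrite /wr => W0; split; field; exact: W0.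
Qed.

Lemma coord_mx D B B' (Z Z' : 'I_2 -> C -> C) : convexC D -> lbasis D B B' -> (forall j, lsol D (Z j) (Z' j)) ->
  exists M, forall j u, D u -> Z j u = comb B M j u /\ Z' j u = comb B' M j u.
Proof.
move=> cD bB sZ; have /choice[c cP] := fun j => coord_cst cD bB (sZ j).
exists (\matrix_(i, j) c j i) => j u Du; rewrite !combE !mxE; exact: cP.
Qed.

Lemma comb_inj D B B' M N u : lbasis D B B' -> D u ->
  (forall j, \forall w \near u, comb B M j w = comb B N j w) -> M = N.
Proof.
move=> [sB wB] Du MN.
have H j : comb B M j u = comb B N j u /\ comb B' M j u = comb B' N j u.
  have [m1 _] := lsol_comb M j sB Du; have [n1 _] := lsol_comb N j sB Du.
  split; last exact: hd_uniq (hd_near m1 (MN j)) n1.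
  by have /nearC[r r0] := MN j; apply; rewrite subrr cN0.
have W0 := wB u Du; rewrite /wr in W0.
apply/matrixP => i j; have [] := H j; rewrite !combE => e1 e2.
have d0 : (M 0 j - N 0 j) * (B 0 u * B' 1 u - B' 0 u * B 1 u) =
   B' 1 u * ((M 0 j * B 0 u + M 1 j * B 1 u) - (N 0 j * B 0 u + N 1 j * B 1 u))
   - B 1 u * ((M 0 j * B' 0 u + M 1 j * B' 1 u) - (N 0 j * B' 0 u + N 1 j * B' 1 u)) by ring.
have d1 : (M 1 j - N 1 j) * (B 0 u * B' 1 u - B' 0 u * B 1 u) =
   B 0 u * ((M 0 j * B' 0 u + M 1 j * B' 1 u) - (N 0 j * B' 0 u + N 1 j * B' 1 u))
   - B' 0 u * ((M 0 j * B 0 u + M 1 j * B 1 u) - (N 0 j * B 0 u + N 1 j * B 1 u)) by ring.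
rewrite e1 e2 !subrr !mulr0 subr0 in d0 d1.
have [i0|i0] := eqVneq i 0.
  by rewrite i0; apply/eqP; rewrite -subr_eq0; move/eqP: d0; rewrite mulf_eq0 (negPf W0) orbF.
have -> : i = 1 by apply/val_inj; case: i i0 => [[|[|]]].
by apply/eqP; rewrite -subr_eq0; move/eqP: d1; rewrite mulf_eq0 (negPf W0) orbF.
Qed.

Lemma lbasis_comb D B B' M : lbasis D B B' -> M \in unitmx -> lbasis D (comb B M) (comb B' M).
Proof.
move=> [sB wB] uM; split=> [j|u Du]; first exact: lsol_comb.
by rewrite wr_comb mulf_neq0 ?wB // -unitfE -unitmxE.
Qed.

Lemma comb_unit D B B' M u : D u ->
  wr (comb B M 0) (comb B' M 0) (comb B M 1) (comb B' M 1) u != 0 -> M \in unitmx.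
Proof. by move=> Du; rewrite wr_comb mulf_eq0 negb_or unitmxE unitfE => /andP[]. Qed.
End LinearODE.

(** * Locally constant maps on an interval *)

Section LocallyConstant.
Variable R : realType.

Definition clamp (a b t : R) : R := if t <= a then a else if b <= t then b else t.

Lemma clamp_itv a b t : a <= b -> a <= clamp a b t <= b.
Proof.
move=> ab; rewrite /clamp; case: (leP t a) => ta; first by rewrite lexx ab.
by case: (leP b t) => tb; [rewrite ab lexx|rewrite !ltW].
Qed.

Lemma clamp_lip a b s t : a <= b -> `|clamp a b s - clamp a b t| <= `|s - t|.
Proof.
move=> ab; have h1 := ler_norm (s - t); have h2 := ler_norm (t - s); rewrite distrC in h2.
move: h1 h2; move: `|s - t| => n h1 h2; rewrite /clamp ler_norml.
by case: (leP s a) => sa; case: (leP t a) => ta; try case: (leP b s) => sb;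
  try case: (leP b t) => tb; apply/andP; split; lra.
Qed.

Lemma clamp_l a b t : t <= a -> clamp a b t = a.
Proof. by rewrite /clamp => ->. Qed.

Lemma clamp_r a b t : a <= b -> b <= t -> clamp a b t = b.
Proof.
move=> ab bt; rewrite /clamp bt; case: (leP t a) => // ta.
by apply/eqP; rewrite eq_le ab (le_trans bt ta).
Qed.

(** T is an arbitrary type, so the argument runs on the 0-1 valued indicator of f t = f a; composed
    with [clamp] it is defined on the whole line and has derivative 0. *)
Lemma loc_cst (T : Type) (f : R -> T) (a b : R) : a <= b ->
  (forall x, a <= x <= b -> exists2 d, 0 < d &
     forall y, `|y - x| < d -> a <= y <= b -> f y = f x) -> f b = f a.
Proof.
move=> ab H.
pose g x : R := if `[< f (clamp a b x) = f a >] then 0 else 1.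
have gd x : is_derive x (1 : R) g 0.
  apply/rdP => e e0; have [d d0 dP] := H _ (clamp_itv x ab); exists d => // h hd.
  have -> : g (x + h) = g x.
    rewrite /g (dP (clamp a b (x + h))) ?clamp_itv // (le_lt_trans (clamp_lip _ _ ab)) //.
    by rewrite addrAC subrr add0r.
  by rewrite subrr sub0r mulr0 oppr0 normr0 mulr_ge0 // ltW.
have := is_derive_0_is_cst b a gd; rewrite /g (clamp_r ab (lexx b)) (clamp_l b (lexx a)).
rewrite [X in _ = X -> _]ifT; last exact/asboolP.
by case: asboolP => // _ /eqP; rewrite oner_eq0.
Qed.
End LocallyConstant.

(** * The hypergeometric equation in the coordinate log z *)

Section LogHypergeometric.
Variable R : realType.
Local Notation C := (Cx R).
Variables al be : C.
Implicit Types (u v w z : C).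

Definition gam : C := al + be + 2^-1.
(* In the coordinate u = log z the hypergeometric equation with parameters    *)
(* al, be, gam = al + be + 1/2 reads Y'' = hp Y' + hq Y.                      *)
Definition hp u : C := - (gam - 1 - (al + be) * expc u) / (1 - expc u).
Definition hq u : C := al * be * expc u / (1 - expc u).

Definition leftP u := cre u < 0.
Definition rightP u := 0 < cre u.

Lemma left_cN u : leftP u -> cN (expc u) < 1.
Proof. by rewrite cN_expc expR_lt1. Qed.
Lemma right_cN u : rightP u -> cN (expc (- u)) < 1.
Proof. by rewrite cN_expc raddfN /= expR_lt1 oppr_lt0. Qed.
Lemma one_sub_neq0 z : cN z < 1 -> 1 - z != 0.
Proof. by move=> H; rewrite subr_eq0; apply: contraTneq H => <-; rewrite cN1 ltxx. Qed.
Lemma left_neq u : leftP u -> 1 - expc u != 0.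
Proof. by move/left_cN/one_sub_neq0. Qed.
Lemma right_neq u : rightP u -> 1 - expc u != 0.
Proof.
move/right_cN => H; apply: contraTneq H => /eqP; rewrite subr_eq0 => /eqP E.
by rewrite expcN -E invr1 cN1 ltxx.
Qed.

Section Left.
Variable s : C.
Let a := s + al. Let b := s + be. Let c := 2 * s + gam.
(** The Frobenius solution z^s F(z) at z = 0; s will be one of the exponents 0 and 1 - gam. *)
Definition lefts u := expc (s * u) * hgF a b c (expc u).
Definition lefts' u := expc (s * u) * (s * hgF a b c (expc u) + expc u * hgF1 a b c (expc u)).

Lemma lefts_sol : s * (s + gam - 1) = 0 -> (forall n, n%:R + c != 0) ->
  lsol hp hq leftP lefts lefts'.
Proof.
move=> hs hc u Lu; have w1 := left_cN Lu; have W0 := left_neq Lu.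
have G0 := hd_comp (hd_expc u) (hgF_hd a b hc w1).
have G1 := hd_comp (hd_expc u) (hgF1_hd a b hc w1).
have E := hd_expcZ s u.
split; first by apply: hd_eq (hdM E G0) _; rewrite /lefts'; ring.
apply: hd_eq (hdM E (hdD (hdZ s G0) (hdM (hd_expc u) G1))) _.
have := hgF_ode a b hc w1; rewrite /lefts /lefts' /hp /hq.
set w := expc u in W0 *; set F := hgF a b c w; set F1 := hgF1 a b c w; set F2 := hgF2 a b c w.
set e := expc (s * u) => ode.
have key : (1 - w) * (s ^+ 2 * F + (2 * s + 1) * w * F1 + w ^+ 2 * F2) =
   - (gam - 1 - (al + be) * w) * (s * F + w * F1) + al * be * w * F.
  apply/eqP; rewrite -subr_eq0; apply/eqP.
  have := congr2 (fun x y => w * x + y * F) ode hs.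
  by rewrite mulr0 mul0r addr0 => <-; rewrite /a /b /c; ring.
apply: (mulfI W0).
rewrite [LHS](_ : _ = e * ((1 - w) * (s ^+ 2 * F + (2 * s + 1) * w * F1 + w ^+ 2 * F2))); last by ring.
by rewrite key; field.
Qed.
End Left.

Section Right.
Variable s : C.
Let a := - s. Let b := 1 - s - gam. Let c := 1 - 2 * s - (al + be).
(** Kummer's solution z^s F(1/z) at z = infinity; s will be -al or -be. *)
Definition rights u := expc (s * u) * hgF a b c (expc (- u)).
Definition rights' u := expc (s * u) *
  (s * hgF a b c (expc (- u)) - expc (- u) * hgF1 a b c (expc (- u))).

Lemma rights_sol : (s + al) * (s + be) = 0 -> (forall n, n%:R + c != 0) ->
  lsol hp hq rightP rights rights'.
Proof.
move=> hs hc u Lu; have w1 := right_cN Lu; have W0 := one_sub_neq0 w1.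
have EN : hd (fun u => expc (- u)) u (- expc (- u)).
  by apply: hd_eq (hd_comp (hdN (hd_id u)) (hd_expc _)) _; rewrite mulrN1.
have G0 := hd_comp EN (hgF_hd a b hc w1).
have G1 := hd_comp EN (hgF1_hd a b hc w1).
have E := hd_expcZ s u.
split; first by apply: hd_eq (hdM E G0) _; rewrite /rights'; ring.
apply: hd_eq (hdM E (hdB (hdZ s G0) (hdM EN G1))) _.
have := hgF_ode a b hc w1; rewrite /rights /rights' /hp /hq.
have -> : expc u = (expc (- u))^-1 by rewrite expcN invrK.
have wn := expc_neq0 (- u).
set w := expc (- u) in W0 wn *.
set F := hgF a b c w; set F1 := hgF1 a b c w; set F2 := hgF2 a b c w.
set e := expc (s * u) => ode.
have key : (w - 1) * (s ^+ 2 * F + (1 - 2 * s) * w * F1 + w ^+ 2 * F2) =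
   - ((gam - 1) * w - (al + be)) * (s * F - w * F1) + al * be * F.
  apply/eqP; rewrite -subr_eq0; apply/eqP.
  have := congr2 (fun x y => - w * x - y * F) ode hs.
  by rewrite mulr0 mul0r subr0 => <-; rewrite /a /b /c; ring.
have W1 : w - 1 != 0 by rewrite -opprB oppr_eq0.
apply: (mulfI W1).
rewrite [LHS](_ : _ = e * ((w - 1) * (s ^+ 2 * F + (1 - 2 * s) * w * F1 + w ^+ 2 * F2))); last by ring.
by rewrite key; field; rewrite wn W1.
Qed.
End Right.

(* The solution that is holomorphic and nonzero at the singular point u = 0,  *)
(* where the exponents are 0 and 1/2.                                         *)
Definition phi u := hgF al be (2^-1) (1 - expc u).
Definition phi' u := - expc u * hgF1 al be (2^-1) (1 - expc u).

Lemma half_nat (n : nat) : n%:R + 2^-1 != 0 :> C.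
Proof.
have -> : n%:R + 2^-1 = emb (n%:R + 2^-1) :> C by rewrite rmorphD /= rmorph_nat fmorphV rmorph_nat.
by rewrite fmorph_eq0 gt_eqF // ltr_wpDl // invr_gt0.
Qed.

Lemma phi_sol : lsol hp hq (fun u => cN (1 - expc u) < 1 /\ 1 - expc u != 0) phi phi'.
Proof.
move=> u [w1 W0].
have EN : hd (fun u => 1 - expc u) u (- expc u).
  by apply: hd_eq (hdB (hd_cst 1 u) (hd_expc u)) _; rewrite sub0r.
have G0 := hd_comp EN (hgF_hd al be half_nat w1).
have G1 := hd_comp EN (hgF1_hd al be half_nat w1).
split; first by apply: hd_eq G0 _; rewrite /phi'; ring.
apply: hd_eq (hdM (hdN (hd_expc u)) G1) _.
have := hgF_ode al be half_nat w1; rewrite /phi /phi' /hp /hq /gam.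
set w := expc u in W0 *.
set F := hgF al be _ _; set F1 := hgF1 al be _ _; set F2 := hgF2 al be _ _ => ode.
have key : (1 - w) * (w ^+ 2 * F2 - w * F1) =
   - (al + be + 2^-1 - 1 - (al + be) * w) * (- w * F1) + al * be * w * F.
  apply/eqP; rewrite -subr_eq0; apply/eqP.
  have := congr1 (fun x => w * x) ode; rewrite mulr0 => <-; by field.
apply: (mulfI W0).
rewrite [LHS](_ : _ = (1 - w) * (w ^+ 2 * F2 - w * F1)); last by ring.
by rewrite key; field.
Qed.

(** Abel's formula: W is a constant times e^(-(gam - 1) u) (1 - e^u)^(-1/2). Squaring W avoids
    choosing a branch of the root. *)
Lemma wr_nz D Y Y' Z Z' u v : convexC D -> (forall u, D u -> 1 - expc u != 0) ->
  lsol hp hq D Y Y' -> lsol hp hq D Z Z' -> D u -> D v ->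
  wr Y Y' Z Z' u != 0 -> wr Y Y' Z Z' v != 0.
Proof.
move=> cD nD sY sZ Du Dv.
pose k := 2 * (gam - 1).
pose V w := wr Y Y' Z Z' w ^+ 2 * (expc (k * w) * (1 - expc w)).
have VE : V v = V u.
  apply: (hd0_cst (f := V)) => t t01; have Dt := cD _ _ Du Dv t t01.
  set w := u + _; have Wn := nD _ Dt.
  apply: hd_eq (hdM (hdX 2 (wr_hd sY sZ Dt)) (hdM (hd_expcZ k w) (hdB (hd_cst 1 w) (hd_expc w)))) _.
  by rewrite -/w /hp /k /gam /=; field; rewrite -/w in Wn.
apply: contraNneq => W0; move: VE; rewrite /V W0 expr0n mul0r => /esym/eqP.
by rewrite !mulf_eq0 (negPf (expc_neq0 _)) (negPf (nD _ Du)) !orbF orbb.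
Qed.

Lemma convex_left : convexC leftP.
Proof.
move=> u v; rewrite /leftP => hu hv t /andP[t0 t1]; rewrite creD creM creB cre_emb cim_emb mul0r subr0.
have [t1'|t1'] := ltP t 1; first by nra.
have -> : t = 1 by apply/eqP; rewrite eq_le t1 t1'.
by lra.
Qed.
Lemma convex_right : convexC rightP.
Proof.
move=> u v; rewrite /rightP => hu hv t /andP[t0 t1]; rewrite creD creM creB cre_emb cim_emb mul0r subr0.
have [t1'|t1'] := ltP t 1; first by nra.
have -> : t = 1 by apply/eqP; rewrite eq_le t1 t1'.
by lra.
Qed.
Definition ballP (c : C) (r : R) u := cN (u - c) < r.
Lemma convex_ball c r : convexC (ballP c r).
Proof.
move=> u v hu hv t /andP[t0 t1]; rewrite /ballP.
rewrite (_ : _ - c = emb (1 - t) * (u - c) + emb t * (v - c)); last first.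
  by rewrite rmorphB rmorph1 /=; ring.
rewrite (le_lt_trans (cND _ _)) // !cNM !cN_emb !ger0_norm ?subr_ge0 //.
move: hu hv; rewrite /ballP; set x := cN _; set y := cN _ => hx hy.
have [t1'|t1'] := ltP t 1; first by nra.
have -> : t = 1 by apply/eqP; rewrite eq_le t1 t1'.
by lra.
Qed.
Lemma convexI D D' : @convexC R D -> convexC D' -> convexC (fun u => D u /\ D' u).
Proof. by move=> h h' u v [a b] [c d] t t01; split; [exact: h|exact: h']. Qed.

Lemma local_basis u0 : 1 - expc u0 != 0 -> exists r : R, 0 < r /\ exists B B',
  (forall u, ballP u0 r u -> 1 - expc u != 0) /\ lbasis hp hq (ballP u0 r) B B'.
Proof.
move=> n0; set z0 := expc u0 in n0.
have z00 : z0 != 0 by exact: expc_neq0.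
have p00 : z0 * (1 - z0) != 0 by rewrite mulf_neq0.
(* These are the coefficients of the hypergeometric equation re-expanded in powers of z - [z0]. *)
have [r r0 rP] := @ps_regular _ _ (1 - 2 * z0) (-1) (gam - (al + be + 1) * z0)
  (- (al + be + 1)) (- (al * be)) p00.
have [a [a0 a1 ar arec]] := rP 1 0.
have [b [b0 b1 br brec]] := rP 0 1.
have n0' : 0 < cN (1 - z0) by rewrite cN_gt0.
have [d d0 dP] := hd_cont (hd_expc u0) (ltac:(by rewrite lt_min r0 n0') : 0 < Num.min r (cN (1 - z0))).
pose Y (a : nat -> C) u := ps a (expc u - z0).
pose Y' (a : nat -> C) u := expc u * ps (dps a) (expc u - z0).
have dom u : ballP u0 d u -> cN (expc u - z0) < r /\ 1 - expc u != 0.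
  move=> /dP; rewrite lt_min => /andP[h1 h2]; split=> //.
  by apply: contraTneq h2 => /eqP; rewrite subr_eq0 => /eqP <-; rewrite ltxx.
have sol (f : nat -> C) : rad f r -> (forall n, z0 * (1 - z0) * (n.+2%:R * n.+1%:R) * f n.+2 +
    n.+1%:R * ((1 - 2 * z0) * n%:R + (gam - (al + be + 1) * z0)) * f n.+1 +
    (-1 * (n%:R * (n%:R - 1)) + - (al + be + 1) * n%:R + - (al * be)) * f n = 0) ->
   lsol hp hq (ballP u0 d) (Y f) (Y' f).
  move=> fr frec u /dom[ur W0].
  have EN : hd (fun u => expc u - z0) u (expc u).
    by apply: hd_eq (hdB (hd_expc u) (hd_cst z0 u)) _; rewrite subr0.
  have G0 := hd_comp EN (ps_hd fr ur).
  have G1 := hd_comp EN (ps_hd (rad_dps fr) ur).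
  split; first by apply: hd_eq G0 _; rewrite /Y' mulrC.
  apply: hd_eq (hdM (hd_expc u) G1) _.
  have := ps_ode fr ur frec; rewrite /Y /Y' /hp /hq.
  set F := ps f _; set F1 := ps (dps f) _; set F2 := ps (dps (dps f)) _.
  set w := expc u in W0 *; move=> ode.
  have key : (1 - w) * (w * F1 + w ^+ 2 * F2) =
     - (gam - 1 - (al + be) * w) * (w * F1) + al * be * w * F.
    apply/eqP; rewrite -subr_eq0; apply/eqP.
    by have := congr1 (fun x => w * x) ode; rewrite mulr0 => <-; ring.
  apply: (mulfI W0).
  rewrite [LHS](_ : _ = (1 - w) * (w * F1 + w ^+ 2 * F2)); last by ring.
  by rewrite key; field.
pose B (j : 'I_2) := if j == 0 then Y a else Y b.
pose B' (j : 'I_2) := if j == 0 then Y' a else Y' b.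
have sB j : lsol hp hq (ballP u0 d) (B j) (B' j).
  by rewrite /B /B'; case: ifP => _; exact: sol.
have u0d : ballP u0 d u0 by rewrite /ballP subrr cN0.
have W : wr (B 0) (B' 0) (B 1) (B' 1) u0 != 0.
  by rewrite /wr /B /B' /= /Y /Y' -/z0 subrr !ps0 /dps a0 a1 b0 b1 !mulr1 !mulr0 subr0 mul1r.
have nz u : ballP u0 d u -> 1 - expc u != 0 by case/dom.
exists d; split=> //; exists B, B'; split; first exact: nz.
split; first exact: sB.
by move=> u du; exact: (wr_nz (@convex_ball u0 d) nz (sB 0) (sB 1) u0d du W).
Qed.
End LogHypergeometric.

(** * Transition matrices *)

Section Transition.
Variable R : realType.
Local Notation C := (Cx R).
Variables al be : C.
Local Notation gam := (gam al be).
Local Notation hp := (hp al be).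
Local Notation hq := (hq al be).
Hypothesis g0 : forall n : nat, n%:R + gam != 0.
Hypothesis g1 : forall n : nat, n%:R + (2 - gam) != 0.
Hypothesis gn : 1 - gam != 0.
Hypothesis ab0 : forall n : nat, n%:R + (1 + al - be) != 0.
Hypothesis ab1 : forall n : nat, n%:R + (1 + be - al) != 0.
Hypothesis abn : al - be != 0.
Implicit Types (u v w z : C) (M N : 'M[C]_2).

Definition sel (T : Type) (x y : T) (j : 'I_2) := if j == 0 then x else y.

(* Bases on Re u < 0 and Re u > 0, that is, near z = 0 and z = infinity.      *)
Definition cL := sel (lefts al be 0) (lefts al be (1 - gam)).
Definition cL' := sel (lefts' al be 0) (lefts' al be (1 - gam)).
Definition bR := sel (rights al be (- al)) (rights al be (- be)).
Definition bR' := sel (rights' al be (- al)) (rights' al be (- be)).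

Lemma cLE j u : cL j u = if j == 0 then lefts al be 0 u else lefts al be (1 - gam) u.
Proof. by rewrite /cL /sel; case: (j == 0). Qed.

Lemma cL_sol j : lsol hp hq (@leftP R) (cL j) (cL' j).
Proof.
rewrite /cL /cL' /sel; case: ifP => _; apply: lefts_sol.
- by rewrite mul0r.
- by move=> n; rewrite mulr0 add0r.
- by rewrite (_ : 1 - gam + gam - 1 = 0) ?mulr0 //; ring.
- by move=> n; rewrite (_ : 2 * (1 - gam) + gam = 2 - gam) //; ring.
Qed.

Lemma bR_sol j : lsol hp hq (@rightP R) (bR j) (bR' j).
Proof.
rewrite /bR /bR' /sel; case: ifP => _; apply: rights_sol.
- by rewrite addNr mul0r.
- by move=> n; rewrite (_ : 1 - _ - _ = 1 + al - be) //; ring.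
- by rewrite addNr mulr0.
- by move=> n; rewrite (_ : 1 - _ - _ = 1 + be - al) //; ring.
Qed.

Lemma nz_near (h : C -> C) d : hd h 0 d -> h 0 != 0 ->
  exists w, [/\ w != 0, cN w < 1 & h w != 0].
Proof.
move=> hh h0; have h0' : 0 < cN (h 0) by rewrite cN_gt0.
have [r r0 rP] := hd_cont hh h0'.
pose x : R := Num.min r 1 / 2.
have m0 : 0 < Num.min r 1 by rewrite lt_min r0 ltr01.
have x0 : 0 < x by rewrite divr_gt0.
have xr : x < r.
  by rewrite /x ltr_pdivrMr // (le_lt_trans (_ : _ <= r)) ?ge_min ?lexx // ltr_pMr // ltr1n.
have x1 : x < 1.
  by rewrite /x ltr_pdivrMr // (le_lt_trans (_ : _ <= 1)) ?ge_min ?lexx ?orbT // mul1r ltr1n.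
have cx : cN (emb x) = x by rewrite cN_emb ger0_norm // ltW.
exists (emb x); split; first by rewrite -cN_gt0 cx.
  by rewrite cx.
have := rP (emb x); rewrite subr0 cx => /(_ xr) H.
by apply: contraTneq H => ->; rewrite sub0r cNN ltxx.
Qed.

Lemma exists_left w : w != 0 -> cN w < 1 -> exists2 u, expc u = w & leftP u.
Proof.
move=> w0 w1; have [u [uw cu]] := polar w0; exists u => //.
by rewrite /leftP cu ln_lt0 // w1 andbT cN_gt0.
Qed.

(** The Wronskian without its exponential factor; it tends to t - s as w tends to 0. The point found
    must be nonzero, as it has to be of the form e^u. The lemma serves z = 0 with w = z and z =
    infinity with w = 1/z. *)
Lemma wr_lefts s t a b c a' b' c' : (forall n : nat, n%:R + c != 0) ->
  (forall n : nat, n%:R + c' != 0) -> t - s != 0 -> exists w, [/\ w != 0, cN w < 1 &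
  hgF a b c w * (t * hgF a' b' c' w + w * hgF1 a' b' c' w)
  - (s * hgF a b c w + w * hgF1 a b c w) * hgF a' b' c' w != 0].
Proof.
move=> hc hc' ts.
have z1 : cN (0 : C) < 1 by rewrite cN0 ltr01.
have F0 := hgF_hd a b hc z1; have F1 := hgF1_hd a b hc z1.
have G0 := hgF_hd a' b' hc' z1; have G1 := hgF1_hd a' b' hc' z1.
apply: nz_near (hdB (hdM F0 (hdD (hdZ t G0) (hdM (hd_id 0) G1)))
  (hdM (hdD (hdZ s F0) (hdM (hd_id 0) F1)) G0)) _.
by rewrite !hgF0 !mul0r !addr0 !mulr1 mul1r.
Qed.

Lemma cL_basis : lbasis hp hq (@leftP R) cL cL'.
Proof.
split; first exact: cL_sol.
have hc : forall n : nat, n%:R + (2 * 0 + gam) != 0 by move=> n; rewrite mulr0 add0r.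
have hc' : forall n : nat, n%:R + (2 * (1 - gam) + gam) != 0.
  by move=> n; rewrite (_ : 2 * (1 - gam) + gam = 2 - gam) //; ring.
have ts : 1 - gam - 0 != 0 by rewrite subr0.
have [w [w0 w1 W]] := wr_lefts (0 + al) (0 + be) (1 - gam + al) (1 - gam + be) hc hc' ts.
have [u uw Lu] := exists_left w0 w1.
move=> v Lv; apply: (wr_nz (@convex_left R) (@left_neq R) (cL_sol 0) (cL_sol 1) Lu Lv).
rewrite /wr /cL /cL' /sel /= /lefts /lefts' uw.
rewrite (_ : _ - _ = expc (0 * u) * expc ((1 - gam) * u) *
  (hgF (0 + al) (0 + be) (2 * 0 + gam) w * ((1 - gam) * hgF (1 - gam + al) (1 - gam + be) (2 * (1 - gam) + gam) w
  + w * hgF1 (1 - gam + al) (1 - gam + be) (2 * (1 - gam) + gam) w)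
  - (0 * hgF (0 + al) (0 + be) (2 * 0 + gam) w + w * hgF1 (0 + al) (0 + be) (2 * 0 + gam) w)
   * hgF (1 - gam + al) (1 - gam + be) (2 * (1 - gam) + gam) w)).
  by rewrite !mulf_neq0 ?expc_neq0.
by set A := expc _; set B := expc _; set F := hgF _ _ _ w; set G := hgF _ _ _ w;
  set F1 := hgF1 _ _ _ w; set G1 := hgF1 _ _ _ w; ring.
Qed.

Lemma bR_basis : lbasis hp hq (@rightP R) bR bR'.
Proof.
split; first exact: bR_sol.
have hc : forall n : nat, n%:R + (1 - 2 * - al - (al + be)) != 0.
  by move=> n; rewrite (_ : 1 - _ - _ = 1 + al - be) //; ring.
have hc' : forall n : nat, n%:R + (1 - 2 * - be - (al + be)) != 0.
  by move=> n; rewrite (_ : 1 - _ - _ = 1 + be - al) //; ring.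
have ts : be - al != 0 by rewrite -opprB oppr_eq0.
have [w [w0 w1 W]] := wr_lefts (- - al) (1 - - al - gam) (- - be) (1 - - be - gam) hc hc' ts.
have [u uw Lu] := exists_left w0 w1.
have Ru : rightP (- u) by rewrite /rightP creN oppr_gt0.
move=> v Rv; apply: (wr_nz (@convex_right R) (@right_neq R) (bR_sol 0) (bR_sol 1) Ru Rv).
rewrite /wr /bR /bR' /sel /= /rights /rights'; rewrite !opprK in W *; rewrite uw.
set A := expc _; set B := expc _; move: W.
set F := hgF _ _ _ w; set G := hgF _ _ _ w; set G1 := hgF1 _ _ _ w; set F1 := hgF1 _ _ _ w.
move=> W; rewrite [X in X != 0](_ : _ = - (A * B) * (F * (be * G + w * G1) - (al * F + w * F1) * G)); last by ring.
by rewrite !mulf_neq0 ?oppr_eq0 ?mulf_neq0 ?expc_neq0.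
Qed.

Definition iy (t : R) : C := ci R * emb t.
Lemma cre_iy t : cre (iy t) = 0.
Proof. by rewrite /iy creM cre_ci cim_ci cre_emb cim_emb; ring. Qed.
Lemma cim_iy t : cim (iy t) = t.
Proof. by rewrite /iy cimM cre_ci cim_ci cre_emb cim_emb; ring. Qed.
Lemma iyB s t : iy s - iy t = iy (s - t).
Proof. by rewrite /iy rmorphB /=; ring. Qed.
Lemma cN_iy t : cN (iy t) = `|t|.
Proof. by rewrite /iy cNM cN_ci mul1r cN_emb. Qed.

(* Continuation across the point i t of the axis turns cL into bR * N.        *)
Definition Tr (t : R) N := N \in unitmx /\ exists r : R, 0 < r /\ exists Z Z',
  [/\ lbasis hp hq (ballP (iy t) r) Z Z',
      forall j u, ballP (iy t) r u -> leftP u -> Z j u = cL j u &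
      forall j u, ballP (iy t) r u -> rightP u -> Z j u = comb bR N j u].

Lemma ball_left t (r : R) : 0 < r -> ballP (iy t) r (iy t - emb (r / 2)) /\ leftP (iy t - emb (r / 2)).
Proof.
move=> r0; rewrite /ballP /leftP addrAC subrr add0r cNN cN_emb ger0_norm ?divr_ge0 ?(ltW r0) //.
by rewrite creB cre_iy cre_emb; split; lra.
Qed.
Lemma ball_right t (r : R) : 0 < r -> ballP (iy t) r (iy t + emb (r / 2)) /\ rightP (iy t + emb (r / 2)).
Proof.
move=> r0; rewrite /ballP /rightP addrAC subrr add0r cN_emb ger0_norm ?divr_ge0 ?(ltW r0) //.
by rewrite creD cre_iy cre_emb; split; lra.
Qed.

Lemma near_ball c (r : R) u : ballP c r u -> \forall w \near u, ballP c r w.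
Proof.
move=> ur; apply/nearC; exists (r - cN (u - c)); first by rewrite subr_gt0.
by move=> w; rewrite /ballP ltrBrDr => h; rewrite (le_lt_trans (cNDB w c u)).
Qed.
Lemma near_left u : leftP u -> \forall w \near u, leftP w.
Proof.
move=> Lu; apply/nearC; exists (- cre u); first by rewrite oppr_gt0.
move=> w h; have := le_lt_trans (cre_le (w - u)) h; rewrite creB /leftP ltr_norml; lra.
Qed.
Lemma near_right u : rightP u -> \forall w \near u, rightP w.
Proof.
move=> Lu; apply/nearC; exists (cre u) => // w h.
by have := le_lt_trans (cre_le (w - u)) h; rewrite creB /rightP ltr_norml; lra.
Qed.

Lemma Tr_exists t : 1 - expc (iy t) != 0 -> exists N, Tr t N.
Proof.
move=> n0; have [r [r0 [B [B' [nz bB]]]]] := local_basis al be n0.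
have [[bl ll] [br rr]] := (ball_left t r0, ball_right t r0).
have cvL := convexI (@convex_ball R (iy t) r) (@convex_left R).
have cvR := convexI (@convex_ball R (iy t) r) (@convex_right R).
have [sB wB] := bB.
have bBL : lbasis hp hq (fun u => ballP (iy t) r u /\ leftP u) B B'.
  by split=> [j|u [bu _]]; [apply: lsolS (sB j) _ => u []|exact: wB].
have bBR : lbasis hp hq (fun u => ballP (iy t) r u /\ rightP u) bR bR'.
  have [h1 h2] := bR_basis.
  by split=> [j|u [_ ru]]; [apply: lsolS (h1 j) _ => u []|exact: h2].
have scL j : lsol hp hq (fun u => ballP (iy t) r u /\ leftP u) (cL j) (cL' j).
  by apply: lsolS (cL_sol j) _ => u [].
have [M MP] := coord_mx cvL bBL scL.
have uM : M \in unitmx.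
  have := cL_basis.2 _ ll; rewrite /wr.
  have [-> ->] := MP 0 _ (conj bl ll); have [-> ->] := MP 1 _ (conj bl ll).
  exact: (comb_unit (D := @leftP R) ll).
have bZ := lbasis_comb bB uM.
have sZR j : lsol hp hq (fun u => ballP (iy t) r u /\ rightP u) (comb B M j) (comb B' M j).
  by apply: lsolS (bZ.1 j) _ => u [].
have [N NP] := coord_mx cvR bBR sZR.
have uN : N \in unitmx.
  have := bZ.2 _ br; rewrite /wr.
  have [-> ->] := NP 0 _ (conj br rr); have [-> ->] := NP 1 _ (conj br rr).
  exact: (comb_unit (D := @rightP R) rr).
exists N; split=> //; exists r; split=> //; exists (comb B M), (comb B' M); split=> //.
  by move=> j u bu lu; have [->] := MP j u (conj bu lu).
by move=> j u bu lu; have [->] := NP j u (conj bu lu).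
Qed.

Lemma Tr_uniq t N N' : Tr t N -> Tr t N' -> N = N'.
Proof.
move=> [uN [r [r0 [Z [Z' [bZ lZ rZ]]]]]] [uN' [s [s0 [W [W' [bW lW rW]]]]]].
pose x := Num.min r s; have x0 : 0 < x by rewrite lt_min r0.
have xr : x <= r by rewrite ge_min lexx.
have xs : x <= s by rewrite ge_min lexx orbT.
have br u : ballP (iy t) x u -> ballP (iy t) r u by move/lt_le_trans; apply.
have bs u : ballP (iy t) x u -> ballP (iy t) s u by move/lt_le_trans; apply.
have [[bl ll] [bri rr]] := (ball_left t x0, ball_right t x0).
have bZx : lbasis hp hq (ballP (iy t) x) Z Z'.
  by split=> [j|u /br]; [apply: lsolS (bZ.1 j) br|exact: bZ.2].
have sW j : lsol hp hq (ballP (iy t) x) (W j) (W' j) by apply: lsolS (bW.1 j) bs.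
have [M MP] := coord_mx (@convex_ball R (iy t) x) bZx sW.
have M1 : M = 1%:M.
  apply: (comb_inj bZx bl) => j; near=> w.
  have bw : ballP (iy t) x w by near: w; exact: near_ball.
  have lw : leftP w by near: w; exact: near_left.
  by rewrite comb1 -(MP j w bw).1 lW ?lZ //; [exact: br|exact: bs].
apply: (comb_inj bR_basis rr) => j; near=> w.
have bw : ballP (iy t) x w by near: w; exact: near_ball.
have rw : rightP w by near: w; exact: near_right.
rewrite -rZ //; last exact: br.
by rewrite -rW //; [rewrite (MP j w bw).1 M1 comb1|exact: bs].
Unshelve. all: by end_near. Qed.

Lemma Tr_open t N : Tr t N -> exists2 d : R, 0 < d & forall t', `|t' - t| < d -> Tr t' N.
Proof.
move=> [uN [r [r0 [Z [Z' [bZ lZ rZ]]]]]]; exists (r / 2); first by rewrite divr_gt0.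
move=> t' tt'; split=> //; exists (r / 2); split; first by rewrite divr_gt0.
have sub u : ballP (iy t') (r / 2) u -> ballP (iy t) r u.
  rewrite /ballP => h; rewrite (le_lt_trans (cNDB u (iy t) (iy t'))) // iyB cN_iy.
  by rewrite [r]splitr ltrD.
exists Z, Z'; split.
- by split=> [j|u /sub]; [apply: lsolS (bZ.1 j) sub|exact: bZ.2].
- by move=> j u /sub; exact: lZ.
- by move=> j u /sub; exact: rZ.
Qed.

(** By [Tr_open] and [Tr_uniq] any choice of a transition matrix is locally constant in t. *)
Lemma Tr_const t1 t2 N : t1 <= t2 -> (forall t, t1 <= t <= t2 -> 1 - expc (iy t) != 0) ->
  (Tr t1 N <-> Tr t2 N).
Proof.
move=> t12 nz.
have /choice[f fP] : forall t : R, exists N, t1 <= t <= t2 -> Tr t N.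
  move=> t; have [tt|] := boolP (t1 <= t <= t2); last by exists 0.
  by have [N' NP] := Tr_exists (nz t tt); exists N'.
have h1 : t1 <= t1 <= t2 by rewrite lexx t12.
have h2 : t1 <= t2 <= t2 by rewrite lexx t12.
have E : f t2 = f t1.
  apply: loc_cst t12 _ => x xt; have [d d0 dP] := Tr_open (fP x xt).
  by exists d => // y yx yt; apply: Tr_uniq (fP y yt) (dP y yx).
split=> H.
  by rewrite (Tr_uniq H (fP _ h1)) -E; exact: fP.
by rewrite (Tr_uniq H (fP _ h2)) E; exact: fP.
Qed.

Lemma iy_nz t (k : int) : k%:~R * tpi R < t -> t < (k%:~R + 1) * tpi R -> 1 - expc (iy t) != 0.
Proof.
move=> h1 h2; rewrite subr_eq0 eq_sym; apply/eqP => /expc_eq1[m mE].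
have tE : t = m%:~R * tpi R.
  have := congr1 (@cim R) mE; rewrite cim_iy => ->.
  by rewrite -(rmorph_int (@emb R)) cimM cre_emb cim_emb cim_tpii mul0r addr0.
move: h1 h2; rewrite tE !ltr_pM2r ?tpi_gt0 // ltr_int -(intrD _ k 1) ltr_int ltzD1 => km mk.
by move: (lt_le_trans km mk); rewrite ltxx.
Qed.

(* Translation by tau k = 2 pi i k acts on cL by rho k and on bR by Dm k.     *)
Definition tau (k : int) : C := k%:~R * tpii R.
Definition rho (k : int) : 'M[C]_2 := diag_mx (\row_j sel 1 (expc ((1 - gam) * tau k)) j).
Definition Dm (k : int) : 'M[C]_2 := diag_mx (\row_j sel (expc (- al * tau k)) (expc (- be * tau k)) j).

Lemma expc_tau k : expc (tau k) = 1. Proof. exact: expc_int. Qed.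
Lemma cre_tau k : cre (tau k) = 0.
Proof. by rewrite /tau -(rmorph_int (@emb R)) creM cre_emb cim_emb cre_tpii; ring. Qed.
Lemma tau_iy k : tau k = iy (k%:~R * tpi R).
Proof. by rewrite /tau /iy rmorphM rmorph_int /= /tpii; ring. Qed.

Lemma comb_diag (B : 'I_2 -> C -> C) (d : 'I_2 -> C) j u : comb B (diag_mx (\row_i d i)) j u = d j * B j u.
Proof.
rewrite /comb (bigD1 j) //= big1 ?addr0 ?mxE ?eqxx ?mulr1n //.
by move=> i ij; rewrite !mxE (negPf ij) mulr0n mul0r.
Qed.

Lemma cL_tau k j u : cL j (u + tau k) = comb cL (rho k) j u.
Proof.
rewrite comb_diag /cL /sel; case: ifP => _; rewrite /lefts expcD expc_tau mulr1.
  by rewrite !mul0r mul1r.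
by rewrite mulrDr expcD; ring.
Qed.
Lemma bR_tau k j u : bR j (u + tau k) = comb bR (Dm k) j u.
Proof.
have E : expc (- (u + tau k)) = expc (- u).
  by rewrite opprD expcD (expcN (tau k)) expc_tau invr1 mulr1.
by rewrite comb_diag /bR /sel; case: ifP => _; rewrite /rights E mulrDr expcD; ring.
Qed.

Lemma lsol_tau D k Y Y' : lsol hp hq D Y Y' ->
  lsol hp hq (fun u => D (u + tau k)) (fun u => Y (u + tau k)) (fun u => Y' (u + tau k)).
Proof.
move=> H u /H[y1 y2]; have S : hd (fun u => u + tau k) u 1.
  by apply: hd_eq (hdD (hd_id u) (hd_cst (tau k) u)) _; rewrite addr0.
split; first by apply: hd_eq (hd_comp S y1) _; rewrite mulr1.
apply: hd_eq (hd_comp S y2) _; rewrite mulr1 /hp /hq expcD expc_tau mulr1 //.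
Qed.

Lemma rho_unit k : rho k \in unitmx.
Proof.
rewrite unitmxE unitfE det_diag !big_ord_recl big_ord0 !mxE /sel /= mulr1 mul1r.
exact: expc_neq0.
Qed.
Lemma Dm_unit k : Dm k \in unitmx.
Proof.
by rewrite unitmxE unitfE det_diag !big_ord_recl big_ord0 !mxE /sel /= mulr1 mulf_neq0 ?expc_neq0.
Qed.

(** The equation has period 2 pi i, so the continuing basis may be shifted. The shift multiplies
    [cL] by [rho k], which has to be undone, and [bR] by [Dm k]. *)
Lemma Tr_tau t N k : Tr t N -> Tr (t - k%:~R * tpi R) (Dm k *m N *m invmx (rho k)).
Proof.
move=> [uN [r [r0 [Z [Z' [bZ lZ rZ]]]]]]; split.
  by rewrite !unitmx_mul uN Dm_unit unitmx_inv rho_unit.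
exists r; split=> //.
pose S := fun j u => Z j (u + tau k); pose S' := fun j u => Z' j (u + tau k).
have sub u : ballP (iy (t - k%:~R * tpi R)) r u -> ballP (iy t) r (u + tau k).
  by rewrite /ballP -iyB -tau_iy opprB addrA; congr (cN _ < _); ring.
have bS : lbasis hp hq (ballP (iy (t - k%:~R * tpi R)) r) S S'.
  split=> [j|u /sub]; last exact: bZ.2.
  exact: (lsolS (lsol_tau (k := k) (bZ.1 j)) sub).
have iu : invmx (rho k) \in unitmx by rewrite unitmx_inv rho_unit.
exists (comb S (invmx (rho k))), (comb S' (invmx (rho k))); split.
- exact: lbasis_comb.
- move=> j u bu lu.
  have -> : comb S (invmx (rho k)) j u = comb (comb cL (rho k)) (invmx (rho k)) j u.
    apply: eq_comb => i; rewrite /S lZ ?cL_tau //; first exact: sub.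
    by rewrite /leftP creD cre_tau addr0.
  by rewrite combM mulmxV ?comb1 // rho_unit.
- move=> j u bu ru; rewrite -!combM; apply: eq_comb => i.
  rewrite /S rZ; [|exact: sub|by rewrite /rightP creD cre_tau addr0].
  by rewrite -combM; apply: eq_comb => l; rewrite bR_tau.
Qed.
End Transition.

(** * Local monodromy *)

Lemma mulmx_conj (F : fieldType) (n : nat) (N X Y : 'M[F]_n) : N \in unitmx ->
  X *m N *m Y = N *m (invmx N *m X *m N) *m Y.
Proof. by move=> uN; rewrite !mulmxA mulmxV // mul1mx. Qed.

Lemma mulmx_conj_cancel (F : fieldType) (n : nat) (N X X' Y Y' : 'M[F]_n) : N \in unitmx ->
  Y' *m Y = 1%:M -> X *m X' = 1%:M ->
  X *m N *m Y' *m (Y *m (invmx N *m X' *m N)) = N.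
Proof.
move=> uN YY XX; rewrite !mulmxA -(mulmxA (X *m N)) YY mulmx1 mulmxK //.
by rewrite XX mul1mx.
Qed.

(** An eigenvalue 1 and determinant -1 force trace 0, and the Cayley-Hamilton theorem then gives the
    claim. *)
Lemma mx22_involution (F : fieldType) (A V : 'M[F]_2) :
  \det A = -1 -> V != 0 -> A *m V = V -> A *m A = 1%:M.
Proof.
move=> dA V0 VE.
have d1 : \det (A - 1%:M) = 0.
  apply/eqP; apply: contraT => nz.
  have u1 : A - 1%:M \in unitmx by rewrite unitmxE unitfE.
  have : (A - 1%:M) *m V = 0 by rewrite mulmxBl VE mul1mx subrr.
  move/(congr1 (mulmx (invmx (A - 1%:M)))); rewrite mulKmx // mulmx0 => V00.
  by rewrite V00 eqxx in V0.
move: dA d1; rewrite !det_mx2 !mxE /= !mulr1n !mulr0n !subr0 => dA d1.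
have tr0 : A 0 0 + A 1 1 = 0.
  have : A 0 0 * A 1 1 - A 0 1 * A 1 0 - ((A 0 0 - 1) * (A 1 1 - 1) - A 0 1 * A 1 0) + 1 = 0.
    by rewrite dA d1; ring.
  by move=> <-; ring.
have a11 : A 1 1 = - A 0 0 by apply/eqP; rewrite -addr_eq0 addrC tr0.
have E i j : (A *m A) i j = A i 0 * A 0 j + A i 1 * A 1 j.
  by rewrite mxE !big_ord_recl big_ord0 addr0; congr (_ + A _ _ * A _ _); exact/val_inj.
rewrite a11 in dA.
apply/matrixP => i j; rewrite E mxE.
have c (k : 'I_2) : k = 0 \/ k = 1.
  by case: k => [[|[|//]] h]; [left|right]; exact/val_inj.
have dA' : A 0 0 * A 0 0 + A 0 1 * A 1 0 = 1.
  by rewrite -[RHS]opprK -dA; ring.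
case: (c i) => ->; case: (c j) => ->; rewrite ?eqxx ?a11 /=.
- exact: dA'.
- by rewrite mulr0n; ring.
- by rewrite mulr0n; ring.
- by rewrite -dA'; ring.
Qed.

Section LocalMonodromy.
Variable R : realType.
Local Notation C := (Cx R).
Variables al be : C.
Local Notation gam := (gam al be).
Local Notation hp := (hp al be).
Local Notation hq := (hq al be).
Hypothesis g0 : forall n : nat, n%:R + gam != 0.
Hypothesis g1 : forall n : nat, n%:R + (2 - gam) != 0.
Hypothesis gn : 1 - gam != 0.
Hypothesis ab0 : forall n : nat, n%:R + (1 + al - be) != 0.
Hypothesis ab1 : forall n : nat, n%:R + (1 + be - al) != 0.
Hypothesis abn : al - be != 0.
Local Notation cL := (cL al be).
Local Notation bR := (bR al be).
Local Notation Tr := (Tr al be).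
Local Notation rho := (rho al be).
Local Notation Dm := (Dm al be).
Local Notation tpi := (tpi R).
Implicit Types (u v w z : C) (M N : 'M[C]_2).

Lemma Tr_first : exists N, forall t, 0 < t < tpi -> Tr t N.
Proof.
have p0 := tpi_gt0 R.
have nz t : 0 < t < tpi -> 1 - expc (iy t) != 0.
  by move=> /andP[h1 h2]; apply: (@iy_nz _ t 0); rewrite ?mul0r ?add0r ?mul1r.
have [|N NP] := Tr_exists g0 g1 gn ab0 ab1 abn (t := tpi / 2); first by apply: nz; lra.
exists N => t t01; have [tp|tp] := leP t (tpi / 2).
  apply/(Tr_const g0 g1 gn ab0 ab1 abn N tp) => // s s1; apply: nz; lra.
apply/(Tr_const g0 g1 gn ab0 ab1 abn N (ltW tp)) => // s s1; apply: nz; lra.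
Qed.

Variable N0 : 'M[C]_2.
Hypothesis N0P : forall t, 0 < t < tpi -> Tr t N0.

Lemma N0_unit : N0 \in unitmx.
Proof. by have [|] := N0P (t := tpi / 2); first by have := tpi_gt0 R; lra. Qed.

Definition Nk (k : int) := Dm (- k) *m N0 *m invmx (rho (- k)).

Lemma Tr_k k t : k%:~R * tpi < t -> t < (k%:~R + 1) * tpi -> Tr t (Nk k).
Proof.
move=> h1 h2; have h : 0 < t - k%:~R * tpi < tpi by lra.
by have := Tr_tau (- k) (N0P h); rewrite rmorphN /= mulNr opprK subrK.
Qed.

(** The function [phi] is single-valued around u = 0, so crossing the axis just above or just below
    0 leads to the same function on the right. Both columns of V are the coordinate vector of [phi],
    which lets [coord_mx] apply. *)
Lemma phi_transfer : exists V : 'M[C]_2, V != 0 /\ N0 *m V = Nk (-1) *m V.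
Proof.
have e0 : expc (0 : C) = 1 := expc0 R.
have F := hd_comp (hdB (hd_cst 1 0) (hd_expc 0)) (_ : hd (hgF al be 2^-1) (1 - expc 0) _).
have F0 : hd (hgF al be 2^-1) (1 - expc 0) (hgF1 al be 2^-1 (1 - expc 0)).
  by apply: hgF_hd; [exact: half_nat|rewrite e0 subrr cN0].
have {F} F := F _ F0; rewrite -[fun w => _]/(phi al be) in F.
have phi0 : phi al be 0 = 1 by rewrite /phi e0 subrr hgF0.
have [d1 d10 D1] := hd_cont F (ltr01 : (0 : R) < 1).
have [d2 d20 D2] := hd_cont (hd_expc 0) (ltr01 : (0 : R) < 1).
pose e := Num.min (Num.min d1 d2) (tpi / 2).
have p0 := tpi_gt0 R.
have ee0 : 0 < e by rewrite !lt_min d10 d20 divr_gt0.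
have ed1 : e <= d1 by rewrite !ge_min lexx.
have ed2 : e <= d2 by rewrite !ge_min lexx orbT.
have ep : e <= tpi / 2 by rewrite !ge_min lexx orbT.
have iy0 : iy (0 : R) = 0 by rewrite /iy rmorph0 mulr0.
have bphi u : ballP 0 e u -> phi al be u != 0.
  move=> h; have := D1 u; rewrite phi0 => /(_ (lt_le_trans h ed1)) H.
  by apply: contraTneq H => ->; rewrite sub0r cNN cN1 ltxx.
have bexp u : ballP 0 e u -> cN (1 - expc u) < 1.
  by move=> h; rewrite cNBC; have := D2 u; rewrite e0; apply; exact: lt_le_trans h ed2.
have cvL := convexI (@convex_ball R 0 e) (@convex_left R).
have cvR := convexI (@convex_ball R 0 e) (@convex_right R).
have cLb := cL_basis g0 g1 gn; have bRb := bR_basis ab0 ab1 abn.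
have cLB : lbasis hp hq (fun u => ballP 0 e u /\ leftP u) cL (cL' al be).
  by split=> [j|u [_ lu]]; [apply: lsolS (cLb.1 j) _ => u []|exact: cLb.2].
have bRB : lbasis hp hq (fun u => ballP 0 e u /\ rightP u) bR (bR' al be).
  by split=> [j|u [_ lu]]; [apply: lsolS (bRb.1 j) _ => u []|exact: bRb.2].
have phL (j : 'I_2) : lsol hp hq (fun u => ballP 0 e u /\ leftP u) (phi al be) (phi' al be).
  by apply: lsolS (phi_sol al be) _ => u [bu lu]; split; [exact: bexp|exact: left_neq].
have phR (j : 'I_2) : lsol hp hq (fun u => ballP 0 e u /\ rightP u) (phi al be) (phi' al be).
  by apply: lsolS (phi_sol al be) _ => u [bu lu]; split; [exact: bexp|exact: right_neq].
have [V VP] := coord_mx cvL cLB phL.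
have [W WP] := coord_mx cvR bRB phR.
have key t N : t != 0 -> `|t| < e -> 1 - expc (iy t) != 0 -> Tr t N -> W = N *m V.
  move=> t0 te nz [uN [r [r0 [Z [Z' [bZ lZ rZ]]]]]].
  have n0' : 0 < cN (1 - expc (iy t)) by rewrite cN_gt0.
  have [d d0 dP] := hd_cont (hd_expc (iy t)) n0'.
  pose x := Num.min (Num.min r d) (e - `|t|).
  have x0 : 0 < x by rewrite !lt_min r0 d0 subr_gt0.
  have xr : x <= r by rewrite !ge_min lexx.
  have xd : x <= d by rewrite !ge_min lexx orbT.
  have xe : x <= e - `|t| by rewrite !ge_min lexx orbT.
  have br u : ballP (iy t) x u -> ballP (iy t) r u by move/lt_le_trans; apply.
  have b0 u : ballP (iy t) x u -> ballP 0 e u.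
    rewrite /ballP => h; rewrite (le_lt_trans (cNDB u 0 (iy t))) // subr0 cN_iy.
    by have := lt_le_trans h xe; lra.
  have nzu u : ballP (iy t) x u -> 1 - expc u != 0.
    move=> h; have H := dP u (lt_le_trans h xd).
    by apply: contraTneq H => /eqP; rewrite subr_eq0 => /eqP <-; rewrite ltxx.
  have bZx : lbasis hp hq (ballP (iy t) x) Z Z'.
    by split=> [j|u /br]; [apply: lsolS (bZ.1 j) br|exact: bZ.2].
  have ph (j : 'I_2) : lsol hp hq (ballP (iy t) x) (phi al be) (phi' al be).
    by apply: lsolS (phi_sol al be) _ => u bu; split; [apply: bexp; exact: b0|exact: nzu].
  have [X XP] := coord_mx (@convex_ball R (iy t) x) bZx ph.
  have [[bl ll] [bri rr]] := (ball_left t x0, ball_right t x0).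
  have XV : X = V.
    apply: (comb_inj cLb ll) => j; near=> w.
    have bw : ballP (iy t) x w by near: w; exact: near_ball.
    have lw : leftP w by near: w; exact: near_left.
    rewrite -(VP j w (conj (b0 _ bw) lw)).1 (XP j w bw).1.
    by apply: eq_comb => i; rewrite lZ //; exact: br.
  apply: (comb_inj bRb rr) => j; near=> w.
  have bw : ballP (iy t) x w by near: w; exact: near_ball.
  have rw : rightP w by near: w; exact: near_right.
  rewrite -(WP j w (conj (b0 _ bw) rw)).1 (XP j w bw).1 -XV -combM.
  by apply: eq_comb => i; rewrite rZ //; exact: br.
exists V; split.
  have [bl ll] := ball_left 0 ee0; rewrite iy0 in bl ll.
  apply: contraTneq (bphi _ bl) => V0; rewrite negbK.
  by have [-> _] := VP 0 _ (conj bl ll); rewrite V0 combE !mxE !mul0r addr0.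
have h1 : 0 < e / 2 by lra.
have h2 : e / 2 < tpi by lra.
have k1 : W = N0 *m V.
  apply: (key (e / 2)); [by rewrite gt_eqF|by rewrite gtr0_norm; lra| |].
    by apply: (@iy_nz _ _ 0); rewrite ?mul0r ?add0r ?mul1r.
  by apply: N0P; rewrite h1.
rewrite -k1; apply: (key (- (e / 2))).
- by rewrite oppr_eq0 gt_eqF.
- by rewrite normrN gtr0_norm; lra.
- by apply: (@iy_nz _ _ (-1)); rewrite ?mulN1r ?addNr ?mul0r; lra.
- by apply: Tr_k; rewrite ?mulN1r ?addNr ?mul0r; lra.
Unshelve. all: by end_near. Qed.

(* A0 is the monodromy of cL around u = 0; up to scalars dinf has the finite   *)
(* order of Dm 1, the monodromy at z = infinity.                              *)
Definition dinf := invmx N0 *m invmx (Dm 1) *m N0.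
Definition A0 := rho 1 *m dinf.

Lemma tauN k : tau R (- k) = - tau R k.
Proof. by rewrite /tau mulrNz mulNr. Qed.
Lemma tauD k l : tau R (k + l) = tau R k + tau R l.
Proof. by rewrite /tau mulrzDr mulrDl. Qed.
Lemma tau1 : tau R 1 = tpii R.
Proof. by rewrite /tau mulr1z mul1r. Qed.

Lemma rho_opp k : rho (- k) *m rho k = 1%:M.
Proof.
rewrite mulmx_diag -[RHS]diag_const_mx; congr diag_mx; apply/rowP => j; rewrite !mxE /sel.
by case: ifP => _; rewrite ?mulr1 // -expcD tauN mulrN addNr expc0.
Qed.
Lemma Dm_opp k : Dm (- k) *m Dm k = 1%:M.
Proof.
rewrite mulmx_diag -[RHS]diag_const_mx; congr diag_mx; apply/rowP => j; rewrite !mxE /sel.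
by case: ifP => _; rewrite -expcD tauN mulrN addNr expc0.
Qed.
Lemma rho_inv k : invmx (rho k) = rho (- k).
Proof.
by rewrite -[RHS]mulmx1 -(mulmxV (rho_unit al be k)) mulmxA rho_opp mul1mx.
Qed.
Lemma Dm_inv k : invmx (Dm k) = Dm (- k).
Proof.
by rewrite -[RHS]mulmx1 -(mulmxV (Dm_unit al be k)) mulmxA Dm_opp mul1mx.
Qed.

Lemma NkE k : Nk k = N0 *m (invmx N0 *m Dm (- k) *m N0) *m rho k.
Proof. by rewrite /Nk rho_inv opprK; apply: mulmx_conj N0_unit. Qed.

Lemma Nk1_unit : Nk (-1) \in unitmx.
Proof. by rewrite /Nk !unitmx_mul Dm_unit N0_unit unitmx_inv rho_unit. Qed.

Lemma A0E : A0 = invmx (Nk (-1)) *m N0.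
Proof.
apply: (can_inj (mulKmx Nk1_unit)); rewrite mulKVmx ?Nk1_unit //.
rewrite /Nk opprK rho_inv /A0 /dinf Dm_inv.
apply: mulmx_conj_cancel; [exact: N0_unit|exact: rho_opp|].
by have := Dm_opp (-1); rewrite opprK.
Qed.

Lemma expc_half : expc (2^-1 * tpii R) = -1.
Proof.
have E : 2^-1 * tpii R = iy pi.
  rewrite /tpii /iy /GRing.natmul /tpi rmorphMn /= -mulr_natl.
  by field.
apply: cext; rewrite ?cre_expc ?cim_expc E cre_iy cim_iy expR0 mul1r ?cospi ?sinpi.
  by rewrite -(rmorphN1 (@emb R)) cre_emb.
by rewrite -(rmorphN1 (@emb R)) cim_emb.
Qed.

Lemma A0_fix : exists V : 'M[C]_2, V != 0 /\ A0 *m V = V.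
Proof.
have [V [V0 VE]] := phi_transfer; exists V; split=> //.
by rewrite A0E -mulmxA VE mulKmx ?Nk1_unit.
Qed.

(** The conjugation by [N0] cancels, which leaves the exponential of 2 pi i ((1 - gam) + al + be);
    the bracket is 1/2 by the definition of [gam]. *)
Lemma A0_det : \det A0 = -1.
Proof.
have n0 : \det N0 != 0 by rewrite -unitfE -unitmxE N0_unit.
rewrite /A0 /dinf !det_mulmx det_inv Dm_inv !det_diag !big_ord_recl !big_ord0 !mxE /sel /=.
rewrite -expc_half [LHS](_ : _ = expc ((1 - gam) * tau R 1) * (expc (- al * tau R (-1)) * expc (- be * tau R (-1)))).
  by rewrite -!expcD; congr expc; rewrite tauN tau1 /gam; field.
by field.
Qed.

Lemma A0_sq : A0 *m A0 = 1%:M.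
Proof. by have [V [V0 VE]] := A0_fix; exact: (mx22_involution A0_det V0 VE). Qed.

Lemma rhoD k l : rho (k + l) = rho k *m rho l.
Proof.
rewrite mulmx_diag; congr diag_mx; apply/rowP => j; rewrite !mxE /sel.
by case: ifP => _; rewrite ?mulr1 // -expcD tauD mulrDr.
Qed.
Lemma DmD k l : Dm (k + l) = Dm k *m Dm l.
Proof.
rewrite mulmx_diag; congr diag_mx; apply/rowP => j; rewrite !mxE /sel.
by case: ifP => _; rewrite -expcD tauD mulrDr.
Qed.
Lemma rho_scalar k : expc ((1 - gam) * tau R k) = 1 -> rho k = 1%:M.
Proof.
move=> H; rewrite /rho H -[RHS]diag_const_mx; congr diag_mx; apply/rowP => j.
by rewrite !mxE /sel; case: ifP.
Qed.
Lemma Dm_scalar k : expc ((be - al) * tau R k) = 1 -> Dm k = (expc (- be * tau R k))%:M.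
Proof.
move=> H; rewrite /Dm -diag_const_mx; congr diag_mx; apply/rowP => j.
rewrite !mxE /sel; case: ifP => // _; rewrite -[RHS]mulr1 -H -expcD; congr expc; ring.
Qed.
Lemma rho_nonscalar k (c : C) : rho k = c%:M -> expc ((1 - gam) * tau R k) = 1.
Proof.
move=> H; have := congr1 (fun M : 'M[C]_2 => M 0 0) H; have := congr1 (fun M : 'M[C]_2 => M 1 1) H.
by rewrite !mxE /sel /= !mulr1n => -> ->.
Qed.
Lemma Dm_nonscalar k (c : C) : Dm k = c%:M -> expc ((be - al) * tau R k) = 1.
Proof.
move=> H; have := congr1 (fun M : 'M[C]_2 => M 0 0) H; have := congr1 (fun M : 'M[C]_2 => M 1 1) H.
rewrite !mxE /sel /= !mulr1n => h1 h2.
have -> : (be - al) * tau R k = - (- be * tau R k) + - al * tau R k by ring.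
by rewrite expcD expcN h1 h2 mulVf // -h1 expc_neq0.
Qed.
End LocalMonodromy.

(** * Finite triangle groups *)

Section GeneratedSet.
Variable G : groupType.
Local Open Scope group_scope.

Definition subgrp (X : set G) : Prop :=
  [/\ X 1, (forall x y, X x -> X y -> X (x * y)) & (forall x, X x -> X x^-1)].

Definition gen2 (a b : G) : set G :=
  [set g | forall X, subgrp X -> X a -> X b -> X g].

Lemma gen2_subgrp a b : subgrp (gen2 a b).
Proof.
split=> [X [X1 _ _] _ _ //|x y xg yg X sX Xa Xb|x xg X sX Xa Xb].
- by have [_ XM _] := sX; apply: XM; [apply: xg|apply: yg].
- by have [_ _ XV] := sX; apply: XV; apply: xg.
Qed.

Lemma gen2_l a b : gen2 a b a. Proof. by []. Qed.
Lemma gen2_r a b : gen2 a b b. Proof. by []. Qed.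

End GeneratedSet.

(** * Multiplication tables deduced from relators *)

Section Words.
Variables (G : groupType) (gen : bool -> G).
Local Open Scope group_scope.

Definition evw (g : G) (w : seq bool) : G := foldl (fun g s => g * gen s) g w.

Lemma evwM g h w : evw (g * h) w = g * evw h w.
Proof. by elim: w h => //= s w IH h; rewrite -mulgA IH. Qed.

Lemma evwE g w : evw g w = g * evw 1 w.
Proof. by rewrite -{1}[g]mulg1 evwM. Qed.

Lemma evw_cat g v w : evw g (v ++ w) = evw (evw g v) w.
Proof. exact: foldl_cat. Qed.

Lemma evw_rcons g w s : evw g (rcons w s) = evw g w * gen s.
Proof. by rewrite -cats1 evw_cat. Qed.

(* [W] lists one word per element of a finite group given by the right        *)
(* multiplication table [t]; [closes] deduces, from relators that run through *)
(* known edges of the Cayley graph except for the last one, that the latter   *)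
(* also holds in [G].                                                         *)
Variables (N : nat) (W : seq (seq bool)) (t : bool -> seq nat).

Definition elt (i : nat) : G := evw 1 (nth [::] W i).

Definition edge (s : bool) (i : nat) : nat := nth 0%N (t s) i.

Definition walk (K : seq (bool * nat)) :=
  fix walk (i : nat) (w : seq bool) : option nat :=
  if w is s :: w' then
    if (s, i) \in K then walk (edge s i) w' else None
  else Some i.

Definition closes (K : seq (bool * nat)) (iw : nat * seq bool) :=
  let s := last true iw.2 in
  if walk K iw.1 (take (size iw.2).-1 iw.2) is Some j then
    if (edge s j == iw.1) && ((s, j) \notin K) then (s, j) :: K else K
  else K.

(** Edges along which a listed word grows by one letter hold in every group, by the definition of
    [elt]; they start the deduction. *)
Definition tree : seq (bool * nat) :=
  [seq si <- [seq (s, i) | s <- [:: true; false], i <- iota 0 N]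
   | nth [::] W (edge si.1 si.2) == rcons (nth [::] W si.2) si.1].

Definition deduce (rels : seq (seq bool)) (K : seq (bool * nat)) :=
  foldl closes K [seq (i, w) | i <- iota 0 N, w <- rels].

(** This many passes complete all three tables below. *)
Definition rounds := 3%N.

Definition complete (rels : seq (seq bool)) : bool :=
  let K := iter rounds (deduce rels) tree in
  all [pred s | all [pred i | (s, i) \in K] (iota 0 N)] [:: true; false].

Definition known (K : seq (bool * nat)) : Prop :=
  forall s i, (s, i) \in K -> elt i * gen s = elt (edge s i).

Lemma walkP K i w j : known K -> walk K i w = Some j -> evw (elt i) w = elt j.
Proof.
move=> kK; elim: w i => [|s w IH] i /=; first by move=> [->].
by case: ifP => // sK /IH <-; rewrite kK.
Qed.

Lemma tree_known : known tree.
Proof.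
move=> s i; rewrite mem_filter /= => /andP[/eqP E _].
by rewrite /elt E evw_rcons.
Qed.

Lemma closes_known K i w : known K -> w != [::] -> evw 1 w = 1 ->
  known (closes K (i, w)).
Proof.
case: (lastP w) => // {}w s kK _ w1; rewrite /closes /= last_rcons size_rcons /=.
rewrite -cats1 take_size_cat //; case E: (walk _ _ _) => [j|//].
case: ifP => // /andP[/eqP Ej _] s' i'; rewrite inE => /orP[/eqP[-> ->]|]; last exact: kK.
by rewrite Ej -(walkP kK E) -evw_rcons evwE w1 mulg1.
Qed.

Lemma deduce_known rels K :
  all (fun w => w != [::]) rels -> (forall w, w \in rels -> evw 1 w = 1) ->
  known K -> known (deduce rels K).
Proof.
move=> /allP r0 r1 kK; rewrite /deduce.
have : {subset [seq (i, w) | i <- iota 0 N, w <- rels] <=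
        [seq (i, w) | i <- iota 0 N, w <- rels]} by [].
elim: {1 3}[seq _ | _ <- _, _ <- _] K kK => //= -[i w] s IH K kK sub.
apply: IH => [|x xs]; last by apply: sub; rewrite inE xs orbT.
have /allpairsP[[i' w'] /= [_ wr [-> ->]]] := sub (i, w) (mem_head _ _).
by apply: closes_known => //; [exact: r0|exact: r1].
Qed.

Lemma completeP rels s i :
  all (fun w => w != [::]) rels -> (forall w, w \in rels -> evw 1 w = 1) ->
  complete rels -> (i < N)%N -> elt i * gen s = elt (edge s i).
Proof.
move=> r0 r1; rewrite /complete => /allP cK iN.
have kK : known (iter rounds (deduce rels) tree).
  by elim: rounds => [|k IH] /=; [exact: tree_known|exact: deduce_known].
have sB : s \in [:: true; false] by case: s.
by apply: kK; have /allP := cK s sB; apply; rewrite mem_iota.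
Qed.

End Words.

Definition mulw W t (i j : nat) : nat :=
  foldl (fun i s => edge t s i) i (nth [::] W j).

Definition inverses N W t : seq nat :=
  [seq find (fun j => mulw W t j i == 0%N) (iota 0 N) | i <- iota 0 N].

Definition conjs N W t (iv : seq nat) (i : nat) : seq nat :=
  undup [seq mulw W t (mulw W t (nth 0%N iv p) i) p | p <- iota 0 N].

(** The last condition is the normal-closure computation: each nontrivial i has two conjugates whose
    product is [s0]. Hence if any nontrivial element of the table becomes 1 in a group, so does
    [s0], and one inequality for [s0] makes the map injective. *)
Definition table_ok (N : nat) (W : seq (seq bool)) (t : bool -> seq nat) (iv : seq nat)
    (rels : seq (seq bool)) (s0 : nat) : bool :=
  [&& (0 < N)%N, nth [::] W 0 == [::],
    all (fun s => all (fun i => edge t s i < N)%N (iota 0 N)) [:: true; false],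
    all (fun w => w != [::]) rels, complete N W t rels,
    all (fun i => let v := nth 0%N iv i in (v < N)%N &&
      all (fun j => (mulw W t v j == 0%N) == (i == j)) (iota 0 N)) (iota 0 N)
  & all (fun i => (i == 0%N) ||
      let C := conjs N W t iv i in has (fun x => has (fun y => mulw W t x y == s0) C) C)
      (iota 0 N)].

Section Table.
Variables (N : nat) (W : seq (seq bool)) (t : bool -> seq nat) (iv : seq nat).
Variables (rels : seq (seq bool)) (s0 : nat).
Hypothesis ok : table_ok N W t iv rels s0.
Variables (G : groupType) (gen : bool -> G).
Hypothesis rels1 : forall w, w \in rels -> evw gen 1%g w = 1%g.
Local Open Scope group_scope.
Local Notation eltG := (elt gen W).
Local Notation mul := (mulw W t).
Local Notation inv := (nth 0%N iv).

Lemma elt0 : eltG 0 = 1.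
Proof. by rewrite /elt; have /and4P[_ /eqP ->] := ok. Qed.

Lemma edge_lt s i : (i < N)%N -> (edge t s i < N)%N.
Proof.
move=> iN; have sB : s \in [:: true; false] by case: s.
have /and4P[_ _ /allP/(_ s sB)/allP H _] := ok.
by apply: H; rewrite mem_iota.
Qed.

Lemma elt_edge s i : (i < N)%N -> eltG i * gen s = eltG (edge t s i).
Proof. by have /and5P[_ _ _ r0 /andP[c _]] := ok; exact: completeP r0 rels1 c. Qed.

Lemma mulw_lt i j : (i < N)%N -> (mul i j < N)%N.
Proof.
rewrite /mulw; elim: (nth _ _ _) i => //= s w IH i iN.
by apply: IH; exact: edge_lt.
Qed.

Lemma eltM i j : (i < N)%N -> eltG i * eltG j = eltG (mul i j).
Proof.
rewrite {2}/elt -evwE /mulw; elim: (nth _ _ _) i => //= s w IH i iN.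
by rewrite elt_edge // IH // edge_lt.
Qed.

Lemma invP i : (i < N)%N -> (inv i < N)%N /\
  forall j, (j < N)%N -> (mul (inv i) j == 0%N) = (i == j).
Proof.
move=> iN; have /and5P[_ _ _ _ /and3P[_ /allP/(_ i) H _]] := ok.
move: H; rewrite mem_iota iN => /(_ isT) /andP[lt /allP H]; split=> // j jN.
by apply: eqP; have := H j; rewrite mem_iota; apply.
Qed.

Lemma inv_lt i : (i < N)%N -> (inv i < N)%N.
Proof. by case/invP. Qed.

Lemma eltV i : (i < N)%N -> eltG (inv i) = (eltG i)^-1.
Proof.
move=> iN; have [lt /(_ i iN)] := invP iN; rewrite eqxx => /eqP E.
by apply: (mulIg (eltG i)); rewrite eltM // E elt0 mulVg.
Qed.

Lemma conjsP i x : (i < N)%N -> x \in conjs N W t iv i ->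
  (x < N)%N /\ exists p, (p < N)%N /\ eltG x = (eltG p)^-1 * eltG i * eltG p.
Proof.
move=> iN; rewrite mem_undup => /mapP[p]; rewrite mem_iota => /= pN ->.
have l1 := mulw_lt i (inv_lt pN); split; first exact: mulw_lt.
by exists p; split=> //; rewrite -!eltM ?inv_lt // eltV.
Qed.

Lemma elt_trivial i : (i < N)%N -> i != 0%N -> eltG i = 1 -> eltG s0 = 1.
Proof.
move=> iN i0 i1.
have /and5P[_ _ _ _ /and3P[_ _ /allP/(_ i)]] := ok.
rewrite mem_iota iN (negPf i0) => /(_ isT) /hasP[x xC /hasP[y yC /eqP <-]].
have [xN [p [pN xE]]] := conjsP iN xC; have [yN [q [qN yE]]] := conjsP iN yC.
by rewrite -eltM // xE yE i1 !mulg1 !mulVg mulg1.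
Qed.

Lemma elt_inj i j : eltG s0 != 1 -> (i < N)%N -> (j < N)%N -> eltG i = eltG j -> i = j.
Proof.
move=> s1 iN jN E.
have [_ /(_ j jN) H] := invP iN; apply/eqP; rewrite -H; apply: contraNT s1 => nz.
apply/eqP; apply: (elt_trivial _ nz); first by apply: mulw_lt; exact: inv_lt.
by rewrite -eltM ?inv_lt // eltV // E mulVg.
Qed.

Lemma elt_gen2 : [set eltG i | i in [set i | (i < N)%N]] = gen2 (gen true) (gen false).
Proof.
have N0 : (0 < N)%N by have /andP[] := ok.
apply/seteqP; split => [_ [i /= iN <-] X sX Xa Xb|g].
  have [X1 XM _] := sX; rewrite /elt.
  elim/last_ind: (nth _ _ _) => //= w s IH; rewrite evw_rcons.
  by apply: XM => //; case: (s).
apply; last 2 first.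
- by exists (edge t true 0); [exact: edge_lt|rewrite -elt_edge // elt0 mul1g].
- by exists (edge t false 0); [exact: edge_lt|rewrite -elt_edge // elt0 mul1g].
split; first by exists 0%N => //; exact: elt0.
- move=> _ _ [i iN <-] [j jN <-]; exists (mul i j); [exact: mulw_lt|].
  by rewrite eltM.
- by move=> _ [i iN <-]; exists (inv i); [exact: inv_lt|rewrite eltV].
Qed.

End Table.

(* Both the abstract group and the concrete one [H] satisfy the relators, so  *)
(* the table describes both.                                                  *)
Lemma table_isomorphic (N : nat) W t iv rels s0 (gT : finGroupType) (H : {group gT})
    (genH : bool -> gT) (G : groupType) (gen : bool -> G) :
  table_ok N W t iv rels s0 ->
  (forall w, w \in rels -> evw genH 1%g w = 1%g) ->
  (forall w, w \in rels -> evw gen 1%g w = 1%g) ->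
  elt genH W s0 != 1%g -> elt gen W s0 != 1%g ->
  (forall s, genH s \in H) -> #|H| = N ->
  isomorphic_to (gen2 (gen true) (gen false)) H.
Proof.
move=> ok rH rG nH nG sH cH.
have inH i : elt genH W i \in H.
  rewrite /elt; elim/last_ind: (nth _ _ _) => [|w s IH]; first exact: group1.
  by rewrite evw_rcons groupM.
pose fH (i : 'I_N) := elt genH W i.
have fH_inj : injective fH.
  by move=> i j E; apply: val_inj; exact: (elt_inj ok rH nH (ltn_ord i) (ltn_ord j) E).
have imH : [set fH i | i : 'I_N]%SET = H :> {set gT}.
  apply/eqP; rewrite eqEcard; apply/andP; split.
    by apply/fintype.subsetP => _ /imsetP[i _ ->]; exact: inH.
  by rewrite card_imset // cH card_ord.
have surj x : x \in H -> exists i : 'I_N, x = fH i.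
  by rewrite -imH => /imsetP[i _ ->]; exists i.
pose f (x : gT) : G := if [pick i : 'I_N | fH i == x] is Some i then elt gen W i else 1%g.
have fE (i : 'I_N) : f (fH i) = elt gen W i.
  rewrite /f; case: pickP => [j /eqP/fH_inj -> //|/(_ i)]; by rewrite eqxx.
exists f; split.
- move=> x y /surj[i ->] /surj[j ->].
  rewrite !fE (eltM ok rG) // {1 2}/fH (eltM ok rH) //.
  exact: (fE (Ordinal (mulw_lt ok j (ltn_ord i)))).
- move=> x y /surj[i ->] /surj[j ->]; rewrite !fE => E.
  by rewrite (val_inj (elt_inj ok rG nG (ltn_ord i) (ltn_ord j) E)).
- rewrite -(elt_gen2 ok rG); apply/seteqP; split.
    by move=> _ [x /surj[i ->] <-]; exists (val i) => //=; rewrite fE.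
  move=> _ [i /= iN <-]; exists (fH (Ordinal iN)); first exact: inH.
  exact: fE.
Qed.

(** * Enumeration of concrete permutation groups *)

Section PermCodes.
Variables (n : nat) (c : bool -> seq nat).
Hypothesis cok : all (fun s => perm_eq (c s) (iota 0 n.+1)) [:: true; false].

Lemma code_perm s : perm_eq (c s) (iota 0 n.+1).
Proof. by have /allP := cok; apply; case: s. Qed.

Definition code_fun s (i : 'I_n.+1) : 'I_n.+1 := inord (nth 0%N (c s) i).

Lemma code_funE s (i : 'I_n.+1) : code_fun s i = nth 0%N (c s) i :> nat.
Proof.
rewrite inordK //.
have : nth 0%N (c s) i \in c s.
  by rewrite mem_nth // (perm_size (code_perm s)) size_iota.
by rewrite (perm_mem (code_perm s)) mem_iota.
Qed.

Lemma code_fun_inj s : injective (code_fun s).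
Proof.
move=> i j /(congr1 val); rewrite /= !code_funE => /eqP.
rewrite nth_uniq ?(perm_size (code_perm s)) ?size_iota //.
  by move/eqP/val_inj.
by rewrite (perm_uniq (code_perm s)) iota_uniq.
Qed.

Definition code_gen s : {perm 'I_n.+1} := perm (@code_fun_inj s).

(** Words act here on plain numbers, so that checks reduce to computation; [code_evw] links this
    with the permutations. *)
Definition code_act (v : nat) (w : seq bool) : nat :=
  foldl (fun v s => nth 0%N (c s) v) v w.

Lemma code_evw (g : {perm 'I_n.+1}) w i :
  evw code_gen g w i = code_act (g i) w :> nat.
Proof.
elim: w g => //= s w IH g; rewrite IH permM permE; congr code_act.
exact: code_funE.
Qed.

Lemma code_rel w : all (fun v => code_act v w == v) (iota 0 n.+1) ->
  evw code_gen 1%g w = 1%g.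
Proof.
move=> /allP H; apply/permP => i; apply: val_inj; rewrite /= code_evw perm1.
by apply/eqP/H; rewrite mem_iota ltn_ord.
Qed.

Lemma code_nontrivial w : code_act 0 w != 0%N -> evw code_gen 1%g w != 1%g.
Proof.
move=> nz; apply: contra_neq nz => E.
by have := code_evw 1%g w ord0; rewrite E perm1 => <-.
Qed.

Definition word_code w := [seq code_act v w | v <- iota 0 n.+1].

(** One breadth-first round. A new word extends an older one by a letter, so that the list stays
    closed under prefixes, as [tree] requires. *)
Definition new_words (ws : seq (seq bool)) :=
  foldl (fun acc w => if word_code w \in map word_code acc then acc else rcons acc w)
    ws [seq rcons w s | w <- ws, s <- [:: true; false]].

Definition all_words := iter 12 new_words [:: [::]].

Definition word_edges (s : bool) :=
  let ws := all_words in
  [seq index (word_code (rcons w s)) (map word_code ws) | w <- ws].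

End PermCodes.

(** A relator only yields its last edge; (a b)^r ends in b, and its rotation (b a)^r is added
    because it ends in a. *)
Definition triangle_rels (m r : nat) : seq (seq bool) :=
  [:: [:: true; true]; nseq m false;
      flatten (nseq r [:: true; false]); flatten (nseq r [:: false; true])].

Lemma triangle_rels1 (G : groupType) (gen : bool -> G) m r w :
  (gen true * gen true = 1 -> gen false ^+ m = 1 ->
   (gen true * gen false) ^+ r = 1 ->
   w \in triangle_rels m r -> evw gen 1 w = 1)%g.
Proof.
move=> a2 bm abr; rewrite !inE.
have pw v k : evw gen 1%g (flatten (nseq k v)) = (evw gen 1%g v ^+ k)%g.
  by elim: k => [//|k IH] /=; rewrite evw_cat evwE IH expgS.
case/or4P => /eqP -> /=.
- by rewrite mul1g.
- have -> : nseq m false = flatten (nseq m [:: false]) by elim: (m) => //= k ->.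
  by rewrite pw /= mul1g.
- by rewrite pw /= mul1g.
- rewrite pw /= mul1g.
  have -> : (gen false * gen true = (gen true * gen false) ^ (gen true))%g.
    by rewrite conjgE mulgA mulKg.
  by rewrite -conjXg abr conj1g.
Qed.

(** Images of 0, 1, 2, ... under a and b: a transposition and a 3-cycle with product a 4-cycle, then
    a transposition and a 4-cycle with product a 3-cycle, then a double transposition and a 3-cycle
    with product a 5-cycle. *)
Definition codes34 (s : bool) := if s then [:: 1; 0; 2; 3]%N else [:: 0; 2; 3; 1]%N.
Definition codes43 (s : bool) := if s then [:: 1; 0; 2; 3]%N else [:: 1; 2; 3; 0]%N.
Definition codes35 (s : bool) := if s then [:: 1; 0; 3; 2; 4]%N else [:: 2; 1; 4; 3; 0]%N.
Definition words34 := Eval vm_compute in all_words 3 codes34.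
Definition words43 := Eval vm_compute in all_words 3 codes43.
Definition words35 := Eval vm_compute in all_words 4 codes35.
Definition edges34 (s : bool) := Eval vm_compute in if s then word_edges 3 codes34 true else word_edges 3 codes34 false.
Definition edges43 (s : bool) := Eval vm_compute in if s then word_edges 3 codes43 true else word_edges 3 codes43 false.
Definition edges35 (s : bool) := Eval vm_compute in if s then word_edges 4 codes35 true else word_edges 4 codes35 false.

Definition inverses34 := Eval vm_compute in inverses 24 words34 edges34.
Definition inverses43 := Eval vm_compute in inverses 24 words43 edges43.
Definition inverses35 := Eval vm_compute in inverses 60 words35 edges35.

(** Element 10 is (a b)^2, a member of the Klein four-group, which lies in every nontrivial normal
    subgroup of S_4. The test element is b^2 in the second table and b in the third, where A_5 is
    simple. *)
Lemma table34 : table_ok 24 words34 edges34 inverses34 (triangle_rels 3 4) 10.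
Proof. by vm_compute. Qed.

Lemma table43 : table_ok 24 words43 edges43 inverses43 (triangle_rels 4 3) 5.
Proof. by vm_compute. Qed.

Lemma table35 : table_ok 60 words35 edges35 inverses35 (triangle_rels 3 5) 2.
Proof. by vm_compute. Qed.

Lemma code_isomorphic n c N W t iv m r s0 (H : {group {perm 'I_n.+1}})
    (cok : all (fun s => perm_eq (c s) (iota 0 n.+1)) [:: true; false])
    (G : groupType) (a b : G) :
  table_ok N W t iv (triangle_rels m r) s0 ->
  all (fun w => all (fun v => code_act c v w == v) (iota 0 n.+1)) (triangle_rels m r) ->
  code_act c 0 (nth [::] W s0) != 0%N ->
  (forall s, code_gen cok s \in H) -> #|H| = N ->
  (a * a = 1 -> b ^+ m = 1 -> (a * b) ^+ r = 1 ->
   evw (fun s => if s then a else b) 1 (nth [::] W s0) != 1 ->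
   isomorphic_to (gen2 a b) H)%g.
Proof.
move=> tok /allP rel nt inH cH a2 bm abr ntG; pose gen s := if s then a else b.
apply: (@table_isomorphic _ _ _ _ _ _ _ _ (code_gen cok) G gen tok) => //.
- by move=> w /rel; exact: code_rel.
- by move=> w; exact: (triangle_rels1 (gen := gen)).
- exact: code_nontrivial.
Qed.

Lemma octahedral_gen2_34 (G : groupType) (a b : G) :
  (a * a = 1 -> b ^+ 3 = 1 -> (a * b) ^+ 4 = 1 -> (a * b) ^+ 2 != 1 ->
   octahedral (gen2 a b))%g.
Proof.
move=> a2 b3 ab4 nt.
have cok : all (fun s => perm_eq (codes34 s) (iota 0 4)) [:: true; false] by [].
apply: (code_isomorphic (cok := cok) table34 _ _ _ _ a2 b3 ab4) => //.
- by move=> s; rewrite inE.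
- by rewrite card_Sym card_ord.
- by move: nt; rewrite /= mul1g expgS expg1 mulgA.
Qed.

Lemma octahedral_gen2_43 (G : groupType) (a b : G) :
  (a * a = 1 -> b ^+ 4 = 1 -> (a * b) ^+ 3 = 1 -> b ^+ 2 != 1 ->
   octahedral (gen2 a b))%g.
Proof.
move=> a2 b4 ab3 nt.
have cok : all (fun s => perm_eq (codes43 s) (iota 0 4)) [:: true; false] by [].
apply: (code_isomorphic (cok := cok) table43 _ _ _ _ a2 b4 ab3) => //.
- by move=> s; rewrite inE.
- by rewrite card_Sym card_ord.
- by move: nt; rewrite /= mul1g expgS expg1.
Qed.

Lemma icosahedral_gen2_35 (G : groupType) (a b : G) :
  (a * a = 1 -> b ^+ 3 = 1 -> (a * b) ^+ 5 = 1 -> b != 1 ->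
   icosahedral (gen2 a b))%g.
Proof.
move=> a2 b3 ab5 nt.
have cok : all (fun s => perm_eq (codes35 s) (iota 0 5)) [:: true; false] by [].
have relP : all (fun w => all (fun v => code_act codes35 v w == v) (iota 0 5))
    (triangle_rels 3 5) by [].
apply: (code_isomorphic (cok := cok) table35 _ _ _ _ a2 b3 ab5) => //.
- have rel w (wr : w \in triangle_rels 3 5) := code_rel cok (allP relP w wr).
  (* An odd power equal to 1 forces even parity: b^3 = 1 settles b, and then (a b)^5 = 1 settles
     a. *)
  have ob : odd_perm (code_gen cok false) = false.
    have := congr1 (@odd_perm _) (rel (nseq 3 false) isT).
    by rewrite /= mul1g !odd_permM odd_perm1; case: odd_perm.
  have oa : odd_perm (code_gen cok true) = false.
    have := congr1 (@odd_perm _) (rel (flatten (nseq 5 [:: true; false])) isT).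
    by rewrite /= mul1g !odd_permM odd_perm1 ob; case: odd_perm.
  by move=> s; rewrite Alt_even; case: s; rewrite ?oa ?ob.
- by apply: double_inj; rewrite -mul2n card_Alt ?card_ord.
- by move: nt; rewrite /= mul1g.
Qed.

(** * Germs and paths *)

Section Germs.
Variable R : realType.
Local Notation C := (Cx R).
Implicit Types (Y B S : 'I_2 -> C -> C) (M N : 'M[C]_2).

Definition hol (f : C -> C) (z : C) := \forall w \near z, exists D, hd f w D.

Lemma holP f z : hol f z <-> holomorphic_near (f : C -> C) z.
Proof.
split=> /nearC[r r0 rP]; apply/nearC; exists r => // w /rP.
  by case=> D /hd_derivable.
by move/derivable_hd; exists (f^`()%classic w).
Qed.

Definition eqg (z : C) B B' := \forall w \near z, forall j : 'I_2, (B j w : C) = B' j w.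

Lemma near2 (z : C) (P Q T : C -> Prop) : (\forall w \near z, P w) ->
  (\forall w \near z, Q w) -> (forall w, P w -> Q w -> T w) -> \forall w \near z, T w.
Proof.
move=> /nearC[r r0 rP] /nearC[s s0 sQ] H; apply/nearC.
exists (Num.min r s); first by rewrite lt_min r0.
by move=> w; rewrite lt_min => /andP[/rP p /sQ q]; exact: H.
Qed.
Lemma near1 (z : C) (P T : C -> Prop) : (\forall w \near z, P w) ->
  (forall w, P w -> T w) -> \forall w \near z, T w.
Proof. by move=> h H; apply: (near2 h h) => w p _; exact: H. Qed.

Lemma eqg_eq z B B' : (forall j w, B j w = B' j w) -> eqg z B B'.
Proof. by move=> E; apply/nearC; exists 1 => // w _ j. Qed.
Lemma eqg_refl z B : eqg z B B. Proof. exact: eqg_eq. Qed.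
Lemma eqg_sym z B B' : eqg z B B' -> eqg z B' B.
Proof. by move=> /nearC[r r0 H]; apply/nearC; exists r => // w /H E j. Qed.
Lemma eqg_trans z B1 B2 B3 : eqg z B1 B2 -> eqg z B2 B3 -> eqg z B1 B3.
Proof. by move=> H1 H2; apply: (near2 H1 H2) => w E1 E2 j; rewrite E1. Qed.
Lemma eqg_comb z B B' M : eqg z B B' -> eqg z (comb B M) (comb B' M).
Proof. by move=> /nearC[r r0 H]; apply/nearC; exists r => // w /H E j; apply: eq_comb. Qed.
Lemma eqg_combM z B M N : eqg z (comb (comb B M) N) (comb B (M *m N)).
Proof. by apply: eqg_eq => j w; apply: combM. Qed.
Lemma eqg_comb1 z B : eqg z (comb B 1%:M) B.
Proof. by apply: eqg_eq => j w; apply: comb1. Qed.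
Lemma eqg_combK z B M N : M *m N = 1%:M -> eqg z (comb (comb B M) N) B.
Proof. by move=> E; apply: eqg_eq => j w; rewrite combM E comb1. Qed.
Lemma eqg_open z B B' : eqg z B B' -> \forall w \near z, eqg w B B'.
Proof. exact: near_join. Qed.

Lemma hol_open f z : hol f z -> \forall w \near z, hol f w.
Proof. exact: near_join. Qed.

Lemma hol_comb B M z j : (forall i, hol (B i) z) -> hol (comb B M j) z.
Proof.
move=> h; apply: (near2 (h 1) (h 0)) => w [d1 h1] [d0 h0].
exists (M 0 j * d0 + M 1 j * d1).
rewrite (_ : comb B M j = fun u => M 0 j * B 0 u + M 1 j * B 1 u).
  exact: hdD (hdZ _ h0) (hdZ _ h1).
by apply/funext => u; rewrite combE.
Qed.

End Germs.

(** * Continuation along paths *)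

Section Paths.
Variable R : realType.
Local Notation C := (Cx R).
Variable D : set C.
Implicit Types (Y B S : 'I_2 -> C -> C) (M N : 'M[C]_2) (g : R -> C) (t s d : R).

Definition cpath g := forall t (e : R), 0 < e ->
  exists2 d, 0 < d & forall s, `|s - t| < d -> cN (g s - g t) < e.

Lemma cpath_near g t (P : C -> Prop) : cpath g -> (\forall w \near g t, P w) ->
  exists2 d, 0 < d & forall s, `|s - t| < d -> P (g s).
Proof.
move=> cg /nearC[r r0 rP]; have [d d0 dP] := cg t r r0.
by exists d => // s /dP/rP.
Qed.

Lemma cpath_continuous g : cpath g -> {within `[0, 1], continuous (g : R -> C)}.
Proof.
move=> cg; apply: continuous_subspaceT => t A /nbhsC[e e0 eA].
have [d d0 dP] := cg t e e0; apply/nbhs_ballP; exists d => // s.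
by rewrite /ball /= distrC => /dP/eA.
Qed.

(* The path is indexed by the whole line, which makes reversal and             *)
(* concatenation continuous without case distinctions at the end points.       *)
Definition pcont g (F : R -> 'I_2 -> C -> C) :=
  [/\ cpath g, forall t, D (g t), forall t j, hol (F t j) (g t) &
    forall t, exists2 d, 0 < d & forall s, `|s - t| < d -> eqg (g s) (F s) (F t)].

Definition Conn P Y Q Y' := exists g F, [/\ pcont g F,
  forall t, t <= 0 -> g t = P, forall t, 1 <= t -> g t = Q, eqg P (F 0) Y & eqg Q (F 1) Y'].

Lemma Conn_eqg P Y Q Y' Z Z' : eqg P Y Z -> eqg Q Y' Z' -> Conn P Y Q Y' -> Conn P Z Q Z'.
Proof.
move=> YZ YZ' [g [F [pF g0 g1 FY FY']]]; exists g, F.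
split=> //; [exact: eqg_trans FY YZ|exact: eqg_trans FY' YZ'].
Qed.

Lemma Conn_comb P Y Q Y' M : Conn P Y Q Y' -> Conn P (comb Y M) Q (comb Y' M).
Proof.
move=> [g [F [[cg Dg hF lF] g0 g1 FY FY']]]; exists g, (fun t => comb (F t) M); split=> //.
- split=> //; first by move=> t j; exact: hol_comb.
  move=> t; have [d d0 dP] := lF t; exists d => // s /dP; exact: eqg_comb.
- exact: eqg_comb.
- exact: eqg_comb.
Qed.

Lemma Conn_sym P Y Q Y' : Conn P Y Q Y' -> Conn Q Y' P Y.
Proof.
move=> [g [F [[cg Dg hF lF] g0 g1 FY FY']]].
exists (fun t => g (1 - t)), (fun t => F (1 - t)).
have E s t : `|(1 - s) - (1 - t)| = `|s - t| by rewrite distrC; congr (`|_|); lra.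
split.
- split; last 1 first.
  + by move=> t; have [d d0 dP] := lF (1 - t); exists d => // s st; apply: dP; rewrite E.
  + move=> t e /(cg (1 - t))[d d0 dP].
    by exists d => // s st; apply: dP; rewrite E.
  + by move=> t; exact: (Dg (1 - t)).
  + by move=> t j; exact: (hF (1 - t) j).
- by move=> t t0; apply: g1; lra.
- by move=> t t0; apply: g0; lra.
- by rewrite subr0; exact: FY'.
- by rewrite subrr; exact: FY.
Qed.

Lemma Conn_trans P Y Q Y' T Y'' : Conn P Y Q Y' -> Conn Q Y' T Y'' -> Conn P Y T Y''.
Proof.
move=> [g [F [[cg Dg hF lF] g0 g1 FY FY']]] [k [G [[ck Dk hG lG] k0 k1 GY GY']]].
(* At every t at least one of the first two terms equals Q, so this is the concatenated path, and
   its continuity is that of a sum. *)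
pose p t := g (2 * t) + k (2 * t - 1) - Q.
pose H t := if t <= 2^-1 then F (2 * t) else G (2 * t - 1).
have pl t : t <= 2^-1 -> p t = g (2 * t).
  move=> th; rewrite /p; have -> : k (2 * t - 1) = Q by apply: k0; lra.
  by rewrite addrK.
have pr t : 2^-1 <= t -> p t = k (2 * t - 1).
  move=> th; rewrite /p; have -> : g (2 * t) = Q by apply: g1; lra.
  by rewrite addrAC subrr add0r.
have cp : cpath p.
  move=> t e e0; have e2 : 0 < e / 2 by rewrite divr_gt0.
  have [d1 d10 D1] := cg (2 * t) _ e2; have [d2 d20 D2] := ck (2 * t - 1) _ e2.
  exists (Num.min d1 d2 / 2); first by rewrite divr_gt0 // lt_min d10.
  move=> s; rewrite ltr_pdivlMr // lt_min => /andP[h1 h2].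
  have E : `|2 * s - 2 * t| = `|s - t| * 2 by rewrite -mulrBr normrM ger0_norm // mulrC.
  have := D1 (2 * s); rewrite E => /(_ h1) b1.
  have := D2 (2 * s - 1); rewrite (_ : 2 * s - 1 - _ = 2 * s - 2 * t); last by ring.
  rewrite E => /(_ h2) b2.
  rewrite /p (_ : _ - _ = (g (2 * s) - g (2 * t)) + (k (2 * s - 1) - k (2 * t - 1))); last by ring.
  by rewrite (le_lt_trans (cND _ _)) //; lra.
exists p, H; split.
- split=> // [t|t j|t].
  + by case: (leP t 2^-1) => th; [rewrite pl|rewrite pr // ltW].
  + by rewrite /H; case: leP => th; [rewrite pl|rewrite pr // ltW].
  + have Hl s : s <= 2^-1 -> H s = F (2 * s) by rewrite /H => ->.
    have Hr s : 2^-1 < s -> H s = G (2 * s - 1) by rewrite /H ltNge => /negPf ->.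
    have [th|th] := ltP t 2^-1; last first.
      have [d d0 dP] := lG (2 * t - 1); rewrite le_eqVlt in th.
      (* At the junction [F 1] and [G 0] both have the germ of Y' at Q, so they agree on a
         neighbourhood, which the path does not leave for s near t. *)
      have [t2|tn] := eqVneq t 2^-1.
        have [d' d'0 d'P] := lF (2 * t).
        have [d3 d30 d3P] : exists2 d, 0 < d & forall s, `|s - t| < d ->
            eqg (p s) (G (2 * t - 1)) (F (2 * t)).
          apply: (@cpath_near p t (fun w => eqg w (G (2 * t - 1)) (F (2 * t))) cp).
          have t1 : 2 * t = 1 by rewrite t2 divff.
          apply: eqg_open; rewrite pl ?t2 // -t2 t1 subrr g1 //.
          exact: (eqg_trans GY (eqg_sym FY')).
        exists (Num.min d3 (Num.min d d' / 2)).
          by rewrite lt_min d30 divr_gt0 // lt_min d0.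
        move=> s; rewrite lt_min ltr_pdivlMr // lt_min => /and3P[s3 s1 s2].
        have E : `|2 * s - 2 * t| = `|s - t| * 2 by rewrite -mulrBr normrM ger0_norm // mulrC.
        have -> : H t = F (2 * t) by apply: Hl; rewrite t2.
        have [sl|sr] := leP s 2^-1.
          by rewrite Hl // pl //; apply: d'P; rewrite E.
        rewrite Hr //; apply: (eqg_trans _ (d3P s s3)).
        rewrite pr ?ltW //; apply: dP.
        by rewrite (_ : 2 * s - 1 - _ = 2 * s - 2 * t) ?E //; ring.
      have t2 : 2^-1 < t by move: th; rewrite eq_sym (negPf tn).
      exists (Num.min (t - 2^-1) (d / 2)); first by rewrite lt_min subr_gt0 t2 divr_gt0.
      move=> s; rewrite lt_min ltr_pdivlMr // => /andP[s1 s2].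
      have E : `|2 * s - 2 * t| = `|s - t| * 2 by rewrite -mulrBr normrM ger0_norm // mulrC.
      have s3 : 2^-1 < s by move: s1; rewrite ltr_norml; lra.
      rewrite !Hr // pr ?ltW //; apply: dP.
      by rewrite (_ : 2 * s - 1 - _ = 2 * s - 2 * t) ?E //; ring.
    have [d d0 dP] := lF (2 * t).
    exists (Num.min (2^-1 - t) (d / 2)); first by rewrite lt_min subr_gt0 th divr_gt0.
    move=> s; rewrite lt_min ltr_pdivlMr // => /andP[s1 s2].
    have E : `|2 * s - 2 * t| = `|s - t| * 2 by rewrite -mulrBr normrM ger0_norm // mulrC.
    have s3 : s < 2^-1 by move: s1; rewrite ltr_norml; lra.
    rewrite !Hl ?ltW // pl ?ltW //; apply: dP; by rewrite E.
- by move=> t t0; rewrite pl ?g0 //; lra.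
- by move=> t t1; rewrite pr ?k1 //; lra.
- by rewrite /H ifT ?mulr0 //; lra.
- rewrite /H ifF ?mulr1; last by apply/negbTE; rewrite -ltNge; lra.
  by rewrite (_ : 2 - 1 = 1) //; ring.
Qed.

Lemma Conn_continues P Y Q Y' : Conn P Y Q Y' ->
  exists g : R -> C, [/\ {within `[0, 1], continuous g}, g 0 = P, g 1 = Q,
    forall t, D (g t) & forall j, continues_to g (Y j) (Y' j)].
Proof.
move=> [g [F [[cg Dg hF lF] g0 g1 FY FY']]]; exists g; split=> //.
- exact: cpath_continuous.
- exact: g0.
- exact: g1.
move=> j; exists (fun t => F t j); split; last 2 first.
- by rewrite g0 //; apply: filterS FY => w; apply.
- by rewrite g1 //; apply: filterS FY' => w; apply.
move=> t _; split; first exact/holP.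
have [d d0 dP] := lF t; apply/nbhs_ballP; exists d => // s.
rewrite /ball /= distrC => /dP H _; by apply: (near1 H) => w; apply.
Qed.

End Paths.

(** * Upper bound for the monodromy *)

Section Monodromy.
Variable R : realType.
Local Notation C := (Cx R).
Implicit Types (Y B S T : 'I_2 -> C -> C) (M N : 'M[C]_2) (g : R -> C) (t s d : R).

(** The radius depends on Y, S and p but not on M; this uniformity matters because M comes with the
    nearby point q. *)
Lemma eqg_ident Y S (p : C) : (forall j, hol (Y j) p) -> (forall j, hol (S j) p) ->
  exists2 d : R, 0 < d & forall q M, cN (q - p) < d -> eqg q Y (comb S M) -> eqg p Y (comb S M).
Proof.
move=> hY hS.
have I2 (j : 'I_2) : j = 0 \/ j = 1.
  by case: j => [[|[|//]] h]; [left|right]; exact/val_inj.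
have /nearC[r r0 rP] : \forall w \near p, forall j,
    (exists a, hd (Y j) w a) /\ (exists b, hd (S j) w b).
  have H j : \forall w \near p, (exists a, hd (Y j) w a) /\ (exists b, hd (S j) w b).
    exact: (near2 (hY j) (hS j)).
  by apply: (near2 (H 0) (H 1)) => w h0 h1 j; case: (I2 j) => ->.
exists (r / 40); first by rewrite divr_gt0.
move=> q M qp qYS; apply/nearC; exists (r / 40); first by rewrite divr_gt0.
move=> w wp j; apply/eqP; rewrite -subr_eq0; apply/eqP.
apply: (identity_theorem (h := fun z => Y j z - comb S M j z) (p := p) (q := q) (r := r)) => //.
  move=> z zr; have [[a ha] _] := rP z zr j.
  have [_ [b0 h0]] := rP z zr 0; have [_ [b1 h1]] := rP z zr 1.
  exists (a - (M 0 j * b0 + M 1 j * b1)).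
  rewrite (_ : comb S M j = fun u => M 0 j * S 0 u + M 1 j * S 1 u).
    exact: hdB ha (hdD (hdZ _ h0) (hdZ _ h1)).
  by apply/funext => u; rewrite combE.
by apply: (near1 qYS) => z ->; rewrite subrr.
Qed.

(* Abstract upper bound: [St x S] are distinguished bases of germs at x, any   *)
(* two of which, also at nearby points, differ by an element of K. A germ of   *)
(* the form S * k * h with k in K keeps this form along a continuation.        *)
Variable D : set C.
Variable K : 'M[C]_2 -> Prop.
Variable St : C -> ('I_2 -> C -> C) -> Prop.
Hypothesis K1 : K 1%:M.
Hypothesis KM : forall k k', K k -> K k' -> K (k *m k').
Hypothesis KV : forall k, K k -> K (invmx k).
Hypothesis KU : forall k, K k -> k \in unitmx.
Hypothesis St_exists : forall x, D x -> exists S, St x S.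
Hypothesis St_uniq : forall x S S', D x -> St x S -> St x S' -> exists2 k, K k & eqg x S' (comb S k).
Hypothesis St_open : forall x S, D x -> St x S ->
  \forall w \near x, exists2 k, K k & St w (comb S k).
Hypothesis St_hol : forall x S, D x -> St x S -> forall j, hol (S j) x.
Hypothesis St_free : forall x S M N, D x -> St x S -> eqg x (comb S M) (comb S N) -> M = N.

(** The coordinates of Y in a distinguished basis, up to left multiplication by K: changing that
    basis only changes k. *)
Definition std x Y (h : 'M[C]_2) := exists S k, [/\ St x S, K k & eqg x Y (comb S (k *m h))].

Lemma std_germ x Y Y' h : eqg x Y Y' -> std x Y h <-> std x Y' h.
Proof.
move=> E; split=> -[S [k [sS Kk YE]]]; exists S, k; split; [exact: sS|exact: Kk| |exact: sS|exact: Kk|].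
- exact: (eqg_trans (eqg_sym E) YE).
- exact: (eqg_trans E YE).
Qed.

Lemma std_open x Y h : D x -> (forall j, hol (Y j) x) ->
  \forall w \near x, D w -> (std w Y h <-> std x Y h).
Proof.
move=> Dx hY; have [S0 sS0] := St_exists Dx.
have [d d0 dP] := eqg_ident hY (St_hol Dx sS0).
have nd : \forall w \near x, cN (w - x) < d by apply/nearC; exists d.
(* The identity theorem carries the relation from w back to x; the other direction is a restriction
   of germs. *)
have back : \forall w \near x, D w -> std w Y h -> std x Y h.
  apply: (near2 nd (St_open Dx sS0)) => w wd [k Kk sw] Dw [S [k' [sS Kk' YE]]].
  have [k2 Kk2 SE] := St_uniq Dw sw sS.
  exists S0, (k *m k2 *m k'); split; [exact: sS0|exact: (KM (KM Kk Kk2) Kk')|].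
  apply: dP wd _; apply: (eqg_trans YE).
  apply: (eqg_trans (eqg_comb _ SE)); apply: (eqg_trans (eqg_combM _ _ _ _)).
  by apply: (eqg_trans (eqg_combM _ _ _ _)); rewrite !mulmxA; exact: eqg_refl.
have [sx|nx] := pselect (std x Y h); last first.
  apply: (near1 back) => w H Dw.
  by split=> [sw|sx]; [exact: (H Dw sw)|case: (nx sx)].
have [S [k' [sS Kk' YE]]] := sx.
apply: (near2 (eqg_open YE) (St_open Dx sS)) => w YEw [k Kk sw] Dw; split=> _; first exact: sx.
exists (comb S k), (invmx k *m k'); split; [exact: sw|exact: (KM (KV Kk) Kk')|].
apply: (eqg_trans YEw); apply: (eqg_trans _ (eqg_sym (eqg_combM _ _ _ _))).
by rewrite -mulmxA mulKVmx ?KU //; exact: eqg_refl.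
Qed.

Lemma monodromy_std P y S0 h M (g : R -> C) : D P -> St P S0 -> h \in unitmx ->
  eqg P y (comb S0 h) -> loop_in D P g ->
  (forall j, continues_to g (y j) (fun x => \sum_i M i j * y i x)) ->
  K (h *m M *m invmx h).
Proof.
move=> DP sS0 uh yE [cg g0 g1 gD] /choice[F FP].
pose G t j := F j t.
have Dg t : 0 <= t <= 1 -> D (g t) by move=> tt; apply: gD; rewrite in_itv.
have hG t j : 0 <= t <= 1 -> hol (G t j) (g t).
  by move=> tt; have [H _ _] := FP j; have [/holP] := H t (ltac:(by rewrite in_itv)).
have lG t : 0 <= t <= 1 -> exists2 d : R, 0 < d & forall s, `|s - t| < d -> 0 <= s <= 1 ->
    eqg (g s) (G s) (G t).
  move=> tt.
  have H j : exists2 d : R, 0 < d & forall s, `|s - t| < d -> 0 <= s <= 1 ->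
      \forall w \near g s, G s j w = G t j w.
    have [H _ _] := FP j; have [_] := H t (ltac:(by rewrite in_itv)).
    move=> /nbhs_ballP[d /= d0 dP]; exists d => // s st ss.
    by apply: dP; [rewrite /ball /= distrC|rewrite in_itv].
  have [d0 d00 d0P] := H 0; have [d1 d10 d1P] := H 1.
  exists (Num.min d0 d1); first by rewrite lt_min d00.
  move=> s; rewrite lt_min => /andP[s0 s1] ss.
  apply: (near2 (d0P s s0 ss) (d1P s s1 ss)) => w h0 h1 j.
  have [->//|j0] := eqVneq j 0.
  have -> // : j = 1 by apply/val_inj; case: j j0 => [[|[|]]].
have cg' t (e : R) : 0 <= t <= 1 -> 0 < e -> exists2 d, 0 < d &
    forall s, `|s - t| < d -> 0 <= s <= 1 -> cN (g s - g t) < e.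
  move=> tt e0; have tI : `[0, 1]%classic t by rewrite /= in_itv.
  have /subspace_continuousP/(_ t tI) cgt := cg.
  have : nbhs (g t) [set z | cN (z - g t) < e] by apply/nbhsC; exists e.
  move=> /cgt; rewrite /nbhs /= /within /= => /nbhs_ballP[d /= d0 dP].
  exists d => // s st ss; apply: dP; first by rewrite /ball /= distrC.
  by rewrite in_itv.
(* [loc_cst] is applied to a map with values in [Prop], so that equivalence along the path becomes
   equality. *)
have E : std (g 1) (G 1) h = std (g 0) (G 0) h.
  apply: (loc_cst (f := fun t => std (g t) (G t) h)); first exact: ler01.
  move=> t tt; have [d1 d10 D1] := lG t tt.
  have hGt j := hG t j tt.
  have /nearC[r r0 rP] := std_open h (Dg t tt) hGt.
  have [d2 d20 D2] := cg' t r tt r0.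
  exists (Num.min d1 d2); first by rewrite lt_min d10.
  move=> s; rewrite lt_min => /andP[s1 s2] ss.
  apply/propext; apply: (iff_trans (std_germ h (D1 s s1 ss))).
  by apply: rP; [exact: D2|exact: Dg].
have S1 : std P (comb y M) h.
  have : std (g 0) (G 0) h.
    exists S0, 1%:M; rewrite g0; split; [exact: sS0|exact: K1|].
    rewrite mul1mx; apply: (eqg_trans _ yE).
    have H j : \forall w \near P, G 0 j w = y j w by have [_ + _] := FP j; rewrite g0.
    apply: (near2 (H 0) (H 1)) => w h0 h1 j.
    have [->//|j0] := eqVneq j 0.
    have -> // : j = 1 by apply/val_inj; case: j j0 => [[|[|]]].
  rewrite -E g1 => /(std_germ h (Y' := comb y M)) => H; apply: H.
  have H j : \forall w \near P, G 1 j w = comb y M j w by have [_ _] := FP j; rewrite g1.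
  apply: (near2 (H 0) (H 1)) => w h0 h1 j.
  have [->//|j0] := eqVneq j 0.
  have -> // : j = 1 by apply/val_inj; case: j j0 => [[|[|]]].
have [S [k [sS Kk yME]]] := S1.
have [k2 Kk2 SE] := St_uniq DP sS0 sS.
have -> : h *m M *m invmx h = k2 *m k; last exact: KM.
have -> : h *m M = k2 *m k *m h; last by rewrite mulmxK.
apply: (St_free DP sS0).
apply: (eqg_trans (eqg_sym (eqg_combM _ _ _ _))); apply: (eqg_trans (eqg_comb _ (eqg_sym yE))).
apply: (eqg_trans yME); apply: (eqg_trans (eqg_comb _ SE)).
by apply: (eqg_trans (eqg_combM _ _ _ _)); rewrite mulmxA; exact: eqg_refl.
Qed.

End Monodromy.

(** * The covering of the x-plane *)

Section Exponential.
Variable R : realType.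
Local Notation C := (Cx R).
Implicit Types (Y B S Z : 'I_2 -> C -> C) (M N : 'M[C]_2) (u v w x : C).

(** The two sides differ by a multiple of 2 pi i, and for small w this difference has modulus below
    2 pi. *)
Lemma logc_expc : exists2 d : R, 0 < d & forall w : C, cN w < d ->
  cN (expc w - 1) < 1 /\ logc (expc w) = w.
Proof.
have t0 := tpi_gt0 R.
have [d1 d10 D1] := hd_cont (hd_expc (0 : C)) (@ltr01 R).
have l1 : cN ((1 : C) - 1) < 1 by rewrite subrr cN0.
have l3 : hd (@logc R) (expc 0) (expc 0)^-1 by apply: logc_hd; rewrite expc0.
have l2 := hd_comp (hd_expc (0 : C)) l3.
have t2 : 0 < tpi R / 2 by rewrite divr_gt0.
have [d2 d20 D2] := hd_cont l2 t2.
exists (Num.min d1 (Num.min d2 (tpi R / 2))); first by rewrite !lt_min d10 d20 t2.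
move=> w; rewrite !lt_min => /and3P[w1 w2 w3].
have e1 : cN (expc w - 1) < 1 by have := D1 w; rewrite subr0 expc0; apply.
split=> //; have [k kE] := expc_inj (logcK e1).
have := D2 w; rewrite subr0 expc0 logc1 subr0 => /(_ w2) b2.
have : cN (k%:~R * tpii R) < tpi R.
  have -> : k%:~R * tpii R = logc (expc w) - w by rewrite kE addrAC subrr add0r.
  by rewrite (le_lt_trans (cNB _ _)) //; lra.
have [kz|k0] := eqVneq k 0; first by rewrite kE kz mulr0z mul0r addr0.
have -> : cN (k%:~R * tpii R) = `|k%:~R| * tpi R.
  rewrite cNM -(rmorph_int (@emb R)) cN_emb; congr (_ * _).
  by rewrite /tpii cNM cN_ci mul1r cN_emb ger0_norm // ltW.
rewrite ltNge -[leLHS]mul1r ler_pM2r // -intr_norm ler1z.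
by rewrite -gtz0_ge1 normr_gt0 k0.
Qed.

Variables (mm : nat) (a : C).
Hypothesis mm0 : (0 < mm)%N.
Hypothesis a0 : a != 0.

(* The covering u |-> x, a local inverse sending Ex u to u, and the induced    *)
(* operations on pairs of functions.                                          *)
Definition Ex u : C := a * expc (u / mm%:R).
Definition Lg u x : C := u + mm%:R * logc (x / Ex u).
Definition pl Y : 'I_2 -> C -> C := fun j v => Y j (Ex v).
Definition push u Z : 'I_2 -> C -> C := fun j x => Z j (Lg u x).

Lemma ExE u : Ex u = a * expc (u / mm%:R). Proof. by []. Qed.
Lemma plE Y j v : pl Y j v = Y j (Ex v). Proof. by []. Qed.
Lemma pushE u Z j x : push u Z j x = Z j (Lg u x). Proof. by []. Qed.
Lemma mmC : mm%:R != 0 :> C. Proof. by rewrite pnatr_eq0 -lt0n. Qed.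
Lemma Ex_neq0 u : Ex u != 0. Proof. by rewrite mulf_neq0 // expc_neq0. Qed.

Lemma ExX u : Ex u ^+ mm = a ^+ mm * expc u.
Proof. by rewrite exprMn -expcMn [mm%:R * _]mulrC divfK ?mmC. Qed.

Lemma ExD u v : Ex (u + v) = Ex u * expc (v / mm%:R).
Proof. by rewrite /Ex mulrDl expcD mulrA. Qed.

Lemma Ex_hd u : hd Ex u (Ex u / mm%:R).
Proof.
have h : hd (fun v => v / mm%:R) u (mm%:R^-1).
  by apply: hd_eq (hdM (hd_id u) (hd_cst (mm%:R^-1) u)) _; ring.
by apply: hd_eq (hdZ a (hd_comp h (hd_expc _))) _; rewrite /Ex mulrA.
Qed.

Lemma Ex_tau u (k : int) : Ex (u + tau R (mm%:Z * k)) = Ex u.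
Proof.
rewrite ExD /tau intrM -[X in _ * expc X](_ : k%:~R * tpii R = _) ?expc_int ?mulr1 //.
by have h := mmC; rewrite -pmulrn; field.
Qed.

Lemma Ex_inj u v : Ex u = Ex v -> exists k : int, v = u + tau R (mm%:Z * k).
Proof.
move=> /(mulfI a0) /esym/expc_inj[k kE]; exists k.
rewrite /tau intrM -pmulrn -[v](divfK mmC) kE mulrDl divfK ?mmC //; ring.
Qed.

Lemma Ex_surj x : x != 0 -> exists u, Ex u = x /\ cre u = mm%:R * ln (cN (x / a)).
Proof.
move=> x0; have xa : x / a != 0 by rewrite mulf_neq0 // invr_eq0.
have [u [uE cu]] := polar xa; exists (mm%:R * u); split.
  by rewrite /Ex [mm%:R * u]mulrC mulfK ?mmC // uE mulrC divfK.
by rewrite -cu -(rmorph_nat (@emb R)) creM cre_emb cim_emb mul0r subr0.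
Qed.

Lemma Ex_div u v : Ex v / Ex u = expc ((v - u) / mm%:R).
Proof. by rewrite -{1}(subrK u v) [v - u + u]addrC ExD mulrAC divff ?Ex_neq0 ?mul1r. Qed.

Lemma Lg_Ex : exists2 d : R, 0 < d & forall u v, cN (v - u) < d -> Lg u (Ex v) = v.
Proof.
have [d d0 dP] := logc_expc; exists d => // u v vu.
have nn : (1 : R) <= mm%:R by rewrite ler1n.
have : cN ((v - u) / mm%:R) < d.
  rewrite cNM cNV cN_nat ltr_pdivrMr ?(lt_le_trans ltr01) //.
  by rewrite (lt_le_trans vu) // ler_peMr // ltW.
by move=> /dP[_ E]; rewrite /Lg Ex_div E mulrC divfK ?mmC // addrC subrK.
Qed.

Lemma Lg_near u : \forall x \near Ex u, Ex (Lg u x) = x /\ exists d, hd (Lg u) x d.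
Proof.
have n0 : 0 < cN (Ex u) by rewrite cN_gt0 Ex_neq0.
apply/nearC; exists (cN (Ex u)) => // x xu.
have x1 : cN (x / Ex u - 1) < 1.
  have -> : x / Ex u - 1 = (x - Ex u) / Ex u by rewrite mulrBl divff ?Ex_neq0.
  by rewrite cNM cNV ltr_pdivrMr // mul1r.
split.
  rewrite /Lg ExD [mm%:R * _]mulrC mulfK ?mmC // logcK //.
  by rewrite mulrC divfK ?Ex_neq0.
exists (mm%:R * ((x / Ex u)^-1 * (Ex u)^-1)).
have h : hd (fun x => x / Ex u) x (Ex u)^-1.
  by apply: hd_eq (hdM (hd_id x) (hd_cst (Ex u)^-1 x)) _; ring.
apply: hd_eq (hdD (hd_cst u x) (hdZ mm%:R (hd_comp h (logc_hd x1)))) _.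
by rewrite add0r.
Qed.

Lemma Lg_id u : Lg u (Ex u) = u.
Proof. by rewrite /Lg divff ?Ex_neq0 // logc1 mulr0 addr0. Qed.

Lemma near_Ex u (P : C -> Prop) : (\forall x \near Ex u, P x) -> \forall v \near u, P (Ex v).
Proof.
move=> /nearC[r r0 rP]; have [d d0 dP] := hd_cont (Ex_hd u) r0.
by apply/nearC; exists d => // v /dP/rP.
Qed.

Lemma near_Lg u (P : C -> Prop) : (\forall v \near u, P v) ->
  \forall x \near Ex u, Ex (Lg u x) = x /\ P (Lg u x).
Proof.
move=> /nearC[r r0 rP]; have nL := Lg_near u.
have [_ [d hL]] : Ex (Lg u (Ex u)) = Ex u /\ exists d, hd (Lg u) (Ex u) d.
  by move/nearC: nL => [e e0]; apply; rewrite subrr cN0.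
have [e e0 eP] := hd_cont hL r0; rewrite Lg_id in eP.
have ne : \forall x \near Ex u, cN (x - Ex u) < e by apply/nearC; exists e.
by apply: (near2 nL ne) => x [h _] /eP/rP.
Qed.

Lemma eqg_pl u Y Y' : eqg (Ex u) Y Y' <-> eqg u (pl Y) (pl Y').
Proof.
split; first exact: near_Ex.
by move=> /near_Lg H; apply: (near1 H) => x [E + j] => /(_ j); rewrite /pl E.
Qed.

Lemma hol_pl u f : hol f (Ex u) <-> hol (fun v => f (Ex v)) u.
Proof.
split=> [/near_Ex H|H].
  apply: (near1 H) => v [d hf].
  by exists (d * (Ex v / mm%:R)); exact: hd_comp (Ex_hd v) hf.
have nE : \forall x \near Ex u, \forall w \near x, Ex (Lg u w) = w.
  by apply: near_join; apply: (near1 (Lg_near u)) => x [].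
have nL : \forall x \near Ex u, exists d, hd (Lg u) x d by apply: (near1 (Lg_near u)) => x [].
have H1 := near2 nL (near_Lg H) (fun x p q => conj p q).
apply: (near2 nE H1) => x xE [[d hL] [_ [d' hf]]]; exists (d' * d).
apply: (hd_near (hd_comp hL hf)); by apply: (near1 xE) => w ->.
Qed.

Lemma pl_push u Z : eqg u (pl (push u Z)) Z.
Proof.
have [d d0 dP] := Lg_Ex.
by apply/nearC; exists d => // v /dP E j; rewrite /pl /push E.
Qed.

Lemma eqg_push u Z Z' : eqg u Z Z' -> eqg (Ex u) (push u Z) (push u Z').
Proof. by move=> H; apply/eqg_pl; apply: (eqg_trans (pl_push u Z)); apply: (eqg_trans H); apply/eqg_sym/pl_push. Qed.

Lemma hol_push u Z j : hol (Z j) u -> hol (push u Z j) (Ex u).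
Proof.
move=> H; apply/hol_pl; apply: (near2 (hol_open H) (eqg_open (pl_push u Z))) => v.
move=> /nearC[r r0 /(_ v)]; rewrite subrr cN0 => /(_ r0) [d hZ] E; exists d.
by apply: (hd_near hZ); apply: (near1 E) => w /(_ j) <-.
Qed.
End Exponential.

(** * Distinguished germs in the u-plane *)

Section StandardGerms.
Variable R : realType.
Local Notation C := (Cx R).
Variables al be : C.
Local Notation gam := (gam al be).
Local Notation hp := (hp al be).
Local Notation hq := (hq al be).
Hypothesis g0 : forall n : nat, n%:R + gam != 0.
Hypothesis g1 : forall n : nat, n%:R + (2 - gam) != 0.
Hypothesis gn : 1 - gam != 0.
Hypothesis ab0 : forall n : nat, n%:R + (1 + al - be) != 0.
Hypothesis ab1 : forall n : nat, n%:R + (1 + be - al) != 0.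
Hypothesis abn : al - be != 0.
Local Notation cL := (cL al be).
Local Notation bR := (bR al be).
Local Notation Tr := (Tr al be).
Local Notation rho := (rho al be).
Local Notation Dm := (Dm al be).
Local Notation tau := (tau R).
Local Notation tpi := (tpi R).
Variable N0 : 'M[C]_2.
Hypothesis N0P : forall t, 0 < t < tpi -> Tr t N0.
Local Notation Nk := (Nk al be N0).
Implicit Types (u v w z x : C) (M N : 'M[C]_2) (Y B S Z : 'I_2 -> C -> C).

Let uN0 := N0_unit N0P.
Let cLb := cL_basis g0 g1 gn.
Let bRb := bR_basis ab0 ab1 abn.

(* Distinguished germs in the u-plane: cL on Re u <= 0 (continued from the     *)
(* left if Re u = 0) and bR * N0 on Re u > 0.                                  *)
Definition Su u S := exists r B B', [/\ 0 < r, lbasis hp hq (ballP u r) B B',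
  forall j v, ballP u r v -> S j v = B j v,
  cre u <= 0 -> forall j v, ballP u r v -> leftP v -> B j v = cL j v &
  0 < cre u -> forall j v, ballP u r v -> B j v = comb bR N0 j v].

Lemma ballPS u v (r s : R) : ballP u s v -> s <= r -> ballP u r v.
Proof. exact: lt_le_trans. Qed.
Lemma ballP_id u (r : R) : 0 < r -> ballP u r u.
Proof. by rewrite /ballP subrr cN0. Qed.
Lemma ballP_half u v w (r : R) : ballP u (r / 2) v -> ballP v (r / 2) w -> ballP u r w.
Proof. by rewrite /ballP => h1 h2; rewrite (le_lt_trans (cNDB w u v)) //; lra. Qed.
Lemma near_ballP u (r : R) : 0 < r -> \forall w \near u, ballP u r w.
Proof. by move=> r0; apply/nearC; exists r. Qed.

Lemma lbasisS (D D' : C -> Prop) B B' : lbasis hp hq D B B' -> (forall v, D' v -> D v) -> lbasis hp hq D' B B'.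
Proof. by move=> [s w] DD; split=> [j|u /DD]; [apply: lsolS (s j) DD|exact: w]. Qed.

Lemma Su_germ u S S' : eqg u S S' -> Su u S -> Su u S'.
Proof.
move=> /nearC[s s0 sP] [r [B [B' [r0 bB SB lB rB]]]].
exists (Num.min r s), B, B'.
have sr v : ballP u (Num.min r s) v -> ballP u r v by move/ballPS; apply; rewrite ge_min lexx.
split.
- by rewrite lt_min r0.
- exact: lbasisS bB sr.
- move=> j v h; rewrite -sP ?SB //; first exact: sr.
  by apply: (ballPS h); rewrite ge_min lexx orbT.
- by move=> cu j v /sr; exact: lB.
- by move=> cu j v /sr; exact: rB.
Qed.

Lemma left_ball u (r : R) : 0 < r -> cre u <= 0 -> exists2 v, ballP u r v & leftP v.
Proof.
move=> r0 cu; exists (u - emb (r / 2)).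
  by rewrite /ballP addrAC subrr add0r cNN cN_emb ger0_norm ?divr_ge0 ?(ltW r0) //; lra.
by rewrite /leftP creB cre_emb; lra.
Qed.

Lemma Su_free u S M N : Su u S -> eqg u (comb S M) (comb S N) -> M = N.
Proof.
move=> [r [B [B' [r0 bB SB lB rB]]]] E.
apply: (comb_inj bB (ballP_id u r0)) => j.
apply: (near2 (near_ballP u r0) E) => v vb /(_ j).
by rewrite (eq_comb (B2 := B) M j (v := v) (fun i => SB i v vb)) (eq_comb (B2 := B) N j (v := v) (fun i => SB i v vb)).
Qed.

Lemma Su_hol u S j : Su u S -> hol (S j) u.
Proof.
move=> [r [B [B' [r0 [bB _] SB lB rB]]]].
apply: (near1 (near_ballP u r0)) => v vb; exists (B' j v).
apply: (hd_near (bB j v vb).1).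
by apply: (near1 (near_ball vb)) => w wb; rewrite SB.
Qed.

(** On the axis both bases agree with [cL] on the left half of a ball, which fixes the coordinates
    of one in the other. *)
Lemma Su_uniq u S S' : Su u S -> Su u S' -> eqg u S' S.
Proof.
move=> [r [B [B' [r0 bB SB lB rB]]]] [s [H [H' [s0 bH SH lH rH]]]].
pose x := Num.min r s; have x0 : 0 < x by rewrite lt_min r0.
have xr v : ballP u x v -> ballP u r v by move/ballPS; apply; rewrite ge_min lexx.
have xs v : ballP u x v -> ballP u s v by move/ballPS; apply; rewrite ge_min lexx orbT.
apply: (near1 (near_ballP u x0)) => v vb j.
rewrite SB ?SH; [|exact: xs|exact: xr].
have [cu|cu] := leP (cre u) 0; last by rewrite rB ?rH //; by [exact: xs|exact: xr].
have [M MP] := coord_mx (@convex_ball R u x) (lbasisS bB xr) (lbasisS bH xs).1.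
have [w wb wl] := left_ball x0 cu.
have -> : H j v = comb B M j v by case: (MP j v vb).
suff -> : M = 1%:M by rewrite comb1.
apply: (comb_inj (lbasisS bB xr) wb) => i.
apply: (near2 (near_ball wb) (near_left wl)) => q qb ql.
by rewrite comb1 -(MP i q qb).1 lH ?lB //; by [exact: xs|exact: xr].
Qed.

Lemma Su_left u : leftP u -> Su u cL.
Proof.
move=> ul; have /nearC[r r0 rP] := near_left ul.
exists r, cL, (cL' al be); split=> //; first exact: lbasisS cLb rP.
by rewrite ltNge => /negP[]; exact: ltW ul.
Qed.

Lemma Su_right u : rightP u -> Su u (comb bR N0).
Proof.
move=> ur; have /nearC[r r0 rP] := near_right ur.
exists r, (comb bR N0), (comb (bR' al be) N0); split=> //.
  by apply: lbasis_comb => //; exact: lbasisS bRb rP.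
by rewrite leNgt (ur : 0 < cre u).
Qed.

Lemma Su_axis t N : Tr t N -> exists Z, Su (iy t) Z /\ exists2 r, 0 < r &
  forall v, ballP (iy t) r v -> [/\ leftP v -> forall j, Z j v = cL j v,
    rightP v -> forall j, Z j v = comb bR N j v & forall j, exists d, hd (Z j) v d].
Proof.
move=> [uN [r [r0 [Z [Z' [bZ lZ rZ]]]]]]; exists Z; split.
  by exists r, Z, Z'; split=> //; rewrite cre_iy ltxx.
exists r => // v vb; split=> [vl j|vr j|j]; [exact: lZ|exact: rZ|].
by exists (Z' j v); exact: (bZ.1 j v vb).1.
Qed.

Lemma axis_interval u : cre u = 0 -> expc u != 1 -> exists t (k : int),
  [/\ u = iy t, k%:~R * tpi < t & t < (k%:~R + 1) * tpi].
Proof.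
move=> cu u1; have p0 := tpi_gt0 R; exists (cim u), (Num.floor (cim u / tpi)).
have uE : u = iy (cim u) by apply: cext; rewrite ?cre_iy ?cim_iy.
split=> //.
- rewrite -ltr_pdivlMr // lt_neqAle floor_le andbT.
  apply: contraNneq u1 => E; apply/eqP.
  rewrite uE (_ : cim u = (Num.floor (cim u / tpi))%:~R * tpi); last first.
    by rewrite E divfK // gt_eqF.
  by rewrite -tau_iy expc_tau.
- by rewrite -ltr_pdivrMr //; have := floorD1_gt (cim u / tpi); rewrite intrD.
Qed.

Lemma Su_exists u : expc u != 1 -> exists S, Su u S.
Proof.
move=> u1; have [ul|ur|cu] := ltgtP (cre u) 0.
- by exists cL; apply: Su_left.
- by exists (comb bR N0); apply: Su_right.
have [t [k [-> h1 h2]]] := axis_interval cu u1.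
by have [Z [SZ _]] := Su_axis (Tr_k N0P h1 h2); exists Z.
Qed.

Lemma Su_restrict u v S r B B' : lbasis hp hq (ballP u r) B B' ->
  (forall j v, ballP u r v -> S j v = B j v) -> (cre u <= 0 -> forall j v, ballP u r v -> leftP v -> B j v = cL j v) ->
  cre u <= 0 -> cre v <= 0 -> ballP u (r / 2) v -> Su v S.
Proof.
move=> bB SB lB cu cv uv.
have r0 : 0 < r / 2 by apply: le_lt_trans uv; exact: cN_ge0.
have sub w : ballP v (r / 2) w -> ballP u r w by exact: ballP_half.
exists (r / 2), B, B'; split=> //; first exact: lbasisS bB sub.
- by move=> j w /sub; exact: SB.
- by move=> _ j w /sub; exact: lB.
- by rewrite ltNge cv.
Qed.

Variable K : 'M[C]_2 -> Prop.
Hypothesis K1 : K 1%:M.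
Hypothesis KM : forall k k', K k -> K k' -> K (k *m k').
Hypothesis KV : forall k, K k -> K (invmx k).
Hypothesis KU : forall k, K k -> k \in unitmx.
Hypothesis Krho : forall k, K (rho k).
Hypothesis KDm : forall k, K (invmx N0 *m Dm k *m N0).

Lemma Su_open u S : expc u != 1 -> Su u S ->
  \forall w \near u, exists2 k, K k & Su w (comb S k).
Proof.
move=> u1 SS; have [ul|ur|cu] := ltgtP (cre u) 0.
- apply: (near2 (near_left ul) (eqg_open (Su_uniq (Su_left ul) SS))) => w wl E.
  exists 1%:M => //; apply: (Su_germ _ (Su_left wl)).
  by apply: (eqg_trans (eqg_sym E)); exact: eqg_sym (eqg_comb1 _ _).
- apply: (near2 (near_right ur) (eqg_open (Su_uniq (Su_right ur) SS))) => w wl E.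
  exists 1%:M => //; apply: (Su_germ _ (Su_right wl)).
  by apply: (eqg_trans (eqg_sym E)); exact: eqg_sym (eqg_comb1 _ _).
have [t [k [uE h1 h2]]] := axis_interval cu u1; have T := Tr_k N0P h1 h2.
have [Z [SZ [r r0 rP]]] := Su_axis T; rewrite -uE in SZ rP.
have SE := eqg_open (Su_uniq SZ SS).
have [s [B [B' [s0 bB SB lB rB]]]] := SS.
have s2 : 0 < s / 2 by rewrite divr_gt0.
have H := near2 (near_ballP u r0) (near_ballP u s2) (fun x p q => conj p q).
apply: (near2 SE H) => w wE [wr ws].
have [cw|cw] := leP (cre w) 0.
  exists 1%:M => //; apply: (Su_germ (eqg_sym (eqg_comb1 _ _))).
  by apply: (Su_restrict bB SB lB) => //; rewrite cu.
have uNk : Nk k \in unitmx by case: T.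
(* Right of the axis the distinguished basis is bR * [N0], but the continuation through the k-th
   interval is bR * [Nk k]. By [NkE] the two differ by an element of K. *)
have KN : K (invmx N0 *m Nk k).
  by rewrite (NkE N0P) !mulmxA mulVmx // mul1mx; apply: KM.
have KN' : K (invmx (Nk k) *m N0).
  have -> : invmx (Nk k) *m N0 = invmx (invmx N0 *m Nk k); last exact: KV.
  have uNN : invmx N0 *m Nk k \in unitmx by exact: KU.
  apply: (can_inj (mulKmx uNN)); rewrite mulmxV //.
  by rewrite -mulmxA mulKVmx // mulVmx.
exists (invmx (Nk k) *m N0) => //.
apply: (Su_germ _ (Su_right cw)); apply: eqg_sym.
apply: (eqg_trans (eqg_comb _ wE)).
apply: (near2 (near_ball wr) (near_right cw)) => v vb vr j.
rewrite (eq_comb (B2 := comb bR (Nk k)) _ j (v := v)).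
  by rewrite combM mulKVmx.
by move=> i; have [_ /(_ vr i)] := rP v vb.
Qed.

(** The shift acts on [cL] by [rho k] and on bR * N0 by the conjugate of [Dm k], so q depends on the
    side on which u lies. *)
Lemma Su_tau u S (k : int) : Su u S ->
  exists2 q, K q & Su (u + tau k) (fun j v => comb S q j (v - tau k)).
Proof.
move=> [r [B [B' [r0 bB SB lB rB]]]].
have tN : tau (- k) = - tau k by rewrite tauN.
have sh v : ballP (u + tau k) r v -> ballP u r (v - tau k).
  by rewrite /ballP opprD addrA addrAC.
have cr v : cre (v - tau k) = cre v by rewrite creB cre_tau subr0.
pose q := if cre u <= 0 then rho k else invmx N0 *m Dm k *m N0.
have Kq : K q by rewrite /q; case: ifP.
exists q => //; exists r, (fun j v => comb B q j (v - tau k)), (fun j v => comb B' q j (v - tau k)).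
have [bS bW] := lbasis_comb bB (KU Kq).
split=> //.
- split=> [j|v /sh/bW //].
  have := lsol_tau (k := - k) (bS j); rewrite tN => H; exact: (lsolS H sh).
- by move=> j v /sh vb; apply: eq_comb => i; exact: SB.
- rewrite creD cre_tau addr0 => cu j v /sh vb vl.
  rewrite /q cu (eq_comb (B2 := cL) _ j (v := v - tau k)).
    by rewrite -cL_tau subrK.
  by move=> i; apply: lB => //; rewrite /leftP cr.
- rewrite creD cre_tau addr0 => cu j v /sh vb.
  rewrite /q leNgt cu /= (eq_comb (B2 := comb bR N0) _ j (v := v - tau k)); last first.
    by move=> i; apply: rB.
  rewrite combM !mulmxA mulmxV // mul1mx -combM.
  by apply: eq_comb => i; rewrite -bR_tau subrK.
Qed.
End StandardGerms.

(** * Distinguished germs in the x-plane *)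

Section StandardElements.
Variable R : realType.
Local Notation C := (Cx R).
Variables al be : C.
Local Notation gam := (gam al be).
Local Notation hp := (hp al be).
Local Notation hq := (hq al be).
Hypothesis g0 : forall n : nat, n%:R + gam != 0.
Hypothesis g1 : forall n : nat, n%:R + (2 - gam) != 0.
Hypothesis gn : 1 - gam != 0.
Hypothesis ab0 : forall n : nat, n%:R + (1 + al - be) != 0.
Hypothesis ab1 : forall n : nat, n%:R + (1 + be - al) != 0.
Hypothesis abn : al - be != 0.
Local Notation cL := (cL al be).
Local Notation bR := (bR al be).
Local Notation Tr := (Tr al be).
Local Notation rho := (rho al be).
Local Notation Dm := (Dm al be).
Local Notation tau := (tau R).
Local Notation tpi := (tpi R).
Variable N0 : 'M[C]_2.
Hypothesis N0P : forall t, 0 < t < tpi -> Tr t N0.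
Local Notation Nk := (Nk al be N0).
Implicit Types (u v w z x : C) (M N : 'M[C]_2) (Y B S Z : 'I_2 -> C -> C).

Variable K : 'M[C]_2 -> Prop.
Hypothesis K1 : K 1%:M.
Hypothesis KM : forall k k', K k -> K k' -> K (k *m k').
Hypothesis KV : forall k, K k -> K (invmx k).
Hypothesis KU : forall k, K k -> k \in unitmx.
Hypothesis Krho : forall k, K (rho k).
Hypothesis KDm : forall k, K (invmx N0 *m Dm k *m N0).
(* [z0] states that x = 0 is an ordinary point.                               *)
Variables (mm : nat) (a : C) (z0 : Prop).
Hypothesis mm0 : (0 < mm)%N.
Hypothesis a0 : a != 0.
Hypothesis hz : z0 -> 1 - gam = mm%:R^-1.
Local Notation Ex := (Ex mm a).
Local Notation pl := (pl mm a).
Local Notation push := (push mm a).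
Local Notation Su := (Su al be N0).

Definition ordp : set C := [set x | x ^+ mm != a ^+ mm /\ (x = 0 -> z0)].

(* cL as a function of x near x = 0, an ordinary point when mm = 3.            *)
Definition C0w (j : 'I_2) w : C :=
  if j == 0 then hgF (0 + al) (0 + be) (2 * 0 + gam) (w ^+ mm)
  else w * hgF (1 - gam + al) (1 - gam + be) (2 * (1 - gam) + gam) (w ^+ mm).
Definition C0 (j : 'I_2) x := C0w j (x / a).

(** The second alternative is there because [Ex] never takes the value 0. *)
Definition St x S := (exists u, Ex u = x /\ Su u (pl S)) \/ [/\ x = 0, z0 & eqg 0 S C0].

Lemma ordp_Ex u : ordp (Ex u) <-> expc u != 1.
Proof.
rewrite /ordp /= ExX //; split=> [[h _]|h].
  by apply: contraNneq h => ->; rewrite mulr1.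
split; last by move/eqP; rewrite (negPf (Ex_neq0 mm a0 u)).
by apply: contraNneq h => E; apply/eqP/(mulfI (expf_neq0 mm a0)); rewrite mulr1.
Qed.

(** Since 1 - gam = 1 / mm, the factor e^((1 - gam) v) is x / a, so both solutions are holomorphic
    at x = 0. *)
Lemma C0_Ex v j : z0 -> C0 j (Ex v) = cL j v.
Proof.
move=> /hz E; have xa : Ex v / a = expc ((1 - gam) * v).
  by rewrite E ExE mulrAC divff // mul1r mulrC.
have xm : (Ex v / a) ^+ mm = expc v.
  by rewrite exprMn exprVn ExX // mulrAC divff ?mul1r // expf_neq0.
rewrite /C0 xa; rewrite xa in xm.
rewrite cLE /C0w xm; case: ifP => _; rewrite /lefts; last by [].
by rewrite mul0r expc0 mul1r.
Qed.

Lemma C0_hd x j : cN (x / a) < 1 -> exists d, hd (C0 j) x d.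
Proof.
move=> xa.
have h : hd (fun x => x / a) x a^-1.
  by apply: hd_eq (hdM (hd_id x) (hd_cst a^-1 x)) _; ring.
suff [d hw] : exists d, hd (C0w j) (x / a) d by exists (d * a^-1); exact: hd_comp h hw.
move: (x / a) xa => w wa.
have wm : cN (w ^+ mm) < 1 by rewrite cNX exprn_ilt1 ?cN_ge0 // -lt0n.
have hm := hdX mm (hd_id w).
rewrite /C0w; case: (j == 0).
  have hc : forall n : nat, n%:R + (2 * 0 + gam) != 0 by move=> n; rewrite mulr0 add0r.
  have := hd_comp hm (hgF_hd (0 + al) (0 + be) hc wm); by eexists; eassumption.
have hc : forall n : nat, n%:R + (2 * (1 - gam) + gam) != 0.
  by move=> n; rewrite (_ : 2 * (1 - gam) + gam = 2 - gam) //; ring.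
have := hdM (hd_id w) (hd_comp hm (hgF_hd (1 - gam + al) (1 - gam + be) hc wm)).
by eexists; eassumption.
Qed.

Lemma near_small (e : R) : 0 < e -> \forall x \near (0 : C), cN (x / a) < e.
Proof.
move=> e0; have an : 0 < cN a by rewrite cN_gt0.
apply/nearC; exists (e * cN a); first by rewrite mulr_gt0.
by move=> x; rewrite subr0 cNM cNV ltr_pdivrMr.
Qed.

Lemma Ex_small x : x != 0 -> cN (x / a) < 1 -> exists2 u, Ex u = x & leftP u.
Proof.
move=> x0 x1; have [u [uE cu]] := Ex_surj mm0 a0 x0; exists u => //.
have xn : 0 < cN (x / a) by rewrite cN_gt0 mulf_neq0 // invr_eq0.
by rewrite /leftP cu pmulr_rlt0 ?ltr0n // ln_lt0 // xn.
Qed.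

Lemma St_exists x : ordp x -> exists S, St x S.
Proof.
move=> Dx; have [x0|x0] := eqVneq x 0.
  by exists C0; right; split=> //; [apply: Dx.2|exact: eqg_refl].
have [u [uE _]] := Ex_surj mm0 a0 x0; rewrite -uE in Dx *.
have [S SS] := Su_exists g0 g1 gn ab0 ab1 abn N0P ((ordp_Ex u).1 Dx).
exists (push u S); left; exists u; split=> //.
exact: Su_germ (eqg_sym (pl_push mm0 a0 u S)) SS.
Qed.

Lemma Ex_Su u u' S : Ex u' = Ex u -> Su u (pl S) -> exists2 q, K q & Su u' (pl (comb S q)).
Proof.
move=> /esym/(Ex_inj mm0 a0)[k ->] /(Su_tau N0P KU Krho KDm (mm%:Z * k))[q Kq].
move=> SS; exists q => //; apply: Su_germ SS; apply: eqg_eq => j w.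
by apply: eq_comb => i; rewrite !plE -[in RHS](subrK (tau (mm%:Z * k)) w) Ex_tau.
Qed.

Lemma St_uniq x S S' : ordp x -> St x S -> St x S' -> exists2 k, K k & eqg x S' (comb S k).
Proof.
move=> _ [[u [<- SS]]|[x0 zz SE]] [[u' [uE SS']]|[x0' _ SE']].
- have [q Kq Sq] := Ex_Su uE SS; exists q => //.
  have E := Su_uniq Sq SS'.
  by rewrite -uE; apply/(eqg_pl mm0 a0).
- by have := Ex_neq0 mm a0 u; rewrite x0' eqxx.
- by have := Ex_neq0 mm a0 u'; rewrite uE x0 eqxx.
- exists 1%:M => //; rewrite x0; apply: (eqg_trans SE'); apply: (eqg_trans (eqg_sym SE)).
  exact: eqg_sym (eqg_comb1 _ _).
Qed.

Lemma St_open x S : ordp x -> St x S -> \forall w \near x, exists2 k, K k & St w (comb S k).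
Proof.
move=> Dx [[u [uE SS]]|[x0 zz SE]].
- rewrite -uE in Dx *.
  have H := Su_open g0 g1 gn ab0 ab1 abn N0P K1 KM KV KU Krho KDm ((ordp_Ex u).1 Dx) SS.
  apply: (near1 (near_Lg mm0 a0 H)) => w [wE [k Kk Sk]]; exists k => //.
  by left; exists (Lg mm a u w).
- rewrite x0; apply: (near2 (near_small ltr01) (eqg_open SE)) => w w1 E.
  exists 1%:M => //; have [w0|w0] := eqVneq w 0.
    right; split=> //; rewrite w0 in E; exact: eqg_trans (eqg_comb1 _ _) E.
  have [u uE ul] := Ex_small w0 w1; left; exists u; split=> //.
  apply: (Su_germ _ (Su_left g0 g1 gn N0 ul)); apply: eqg_sym.
  rewrite -uE in E; have {E} := (eqg_pl mm0 a0 u _ _).1 E => E.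
  apply: (eqg_trans (B2 := pl S)); first by apply: eqg_eq => j v; exact: comb1.
  by apply: (eqg_trans E); apply: eqg_eq => j v; exact: C0_Ex.
Qed.

Lemma St_hol x S : ordp x -> St x S -> forall j, hol (S j) x.
Proof.
move=> Dx [[u [<- SS]]|[-> zz SE]] j.
  by apply/(hol_pl mm0 a0); exact: Su_hol SS.
apply: (near2 (near_small ltr01) (eqg_open SE)) => w w1 E.
have [d hC] := C0_hd j w1; exists d; apply: (hd_near hC).
by apply: (near1 E) => v ->.
Qed.

Lemma small_exists (r : R) : 0 < r -> exists v, [/\ cN (Ex v) < r, leftP v & cN (Ex v / a) < 1].
Proof.
move=> r0; have an : 0 < cN a by rewrite cN_gt0.
pose e := Num.min (r / 2) (cN a / 2).
have e0 : 0 < e by rewrite lt_min !divr_gt0.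
have er : e < r by rewrite (@le_lt_trans _ _ (r / 2)) ?ge_min ?lexx //; lra.
have ea : e < cN a by rewrite (@le_lt_trans _ _ (cN a / 2)) ?ge_min ?lexx ?orbT //; lra.
have e1 : emb e != 0 by rewrite -cN_gt0 cN_emb ger0_norm ?(ltW e0).
have ex : cN (emb e / a) < 1.
  by rewrite cNM cNV cN_emb ger0_norm ?(ltW e0) // ltr_pdivrMr // mul1r.
have [v vE vl] := Ex_small e1 ex; exists v.
by rewrite vE cN_emb ger0_norm ?(ltW e0).
Qed.

Lemma St_free x S M N : ordp x -> St x S -> eqg x (comb S M) (comb S N) -> M = N.
Proof.
move=> Dx [[u [<- SS]]|[-> zz SE]] E.
  by apply: (Su_free SS); have := (eqg_pl mm0 a0 u _ _).1 E.
have {}E : eqg 0 (comb C0 M) (comb C0 N).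
  by apply: (eqg_trans (eqg_comb _ (eqg_sym SE))); apply: (eqg_trans E); exact: eqg_comb.
have /nearC[r r0 rP] := eqg_open E.
have [v [vr vl _]] := small_exists r0.
have : eqg (Ex v) (comb C0 M) (comb C0 N) by apply: rP; rewrite subr0.
move/(eqg_pl mm0 a0) => Ev; apply: (Su_free (Su_left g0 g1 gn N0 vl)).
have pc L : eqg v (comb cL L) (pl (comb C0 L)).
  by apply: eqg_eq => j w; apply: eq_comb => i; rewrite C0_Ex.
by apply: (eqg_trans (pc M)); apply: (eqg_trans Ev); exact: eqg_sym (pc N).
Qed.

Lemma monodromy_upper P y S0 h M (g : R -> C) : ordp P -> St P S0 -> h \in unitmx ->
  eqg P y (comb S0 h) -> loop_in ordp P g ->
  (forall j, continues_to g (y j) (fun x => \sum_i M i j * y i x)) ->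
  K (h *m M *m invmx h).
Proof.
exact: (monodromy_std K1 KM KV KU St_exists St_uniq St_open St_hol St_free).
Qed.
End StandardElements.

(** * Loops realizing the generators *)

Lemma mulmx_conj_step (F : fieldType) (n : nat) (N X X' W Y Z1 Z2 T : 'M[F]_n) : N \in unitmx ->
  Y *m (Z1 *m Z2) = 1%:M -> X *m X' = W ->
  X *m N *m Y *m (Z1 *m (Z2 *m (invmx N *m X' *m N)) *m T) = W *m N *m T.
Proof.
move=> uN YZ XX; rewrite !mulmxA -(mulmxA (X *m N) Y Z1) -(mulmxA (X *m N)) -(mulmxA Y) YZ mulmx1.
by rewrite mulmxK // XX.
Qed.

Section Loops.
Variable R : realType.
Local Notation C := (Cx R).
Variables al be : C.
Local Notation gam := (gam al be).
Local Notation hp := (hp al be).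
Local Notation hq := (hq al be).
Hypothesis g0 : forall n : nat, n%:R + gam != 0.
Hypothesis g1 : forall n : nat, n%:R + (2 - gam) != 0.
Hypothesis gn : 1 - gam != 0.
Hypothesis ab0 : forall n : nat, n%:R + (1 + al - be) != 0.
Hypothesis ab1 : forall n : nat, n%:R + (1 + be - al) != 0.
Hypothesis abn : al - be != 0.
Local Notation cL := (cL al be).
Local Notation bR := (bR al be).
Local Notation Tr := (Tr al be).
Local Notation rho := (rho al be).
Local Notation Dm := (Dm al be).
Local Notation tau := (tau R).
Local Notation tpi := (tpi R).
Variable N0 : 'M[C]_2.
Hypothesis N0P : forall t, 0 < t < tpi -> Tr t N0.
Local Notation Nk := (Nk al be N0).
Implicit Types (u v w z x : C) (M N : 'M[C]_2) (Y B S Z : 'I_2 -> C -> C).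

Variables (mm : nat) (a : C) (z0 : Prop).
Hypothesis mm0 : (0 < mm)%N.
Hypothesis a0 : a != 0.
Hypothesis hz : z0 -> 1 - gam = mm%:R^-1.
Local Notation Ex := (Ex mm a).
Local Notation pl := (pl mm a).
Local Notation push := (push mm a).
Local Notation Su := (Su al be N0).
Local Notation ordp := (ordp mm a z0).
Local Notation C0 := (C0 al be mm a).
Local Notation St := (St al be N0 mm a z0).
Local Notation Conn := (Conn ordp).

Lemma cpath_seg u v : cpath (fun t => u + emb (clamp 0 1 t) * v : C).
Proof.
move=> t e e0; have L0 : 0 < cN v + 1 by rewrite ltr_wpDl ?cN_ge0.
exists (e / (cN v + 1)); first by rewrite divr_gt0.
move=> s; rewrite ltr_pdivlMr // => H.
rewrite (_ : _ - _ = emb (clamp 0 1 s - clamp 0 1 t) * v); last by rewrite rmorphB /=; ring.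
rewrite cNM cN_emb (le_lt_trans _ H) // ler_pM ?cN_ge0 //; first exact: clamp_lip ler01.
by rewrite lerDl.
Qed.

Lemma cpath_Ex (g : R -> C) : cpath g -> cpath (fun t => Ex (g t)).
Proof.
move=> cg t e e0; have [d d0 dP] := hd_cont (Ex_hd mm a (g t)) e0.
by have [d' d'0 d'P] := cg t d d0; exists d' => // s /d'P/dP.
Qed.

(** Local inverses at neighbouring points have the same germ, so pushing a fixed pair of functions
    along a path gives locally constant function elements. *)
Lemma Lg_loc u : exists2 d : R, 0 < d & forall v, cN (v - u) < d ->
  \forall x \near Ex v, Lg mm a v x = Lg mm a u x.
Proof.
have [d d0 dP] := Lg_Ex mm0 a0; have d2 : 0 < d / 2 by rewrite divr_gt0.
exists (d / 2) => // v uv; have vb := near_ballP v d2.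
apply: (near1 (near_Lg mm0 a0 vb)) => x [E h].
by rewrite -[in RHS]E dP //; exact: (ballP_half uv h).
Qed.

Lemma Conn_seg (U : C -> Prop) Z u v : convexC U -> (forall w, U w -> expc w != 1) ->
  (forall j w, U w -> hol (Z j) w) -> U u -> U v -> Conn (Ex u) (push u Z) (Ex v) (push v Z).
Proof.
move=> cU nU hU Uu Uv; pose g t := u + emb (clamp 0 1 t) * (v - u).
have gU t : U (g t) by apply: cU => //; exact: clamp_itv ler01.
have cg : cpath g by exact: cpath_seg.
have gl t : t <= 0 -> g t = u by move=> t0; rewrite /g clamp_l // rmorph0 mul0r addr0.
have gr t : 1 <= t -> g t = v by move=> t0; rewrite /g clamp_r // rmorph1 mul1r addrC subrK.
exists (fun t => Ex (g t)), (fun t => push (g t) Z); split.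
- split.
  + exact: cpath_Ex.
  + by move=> t; apply/ordp_Ex => //; exact: nU.
  + by move=> t j; apply: hol_push => //; exact: hU.
  + move=> t; have [d d0 dP] := Lg_loc (g t); have [d' d'0 d'P] := cg t d d0.
    exists d' => // s /d'P/dP H; apply: (near1 H) => x E j.
    by rewrite !pushE E.
- by move=> t /gl ->.
- by move=> t /gr ->.
- by rewrite gl //; exact: eqg_refl.
- by rewrite gr //; exact: eqg_refl.
Qed.

Lemma Conn_zero : z0 -> exists2 v, leftP v & Conn 0 C0 (Ex v) (push v cL).
Proof.
move=> zz; have [v [_ vl v1]] := small_exists mm0 a0 (@ltr01 R); exists v => //.
pose g t := 0 + emb (clamp 0 1 t) * Ex v.
have gl t : t <= 0 -> g t = 0 by move=> t0; rewrite /g clamp_l // rmorph0 mul0r addr0.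
have gr t : 1 <= t -> g t = Ex v by move=> t0; rewrite /g clamp_r // rmorph1 mul1r add0r.
have g1' t : cN (g t / a) < 1.
  rewrite /g add0r -mulrA cNM cN_emb; have /andP[c0 c1] := clamp_itv t (@ler01 R).
  by rewrite ger0_norm // (le_lt_trans _ v1) // ler_piMl ?cN_ge0.
exists g, (fun _ => C0); split.
- split.
  + exact: cpath_seg.
  + move=> t; split=> //; apply: contraTneq (g1' t) => E; apply/negP => h.
    have : cN ((g t / a) ^+ mm) < 1 by rewrite cNX exprn_ilt1 ?cN_ge0 // -lt0n.
    by rewrite exprMn exprVn E divff ?expf_neq0 // cN1 ltxx.
  + move=> t j; have an : 0 < 1 - cN (g t / a) by rewrite subr_gt0.
    have na : 0 < cN a by rewrite cN_gt0.
    apply/nearC; exists ((1 - cN (g t / a)) * cN a); first by rewrite mulr_gt0.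
    move=> w h; apply: C0_hd => //.
    have -> : w / a = (w - g t) / a + g t / a by rewrite -mulrDl subrK.
    rewrite (le_lt_trans (cND _ _)) // -ltrBrDr cNM cNV ltr_pdivrMr //.
  + by move=> t; exists 1 => [|s _]; [exact: ltr01|apply: eqg_refl].
- exact: gl.
- exact: gr.
- exact: eqg_refl.
- apply/(eqg_pl mm0 a0); apply: (eqg_trans (B2 := cL)).
    by apply: eqg_eq => j w; exact: (C0_Ex mm0 a0 hz).
  exact: eqg_sym (pl_push mm0 a0 v cL).
Qed.

Lemma leftP_expc u : leftP u -> expc u != 1.
Proof. by move/left_neq; rewrite subr_eq0 eq_sym. Qed.
Lemma rightP_expc u : rightP u -> expc u != 1.
Proof. by move/right_neq; rewrite subr_eq0 eq_sym. Qed.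

Lemma cL_hol j u : leftP u -> hol (cL j) u.
Proof. by move=> ul; exact: (Su_hol j (Su_left g0 g1 gn N0 ul)). Qed.
Lemma bR_hol j u : rightP u -> hol (bR j) u.
Proof.
move=> ur; apply: (near1 (near_right ur)) => w wr.
by exists (bR' al be j w); exact: ((bR_basis ab0 ab1 abn).1 j w wr).1.
Qed.

Lemma Conn_left u v : leftP u -> leftP v -> Conn (Ex u) (push u cL) (Ex v) (push v cL).
Proof.
move=> ul vl; apply: (Conn_seg (U := @leftP R)) => //; first exact: convex_left.
- exact: leftP_expc.
- exact: cL_hol.
Qed.

Lemma Conn_axis t N : expc (iy t) != 1 -> Tr t N -> exists Z, Su (iy t) Z /\
  exists u w, [/\ leftP u, rightP w, Conn (Ex (iy t)) (push (iy t) Z) (Ex u) (push u cL) &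
    Conn (Ex (iy t)) (push (iy t) Z) (Ex w) (comb (push w bR) N)].
Proof.
move=> n1 T; have [Z [SZ [r r0 rP]]] := Su_axis N0 T; exists Z; split=> //.
have n1' : 0 < cN (expc (iy t) - 1) by rewrite cN_gt0 subr_eq0.
have [d d0 dP] := hd_cont (hd_expc (iy t)) n1'.
pose s := Num.min r d; have s0 : 0 < s by rewrite lt_min r0.
have sr v : ballP (iy t) s v -> ballP (iy t) r v by move/ballPS; apply; rewrite ge_min lexx.
have sn v : ballP (iy t) s v -> expc v != 1.
  move=> h; have hd' : ballP (iy t) d v by apply: (ballPS h); rewrite ge_min lexx orbT.
  have := dP v hd'.
  by apply: contraTneq => ->; rewrite cNBC ltxx.
have [[bl ll] [br rr]] := (ball_left t s0, ball_right t s0).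
have sh j v : ballP (iy t) s v -> hol (Z j) v.
  by move=> vb; apply: (near1 (near_ball vb)) => w /sr/rP[_ _]; apply.
exists (iy t - emb (s / 2)), (iy t + emb (s / 2)); split=> //.
- apply: (Conn_eqg (eqg_refl _ _) _ (Conn_seg (@convex_ball R (iy t) s) sn sh (ballP_id _ s0) bl)).
  apply: (eqg_push mm0 a0); apply: (near2 (near_ball bl) (near_left ll)) => v /sr/rP[h _ _] vl j.
  exact: h.
- apply: (Conn_eqg (eqg_refl _ _) _ (Conn_seg (@convex_ball R (iy t) s) sn sh (ballP_id _ s0) br)).
  apply: (eqg_trans (B2 := push _ (comb bR N))); last exact: eqg_refl.
  apply: (eqg_push mm0 a0); apply: (near2 (near_ball br) (near_right rr)) => v /sr/rP[_ h _] vl j.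
  exact: h.
Qed.

Lemma Conn_cross t N u w : expc (iy t) != 1 -> Tr t N -> leftP u -> rightP w ->
  Conn (Ex u) (push u cL) (Ex w) (comb (push w bR) N).
Proof.
move=> n1 T ul wr; have [Z [_ [v [x [vl xr c1 c2]]]]] := Conn_axis n1 T.
apply: (Conn_trans (Conn_left ul vl)); apply: (Conn_trans (Conn_sym c1)).
apply: (Conn_trans c2); apply: Conn_comb.
apply: (Conn_seg (U := @rightP R)) => //; first exact: convex_right.
- exact: rightP_expc.
- exact: bR_hol.
Qed.

Lemma iy_neq1 t (k : int) : k%:~R * tpi < t -> t < (k%:~R + 1) * tpi -> expc (iy t) != 1.
Proof. by move=> h1 h2; have := iy_nz h1 h2; rewrite subr_eq0 eq_sym. Qed.

Lemma Conn_base P S b : ordp P -> St P S -> leftP b -> Conn P S (Ex b) (push b cL).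
Proof.
move=> DP [[u [uP SS]]|[-> zz SE]] bl; last first.
  have [v vl c] := Conn_zero zz.
  apply: (Conn_trans _ (Conn_left vl bl)).
  exact: (Conn_eqg (eqg_sym SE) (eqg_refl _ _) c).
rewrite -uP in DP *; have p0 := tpi_gt0 R.
have pS Z : Su u Z -> eqg (Ex u) (push u Z) S.
  move=> SZ; apply/(eqg_pl mm0 a0); apply: (eqg_trans (pl_push mm0 a0 u Z)).
  exact: (Su_uniq SS SZ).
have [ul|ur|cu] := ltgtP (cre u) 0.
- apply: (Conn_eqg (pS _ (Su_left g0 g1 gn N0 ul)) (eqg_refl _ _)); exact: Conn_left.
- have T : 0 < tpi / 2 < tpi by lra.
  have n1 : expc (iy (tpi / 2)) != 1 by apply: (@iy_neq1 _ 0); rewrite ?mul0r ?add0r ?mul1r; lra.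
  apply: Conn_sym; apply: (Conn_eqg (eqg_refl _ _) _ (Conn_cross n1 (N0P T) bl ur)).
  exact: (pS _ (Su_right ab0 ab1 abn N0P ur)).
- have [t [k [uE h1 h2]]] := axis_interval cu ((ordp_Ex z0 mm0 a0 u).1 DP).
  have [Z [SZ [v [x [vl _ c _]]]]] := Conn_axis (iy_neq1 h1 h2) (Tr_k N0P h1 h2).
  rewrite -uE in SZ c.
  apply: (Conn_trans (Conn_eqg (pS _ SZ) (eqg_refl _ _) c)); exact: Conn_left.
Qed.

(** Crossing above 2 pi i k and returning below it is a loop around this point, the translate of the
    loop around u = 0 that defines [A0]. *)
Lemma Nk_step (k : int) : invmx (Nk (k - 1)) *m Nk k = rho (- k) *m A0 al be N0 *m rho k.
Proof.
have u1 j : Nk j \in unitmx.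
  by rewrite !unitmx_mul Dm_unit (N0_unit N0P) unitmx_inv rho_unit.
apply: (can_inj (mulKmx (u1 (k - 1)))); rewrite mulKVmx //.
rewrite /A0 /dinf Dm_inv /Nk !rho_inv !opprK.
apply: esym; apply: mulmx_conj_step; first exact: N0_unit N0P.
- rewrite -!rhoD (_ : k - 1 + (- k + 1) = - 0 + 0) ?rhoD ?rho_opp //; ring.
- by rewrite -DmD; congr Dm; ring.
Qed.

Section BasePoint.
Variables (P : C) (S : 'I_2 -> C -> C).
Hypothesis DP : ordp P.
Hypothesis SP : St P S.

Definition Mon g := Conn P S P (comb S g).

(** After the first loop the germ is S g; the second loop replaces S by S h, hence the reversed
    order. *)
Lemma Mon_mul g h : Mon g -> Mon h -> Mon (h *m g).
Proof.
move=> cg ch; apply: (Conn_trans cg).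
exact: (Conn_eqg (eqg_refl _ _) (eqg_combM _ _ _ _) (Conn_comb g ch)).
Qed.

Lemma Mon_inv g : g \in unitmx -> Mon g -> Mon (invmx g).
Proof.
move=> ug cg; apply: Conn_sym.
exact: (Conn_eqg (eqg_refl _ _) (eqg_combK _ _ (mulmxV ug)) (Conn_comb (invmx g) cg)).
Qed.

Lemma Mon_loop (k : int) : Mon (rho (- k) *m A0 al be N0 *m rho k).
Proof.
have p0 := tpi_gt0 R.
have b : leftP (-1 : C) by rewrite /leftP creN -(rmorph1 (@emb R)) cre_emb ltrN10.
have w : rightP (1 : C) by rewrite /rightP -(rmorph1 (@emb R)) cre_emb ltr01.
have T (j : int) : Conn (Ex (-1)) (push (-1) cL) (Ex 1) (comb (push 1 bR) (Nk j)).
  pose t := (j%:~R + 2^-1) * tpi.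
  have h1 : j%:~R * tpi < t by rewrite ltr_pM2r //; lra.
  have h2 : t < (j%:~R + 1) * tpi by rewrite ltr_pM2r //; lra.
  exact: (Conn_cross (iy_neq1 h1 h2) (Tr_k N0P h1 h2) b w).
have u1 : Nk (k - 1) \in unitmx.
  by rewrite !unitmx_mul Dm_unit (N0_unit N0P) unitmx_inv rho_unit.
set X := rho (- k) *m _ *m _.
have NX : Nk (k - 1) *m X = Nk k by rewrite /X -Nk_step mulKVmx.
have c1 := Conn_comb X (T (k - 1)).
have c2 : Conn (Ex (-1)) (push (-1) cL) (Ex (-1)) (comb (push (-1) cL) X).
  apply: (Conn_trans (T k)); apply: Conn_sym.
  apply: (Conn_eqg (eqg_refl _ _) _ c1); apply: (eqg_trans (eqg_combM _ _ _ _)).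
  by rewrite NX; exact: eqg_refl.
have cb := Conn_base DP SP b.
exact: (Conn_trans cb (Conn_trans c2 (Conn_sym (Conn_comb X cb)))).
Qed.

Lemma Mon_monodromy y h g : h \in unitmx -> eqg P y (comb S h) -> Mon g ->
  exists2 gm : R -> C, loop_in ordp P gm &
    forall j, continues_to gm (y j) (fun x => \sum_i (invmx h *m g *m h) i j * y i x).
Proof.
move=> uh yE cg.
have c : Conn P y P (comb y (invmx h *m g *m h)).
  apply: (Conn_eqg (eqg_sym yE) _ (Conn_comb h cg)).
  apply: (eqg_trans (eqg_combM _ _ _ _)); apply: eqg_sym.
  apply: (eqg_trans (eqg_comb _ yE)); apply: (eqg_trans (eqg_combM _ _ _ _)).
  by rewrite !mulmxA mulmxV // mul1mx; exact: eqg_refl.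
have [gm [cgm gm0 gm1 Dg H]] := Conn_continues c.
by exists gm => //; split.
Qed.
End BasePoint.

End Loops.

(** * Local solutions of the Lamé equation *)

Section Coordinates.
Variable R : realType.
Local Notation C := (Cx R).
Variables al be : C.
Local Notation gam := (gam al be).
Local Notation hp := (hp al be).
Local Notation hq := (hq al be).
Hypothesis g0 : forall n : nat, n%:R + gam != 0.
Hypothesis g1 : forall n : nat, n%:R + (2 - gam) != 0.
Hypothesis gn : 1 - gam != 0.
Hypothesis ab0 : forall n : nat, n%:R + (1 + al - be) != 0.
Hypothesis ab1 : forall n : nat, n%:R + (1 + be - al) != 0.
Hypothesis abn : al - be != 0.
Local Notation cL := (cL al be).
Local Notation bR := (bR al be).
Local Notation Tr := (Tr al be).
Local Notation rho := (rho al be).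
Local Notation Dm := (Dm al be).
Local Notation tau := (tau R).
Local Notation tpi := (tpi R).
Variable N0 : 'M[C]_2.
Hypothesis N0P : forall t, 0 < t < tpi -> Tr t N0.
Local Notation Nk := (Nk al be N0).
Implicit Types (u v w z x : C) (M N : 'M[C]_2) (Y B S Z : 'I_2 -> C -> C).

Variables (mm : nat) (a : C) (z0 : Prop).
Hypothesis mm0 : (0 < mm)%N.
Hypothesis a0 : a != 0.
Hypothesis hz : z0 -> 1 - gam = mm%:R^-1.
Local Notation Ex := (Ex mm a).
Local Notation pl := (pl mm a).
Local Notation push := (push mm a).
Local Notation Su := (Su al be N0).
Local Notation ordp := (ordp mm a z0).
Local Notation C0 := (C0 al be mm a).
Local Notation St := (St al be N0 mm a z0).

Lemma eq_limit (f g : C -> C) x d d' (r : R) : hd f x d -> hd g x d' -> 0 < r ->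
  (forall w, w != x -> cN (w - x) < r -> f w = g w) -> f x = g x.
Proof.
move=> hf hg r0 E; apply/eqP; rewrite -subr_eq0; apply: contraT => nz.
have e0 : 0 < cN (f x - g x) / 2 by rewrite divr_gt0 // cN_gt0.
have [d1 d10 D1] := hd_cont hf e0; have [d2 d20 D2] := hd_cont hg e0.
pose s := Num.min r (Num.min d1 d2) / 2.
have m0 : 0 < Num.min r (Num.min d1 d2) by rewrite !lt_min r0 d10.
have s0 : 0 < s by rewrite divr_gt0.
have sm : s < Num.min r (Num.min d1 d2) by rewrite /s; lra.
move: sm; rewrite !lt_min => /and3P[sr sd1 sd2].
have ws : cN (x + emb s - x) = s by rewrite addrAC subrr add0r cN_emb ger0_norm // ltW.
have b1 := D1 (x + emb s); rewrite ws in b1; have {}b1 := b1 sd1.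
have b2 := D2 (x + emb s); rewrite ws in b2; have {}b2 := b2 sd2.
have Ew : f (x + emb s) = g (x + emb s).
  by apply: E; rewrite ?ws //; rewrite -subr_eq0 -cN_eq0 ws gt_eqF.
have := cNDB (f x) (g x) (f (x + emb s)); rewrite [in cN (f (x + emb s) - g x)]Ew.
by rewrite cNBC in b1; lra.
Qed.

Lemma convex_halfplane (c : R) : convexC (fun u => leftP u /\ cre u < c).
Proof.
apply: convexI; first exact: convex_left.
move=> u v hu hv t t01.
rewrite creD creM cre_emb cim_emb mul0r subr0 creB.
have [t0|t1] := eqVneq t 0; first by rewrite t0 mul0r addr0.
have tp : 0 < t by rewrite lt_neqAle eq_sym t1; case/andP: t01.
have h1 : t * cre v < t * c by rewrite ltr_pM2l.
have h2 : (1 - t) * cre u <= (1 - t) * c by rewrite ler_wpM2l ?(ltW hu) // subr_ge0; case/andP: t01.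
lra.
Qed.

(* At P = 0 coordinates are computed on a half-plane Re u < c, which covers a  *)
(* punctured disc.                                                            *)
Lemma St_coord P S y (Y' : 'I_2 -> C -> C) (r : R) : ordp P -> St P S -> 0 < r ->
  (forall j, lsol hp hq (fun u => cN (Ex u - P) < r) (pl y j) (Y' j)) ->
  (forall j, hol (y j) P) -> exists h, eqg P y (comb S h).
Proof.
move=> DP [[u [uP SS]]|[P0 zz SE]] r0 sy hy.
  rewrite -uP in sy *; have [s [B [B' [s0 bB SB _ _]]]] := SS.
  have [d d0 dP] := hd_cont (Ex_hd mm a u) r0.
  pose x := Num.min s d; have x0 : 0 < x by rewrite lt_min s0.
  have xs v : ballP u x v -> ballP u s v by move/ballPS; apply; rewrite ge_min lexx.
  have xd v : ballP u x v -> cN (Ex v - Ex u) < r.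
    by move=> h; apply: dP; apply: (ballPS h); rewrite ge_min lexx orbT.
  have [h hP] := coord_mx (@convex_ball R u x) (lbasisS bB xs) (fun j => lsolS (sy j) xd).
  exists h; apply/(eqg_pl mm0 a0); apply: (near1 (near_ballP u x0)) => v vb j.
  rewrite (hP j v vb).1; apply: eq_comb => i; rewrite -SB //; exact: xs.
rewrite P0 in sy hy *.
have an : 0 < cN a by rewrite cN_gt0.
(* Since |Ex u| = |a| e^(Re u / mm), the condition Re u < c means |Ex u| < r. *)
pose c := mm%:R * ln (r / cN a).
have mp : 0 < mm%:R :> R by rewrite ltr0n.
have sm u : leftP u /\ cre u < c -> cN (Ex u - 0) < r.
  move=> [_ uc]; rewrite subr0 ExE cNM cN_expc mulrC -ltr_pdivlMr //.
  rewrite -[ltRHS]lnK ?posrE ?divr_gt0 // ltr_expR -(rmorph_nat (@emb R)) -rmorphV ?unitfE ?gt_eqF //=.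
  by rewrite creM cre_emb cim_emb mulr0 subr0 ltr_pdivrMr // mulrC.
have hl u : leftP u /\ cre u < c -> leftP u by case.
have [h hP] := coord_mx (@convex_halfplane c) (lbasisS (cL_basis g0 g1 gn) hl)
  (fun j => lsolS (sy j) sm).
exists h; apply: (eqg_trans _ (eqg_sym (eqg_comb _ SE))).
have E x j : x != 0 -> cN (x / a) < Num.min 1 (r / cN a) -> y j x = comb C0 h j x.
  move=> x0; rewrite lt_min => /andP[x1 x2]; have [u [uE cu]] := Ex_surj mm0 a0 x0.
  have xn : 0 < cN (x / a) by rewrite cN_gt0 mulf_neq0 // invr_eq0.
  have ul : leftP u by rewrite /leftP cu pmulr_rlt0 // ln_lt0 // xn.
  have uc : cre u < c by rewrite cu ltr_pM2l // ltr_ln // posrE divr_gt0.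
  have [+ _] := hP j u (conj ul uc); rewrite plE uE => ->.
  by apply: eq_comb => i; rewrite -(C0_Ex mm0 a0 hz _ _ zz) uE.
have m0 : 0 < Num.min 1 (r / cN a) by rewrite lt_min ltr01 divr_gt0.
apply: (near1 (near_small a0 m0)) => x xs j; have [->|x0] := eqVneq x 0; last exact: E.
have hd0 j' : exists d, hd (y j') 0 d.
  by have /nearC[e e0] := hy j'; apply; rewrite subrr cN0.
have hc0 i : exists d, hd (C0 i) 0 d by apply: C0_hd => //; rewrite mul0r cN0.
have [d hd_y] := hd0 j; have [d0 h0] := hc0 0; have [d1 h1] := hc0 1.
have hc : hd (comb C0 h j) 0 (h 0 j * d0 + h 1 j * d1).
  rewrite (_ : comb C0 h j = fun u => h 0 j * C0 0 u + h 1 j * C0 1 u).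
    exact: hdD (hdZ _ h0) (hdZ _ h1).
  by apply/funext => u; rewrite combE.
have /nearC[e e0 eP] := near_small a0 m0.
by apply: (eq_limit hd_y hc e0) => w w0 /eP; exact: E.
Qed.
End Coordinates.

Section LameLift.
Variable R : realType.
Local Notation C := (Cx R).
Variables (al be : C) (mm : nat) (a : C) (e : 'I_3 -> C) (l : C).
Hypothesis mm0 : (0 < mm)%N.
Hypothesis a0 : a != 0.
Local Notation Ex := (Ex mm a).
Hypothesis hpE : forall u, (forall i, Ex u != e i) ->
  hp al be u = mm%:R^-1 - Ex u / mm%:R * (2^-1 * \sum_i (Ex u - e i)^-1).
Hypothesis hqE : forall u, (forall i, Ex u != e i) ->
  hq al be u = (Ex u / mm%:R) ^+ 2 * ((l * (l + 1) * Ex u) / (4 * \prod_i (Ex u - e i))).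

Lemma lift_eq (y2 y1 y0 s q x : C) : y2 + 2^-1 * s * y1 - q * y0 = 0 ->
  y2 * (x / mm%:R) * (x / mm%:R) + y1 * (x / mm%:R / mm%:R) =
  (mm%:R^-1 - x / mm%:R * (2^-1 * s)) * (y1 * (x / mm%:R)) + (x / mm%:R) ^+ 2 * q * y0.
Proof.
move=> L; have -> : y2 = q * y0 - 2^-1 * s * y1.
  by apply/eqP; rewrite -subr_eq0 -L; apply/eqP; ring.
by have m0 := mmC R mm0; field.
Qed.

Lemma ordinary_near (P : C) : ordinary (C := C) e P -> \forall x \near P, forall i, x != e i.
Proof.
move=> Po.
have H i : \forall x \near P, x != e i.
  apply/nearC; exists (cN (P - e i)); first by rewrite cN_gt0 subr_eq0; exact: Po.
  by move=> w; apply: contraTneq => ->; rewrite cNBC ltxx.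
have /nearC[r r0 rP] := H ord0; have /nearC[s s0 sP] := H (lift ord0 ord0).
have /nearC[t t0 tP] := H (lift ord0 (lift ord0 ord0)).
apply/nearC; exists (Num.min r (Num.min s t)); first by rewrite !lt_min r0 s0.
move=> w; rewrite !lt_min => /and3P[/rP h0 /sP h1 /tP h2] i.
by case: (unliftP ord0 i) => [j ->|->//]; case: (unliftP ord0 j) => [k ->|->//]; rewrite (ord1 k).
Qed.

(** Chain rule with Ex' = Ex / mm; [hpE] and [hqE] identify the resulting coefficients with the
    hypergeometric ones. *)
Lemma lame_lsol (P : C) (y : C -> C) : ordinary (C := C) e P -> local_solution (C := C) e l 0 P y ->
  exists r Y', 0 < r /\ lsol (hp al be) (hq al be) (fun u => cN (Ex u - P) < r) (fun v => y (Ex v)) Y'.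
Proof.
move=> Po sy; have [r r0 rP] := (nearC _ _).1 (near2 sy (ordinary_near Po) (fun x p q => conj p q)).
exists r, (fun u => y^`()%classic (Ex u) * (Ex u / mm%:R)); split=> // u /rP[[d1 d2 L] ne].
have h0 := derivable_hd d1; have h1 := derivable_hd d2; have hE := Ex_hd mm a u.
split; first exact: hd_comp hE h0.
have hE' : hd (fun v => Ex v / mm%:R) u (Ex u / mm%:R / mm%:R).
  by apply: hd_eq (hdM hE (hd_cst (mm%:R^-1) u)) _; rewrite mulr0 addr0.
apply: hd_eq (hdM (hd_comp hE h1) hE') _.
move: L; rewrite /Lame_op /derive1n /= addr0.
rewrite hpE // hqE //.
move: (\sum_i _) (_ / (4 * _)) => s q.
exact: lift_eq.
Qed.
End LameLift.

(** * The projective monodromy group *)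

Section ProjectiveClass.
Variables (F : fieldType) (n : nat).
Implicit Types M N : 'M[F]_n.

Definition mkGL M (u : M \in unitmx) : GL n F := exist _ M u.

(** Total on matrices: a singular M gets the class of the identity, so invertibility enters only
    where products are formed. *)
Definition cls M : PGL n F := toPGL (insubd (GL_one n F) M).

Lemma cls_val (A : GL n F) : cls (val A) = toPGL A.
Proof. by rewrite /cls valKd. Qed.

Lemma clsM M N : M \in unitmx -> N \in unitmx -> cls (M *m N) = (cls M * cls N)%g.
Proof.
move=> uM uN; pose A := mkGL uM; pose B := mkGL uN.
have -> : cls M = toPGL A by rewrite -cls_val.
have -> : cls N = toPGL B by rewrite -cls_val.
by rewrite -toPGLM -cls_val.
Qed.

Lemma cls_scalar (c : F) : c != 0 -> cls c%:M = 1%g.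
Proof.
move=> c0; have u : (c%:M : 'M[F]_n) \in unitmx by rewrite unitmxE det_scalar unitrX // unitfE.
rewrite [LHS](cls_val (mkGL u)); apply/toPGLP; exists c => //=.
by rewrite scalemx1.
Qed.

Lemma cls1 : cls 1%:M = 1%g.
Proof. by rewrite cls_scalar ?oner_eq0. Qed.

Lemma clsV M : M \in unitmx -> cls (invmx M) = (cls M)^-1%g.
Proof.
move=> uM; apply: (mulgI (cls M)).
by rewrite -clsM ?unitmx_inv // mulmxV // cls1 mulgV.
Qed.

Lemma cls_eq1 M : M \in unitmx -> cls M = 1%g -> exists c, M = c%:M.
Proof.
move=> uM; rewrite -[cls M]/(cls (val (mkGL uM))) cls_val => /toPGLP[c _ /= ->].
by exists c; rewrite scalemx1.
Qed.

Variable f : int -> 'M[F]_n.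
Hypothesis fu : forall k, f k \in unitmx.
Hypothesis fD : forall k l, f (k + l) = f k *m f l.

Lemma cls_pow (k : nat) : cls (f k%:Z) = (cls (f 1) ^+ k)%g.
Proof.
elim: k => [|k IH].
  rewrite expg0; apply: (mulgI (cls (f 0))).
  by rewrite -clsM // -fD addr0 mulg1.
by rewrite expgSr -IH -clsM // -fD intS addrC.
Qed.

Lemma cls_opp (k : int) : cls (f (- k)) = ((cls (f k))^-1)%g.
Proof.
apply: (mulgI (cls (f k))); rewrite mulgV -clsM // -fD subrr.
exact: (cls_pow 0).
Qed.

Lemma cls_subgrp (X : set (PGL n F)) (k : int) : subgrp X -> X (cls (f 1)) -> X (cls (f k)).
Proof.
move=> [X1 XM XV] Xf.
have Xn (m : nat) : X (cls (f m)).
  by rewrite cls_pow; elim: m => [|m IH]; [rewrite expg0|rewrite expgS; exact: XM].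
case: k => [m|m]; first exact: Xn.
by rewrite NegzE cls_opp; apply: XV.
Qed.
End ProjectiveClass.

(** Induction step for writing (a b)^k b^-k as a product of the conjugates b^j a b^-j with j < k. *)
Lemma expg_mul_step (G : groupType) (a b : G) (k : nat) :
  ((a * b) ^+ k.+1 * b ^- k.+1 = ((a * b) ^+ k * b ^- k) * (b ^+ k * a * b ^- k))%g.
Proof. by rewrite !expgSr invgM !mulgA mulgK mulgKV. Qed.

Lemma isomorphic_conj (G : groupType) (X : set G) (c : G) (gT : finGroupType) (H : {group gT}) :
  isomorphic_to X H -> isomorphic_to [set (c^-1 * g * c)%g | g in X] H.
Proof.
move=> [f [fM fI <-]]; exists (fun x => (c^-1 * f x * c)%g); split.
- by move=> x y xH yH; rewrite fM // !mulgA mulgK.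
- by move=> x y xH yH /mulIg/mulgI; exact: fI.
- apply/seteqP; split=> [_ [x xH <-]|_ [_ [x xH <-] <-]]; last by exists x.
  by exists (f x) => //; exists x.
Qed.

Section ProjectiveMonodromy.
Variable R : realType.
Local Notation C := (Cx R).
Variables al be : C.
Local Notation gam := (gam al be).
Local Notation hp := (hp al be).
Local Notation hq := (hq al be).
Hypothesis g0 : forall n : nat, n%:R + gam != 0.
Hypothesis g1 : forall n : nat, n%:R + (2 - gam) != 0.
Hypothesis gn : 1 - gam != 0.
Hypothesis ab0 : forall n : nat, n%:R + (1 + al - be) != 0.
Hypothesis ab1 : forall n : nat, n%:R + (1 + be - al) != 0.
Hypothesis abn : al - be != 0.
Local Notation cL := (cL al be).
Local Notation bR := (bR al be).
Local Notation Tr := (Tr al be).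
Local Notation rho := (rho al be).
Local Notation Dm := (Dm al be).
Local Notation tau := (tau R).
Local Notation tpi := (tpi R).
Variable N0 : 'M[C]_2.
Hypothesis N0P : forall t, 0 < t < tpi -> Tr t N0.
Local Notation Nk := (Nk al be N0).
Implicit Types (u v w z x : C) (M N : 'M[C]_2) (Y B S Z : 'I_2 -> C -> C).

Variables (mm : nat) (a : C) (z0 : Prop).
Hypothesis mm0 : (0 < mm)%N.
Hypothesis a0 : a != 0.
Hypothesis hz : z0 -> 1 - gam = mm%:R^-1.
Local Notation Ex := (Ex mm a).
Local Notation pl := (pl mm a).
Local Notation push := (push mm a).
Local Notation ordp := (ordp mm a z0).
Local Notation St := (St al be N0 mm a z0).

Variables (e : 'I_3 -> C) (l : C).
Hypothesis ordE : forall x, ordinary (C := C) e x <-> ordp x.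
Hypothesis hpE : forall u, (forall i, Ex u != e i) ->
  hp u = mm%:R^-1 - Ex u / mm%:R * (2^-1 * \sum_i (Ex u - e i)^-1).
Hypothesis hqE : forall u, (forall i, Ex u != e i) ->
  hq u = (Ex u / mm%:R) ^+ 2 * ((l * (l + 1) * Ex u) / (4 * \prod_i (Ex u - e i))).
Variables (m r s : nat).
Hypothesis rho_m : expc ((1 - gam) * tau m) = 1.
Hypothesis Dm_r : expc ((be - al) * tau r) = 1.
Hypothesis rs : (r * s = 1 %[mod m])%N.

Let ga : PGL 2 C := cls (A0 al be N0).
Let gb : PGL 2 C := cls (rho 1).

Let uN0 := N0_unit N0P.
Let uD k : invmx N0 *m Dm k *m N0 \in unitmx.
Proof. by rewrite !unitmx_mul unitmx_inv uN0 Dm_unit. Qed.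
Let DD k l' : invmx N0 *m Dm (k + l') *m N0 = (invmx N0 *m Dm k *m N0) *m (invmx N0 *m Dm l' *m N0).
Proof. by rewrite DmD !mulmxA mulmxK. Qed.
Let ur := rho_unit al be.
Let rD := rhoD al be.
Let uA : A0 al be N0 \in unitmx.
Proof. by rewrite /A0 unitmx_mul ur /dinf Dm_inv uD. Qed.

Lemma ga_sq : (ga * ga = 1)%g.
Proof. by rewrite -clsM // (A0_sq g0 g1 gn ab0 ab1 abn N0P) // cls1. Qed.

Lemma gb_pow : (gb ^+ m = 1)%g.
Proof. by rewrite -(cls_pow ur rD) rho_scalar // cls1. Qed.

(** By definition a = b d, where d is the class of [dinf]. As a is an involution, (a b)^-1 = b^-1 a
    = d. *)
Lemma gab_inv : ((ga * gb)^-1 = cls (invmx N0 *m Dm (-1) *m N0))%g.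
Proof.
have -> : ((ga * gb)^-1 = gb^-1 * ga)%g.
  by rewrite invgM; congr (_ * _)%g; apply: (mulgI ga); rewrite mulgV ga_sq.
have -> : ga = (gb * cls (dinf al be N0))%g.
  by apply: clsM; [exact: ur|rewrite /dinf Dm_inv; exact: uD].
by rewrite mulKg /dinf Dm_inv.
Qed.

Lemma gabX (k : nat) : ((ga * gb) ^+ k = cls (invmx N0 *m Dm k *m N0))%g.
Proof.
by rewrite (cls_pow uD DD) -[X in (X ^+ _)%g]invgK gab_inv -(cls_opp uD DD) opprK.
Qed.

Lemma gab_pow : ((ga * gb) ^+ r = 1)%g.
Proof.
rewrite gabX Dm_scalar // mul_mx_scalar -scalemxAl mulVmx // scalemx1.
by rewrite cls_scalar ?expc_neq0.
Qed.

Lemma gab_pow_eq1 (k : nat) : ((ga * gb) ^+ k = 1)%g -> expc ((be - al) * tau k) = 1.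
Proof.
rewrite gabX => /(cls_eq1 (uD k))[c cE]; apply: (Dm_nonscalar (c := c)).
transitivity (N0 *m (invmx N0 *m Dm k *m N0) *m invmx N0).
  by rewrite !mulmxA mulmxV // mul1mx mulmxK.
by rewrite cE mul_mx_scalar -scalemxAl mulmxV // scalemx1.
Qed.

(** The preimage of the group generated by a and b among matrices; the upper bound is applied with
    this K. *)
Let K (M : 'M[C]_2) := M \in unitmx /\ gen2 ga gb (cls M).

Let gS := gen2_subgrp ga gb.
Let K1 : K 1%:M.
Proof. by split; [exact: unitmx1|rewrite cls1; case: gS]. Qed.
Let KM k k' : K k -> K k' -> K (k *m k').
Proof.
move=> [u h] [u' h']; split; first by rewrite unitmx_mul u.
by rewrite clsM //; have [_ + _] := gS; apply.
Qed.
Let KV k : K k -> K (invmx k).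
Proof.
move=> [u h]; split; first by rewrite unitmx_inv.
by rewrite clsV //; have [_ _] := gS; apply.
Qed.
Let KU k : K k -> k \in unitmx. Proof. by case. Qed.
Let Krho k : K (rho k).
Proof. by split; [exact: ur|exact: (cls_subgrp ur rD k gS (@gen2_r _ ga gb))]. Qed.
Let KDm k : K (invmx N0 *m Dm k *m N0).
Proof.
split; first exact: uD.
apply: (cls_subgrp uD DD k gS).
have [_ gM gV] := gS; rewrite -[1]opprK (cls_opp uD DD) -gab_inv invgK.
by apply: gM; [exact: gen2_l|exact: gen2_r].
Qed.

Lemma basis_coord P y : ordinary (C := C) e P -> solution_basis (C := C) e l 0 P y ->
  exists S h, [/\ St P S, h \in unitmx & eqg P y (comb S h)].
Proof.
move=> Po [sy fy]; have DP := (ordE P).1 Po.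
have [S SP] := St_exists g0 g1 gn ab0 ab1 abn N0P mm0 a0 DP.
have [r0 [Y0 [r00 H0]]] := lame_lsol mm0 hpE hqE Po (sy 0).
have [r1 [Y1 [r10 H1]]] := lame_lsol mm0 hpE hqE Po (sy 1).
have I2 (j : 'I_2) : j = 0 \/ j = 1.
  by case: j => [[|[|//]] h]; [left|right]; exact/val_inj.
have hy j : hol (y j) P.
  apply: (near1 (sy j)) => x [d1 _ _]; exists ((y j)^`()%classic x); exact: derivable_hd.
have rm0 : 0 < Num.min r0 r1 by rewrite lt_min r00.
have [h hE] : exists h, eqg P y (comb S h).
  apply: (St_coord g0 g1 gn mm0 a0 hz (Y' := fun j => if j == 0 then Y0 else Y1) DP SP rm0 _ hy).
  move=> j; case: (I2 j) => ->.
    by apply: (lsolS H0) => u; rewrite lt_min => /andP[].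
  by apply: (lsolS H1) => u; rewrite lt_min => /andP[].
(* A kernel vector of h would be a linear relation between the two given solutions. *)
exists S, h; split=> //; rewrite unitmxE unitfE -det_tr; apply/negP => /det0P[v v0 vh].
case/negP: v0; apply/eqP/rowP => j; rewrite mxE; apply: (fy (fun j => v 0 j)).
apply: (near1 hE) => x xE.
under eq_bigr do rewrite xE /comb mulr_sumr.
rewrite exchange_big big1 // => i _.
have := congr1 (fun w : 'rV[C]_2 => w 0 i) vh; rewrite !mxE => E.
transitivity ((\sum_j v 0 j * h^T j i) * S i x); last by rewrite E mul0r.
by rewrite mulr_suml; apply: eq_bigr => k _; rewrite mxE mulrA.
Qed.

(* The loops around tau (- k) give b^k a b^-k. Their product for k < r is      *)
(* (a b)^r b^-r = b^-r, and r is invertible modulo the order of b.            *)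
Lemma gen2_Mon P S g : ordp P -> St P S -> gen2 ga gb g ->
  exists M, [/\ M \in unitmx, cls M = g & Mon mm a z0 P S M].
Proof.
move=> DP SP; apply: (_ : gen2 ga gb g -> [set g | exists M, [/\ M \in unitmx, cls M = g & Mon mm a z0 P S M]] g).
set Y := [set g | _].
have YM (x y : PGL 2 C) : Y x -> Y y -> Y (x * y)%g.
  move=> [M [uM <- cM]] [N [uN <- cN]]; exists (M *m N); split.
  - by rewrite unitmx_mul uM.
  - by rewrite clsM.
  - exact: Mon_mul.
have YV (x : PGL 2 C) : Y x -> Y x^-1%g.
  move=> [M [uM <- cM]]; exists (invmx M); split.
  - by rewrite unitmx_inv.
  - by rewrite clsV.
  - exact: Mon_inv.
have Yc k : Y ((cls (rho k))^-1 * ga * cls (rho k))%g.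
  have uB : rho (- k) *m A0 al be N0 \in unitmx.
    by rewrite (unitmx_mul (rho (- k))) ur uA.
  exists (rho (- k) *m A0 al be N0 *m rho k); split.
  - by rewrite (unitmx_mul (_ *m A0 al be N0)) uB ur.
  - by rewrite (clsM uB (ur k)) (clsM (ur (- k)) uA) (cls_opp ur rD).
  - exact: (Mon_loop g0 g1 gn ab0 ab1 abn N0P mm0 a0 hz DP SP).
have Ya : Y ga by have := Yc 0; rewrite (cls_pow ur rD 0) expg0 invg1 mul1g mulg1.
have Y1 : Y 1%g by rewrite -ga_sq; exact: YM.
have Yr k : Y ((ga * gb) ^+ k * gb ^- k)%g.
  elim: k => [|k IH]; first by rewrite !expg0 invg1 mulg1.
  rewrite expg_mul_step.
  apply: YM => //; have := Yc (- k%:Z).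
  by rewrite (cls_opp ur rD) (cls_pow ur rD) invgK.
have Yb : Y gb.
  have Ybr : Y (gb ^+ r)%g by have := YV _ (Yr r); rewrite gab_pow mul1g invgK.
  have -> : gb = ((gb ^+ r) ^+ s)%g.
    have pm k : (gb ^+ k = gb ^+ (k %% m))%g.
      by rewrite {1}(divn_eq k m) expgD mulnC expgM gb_pow expg1n mul1g.
    by rewrite -expgM pm rs -pm expg1.
  by elim: (s) => [|k IH]; [rewrite expg0|rewrite expgS; exact: YM].
by apply.
Qed.

Lemma projective_monodromyE P y : ordinary (C := C) e P -> solution_basis (C := C) e l 0 P y ->
  exists c : PGL 2 C, projective_monodromy_group R e P y = [set (c^-1 * g * c)%g | g in gen2 ga gb].
Proof.
move=> Po sy; have [S [h [SP uh yE]]] := basis_coord Po sy; have DP := (ordE P).1 Po.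
exists (cls h); have EO : ordinary (C := C) e = ordp by apply/seteqP; split=> x /ordE.
apply/seteqP; split=> [_ [M [gm lg cg] <-]|_ [g gg <-]].
- rewrite EO in lg.
  have [uH gH] := monodromy_upper g0 g1 gn ab0 ab1 abn N0P K1 KM KV KU Krho KDm mm0 a0 hz
    DP SP uh yE lg cg.
  exists (cls (h *m val M *m invmx h)) => //.
  rewrite !clsM ?unitmx_mul ?unitmx_inv ?uh ?(valP M) // clsV // cls_val.
  by rewrite !mulgA mulVg mul1g mulgKV.
- have [G [uG <- cG]] := gen2_Mon DP SP gg.
  have [gm lg cg] := Mon_monodromy uh yE cG.
  have uM : invmx h *m G *m h \in unitmx by rewrite !unitmx_mul unitmx_inv uh uG.
  exists (mkGL uM); first by exists gm => //; rewrite EO.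
  by rewrite -cls_val /= !clsM ?unitmx_mul ?unitmx_inv ?uh // clsV.
Qed.
End ProjectiveMonodromy.

(** * From exponent differences to the triangle relations *)

Section Presentation.
Variable R : realType.
Local Notation C := (Cx R).
Implicit Types (x u : C).

Lemma ratio_nonint (p : int) (r : nat) (k : int) : (0 < r)%N -> ~~ (r %| p)%Z ->
  p%:~R / r%:R != k%:~R :> C.
Proof.
move=> r0; apply: contra => /eqP E; apply/dvdzP; exists k.
have rn : r%:R != 0 :> C by rewrite pnatr_eq0 -lt0n.
by apply: (@intr_inj C); rewrite intrM -E -pmulrn divfK.
Qed.

Lemma tpii_neq0 : tpii R != 0.
Proof. by rewrite -cN_gt0 /tpii cNM cN_ci mul1r cN_emb normr_gt0 gt_eqF // tpi_gt0. Qed.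

Lemma expc_ratio (p : int) (r k : nat) : (0 < r)%N ->
  expc (p%:~R / r%:R * tau R k) = 1 <-> (r %| p * k)%Z.
Proof.
move=> r0; have rn : r%:R != 0 :> C by rewrite pnatr_eq0 -lt0n.
rewrite /tau mulrA (_ : _ / _ * k%:~R = (p * k)%:~R / r%:R); last by rewrite intrM mulrAC.
split=> [/expc_eq1[j]|/dvdzP[j ->]]; last first.
  by rewrite intrM -pmulrn mulfK // expc_int.
by move=> /(mulIf tpii_neq0) E; apply: contraT => /(ratio_nonint j r0); rewrite E eqxx.
Qed.

Variables (al be : C) (m r s : nat) (p : int).
Hypothesis m1 : (1 < m)%N.
Hypothesis r1 : (0 < r)%N.
Hypothesis rp : ~~ (r %| p)%Z.
Hypothesis gamE : 1 - gam al be = 1%:~R / m%:R.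
Hypothesis delE : be - al = p%:~R / r%:R.
Hypothesis rs : (r * s = 1 %[mod m])%N.

Let m0 : (0 : C) < m%:R. Proof. by rewrite ltr0n ltnW. Qed.

Let g0 (n : nat) : n%:R + gam al be != 0.
Proof.
rewrite gt_eqF // ltr_wpDl ?ler0n //.
have -> : gam al be = 1 - 1%:~R / m%:R by rewrite -gamE; ring.
by rewrite subr_gt0 mul1r invf_lt1 // ltr1n.
Qed.

Let g1 (n : nat) : n%:R + (2 - gam al be) != 0.
Proof.
rewrite gt_eqF // ltr_wpDl ?ler0n //.
have -> : 2 - gam al be = 1 + 1%:~R / m%:R by rewrite -gamE; ring.
by rewrite addr_gt0 ?ltr01 // mul1r invr_gt0.
Qed.

Let gn : 1 - gam al be != 0.
Proof. by rewrite gamE mul1r invr_eq0 gt_eqF. Qed.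

(** A nonintegral exponent difference p / r at infinity excludes vanishing denominators in both
    series there. *)
Let ab0 (n : nat) : n%:R + (1 + al - be) != 0.
Proof.
have -> : n%:R + (1 + al - be) = (n.+1)%:Z%:~R - p%:~R / r%:R.
  by rewrite -delE -pmulrn -natr1; ring.
by rewrite subr_eq0 eq_sym ratio_nonint.
Qed.

Let ab1 (n : nat) : n%:R + (1 + be - al) != 0.
Proof.
have -> : n%:R + (1 + be - al) = p%:~R / r%:R - (- n.+1%:Z)%:~R.
  by rewrite -delE rmorphN /= -pmulrn -natr1; ring.
by rewrite subr_eq0 ratio_nonint.
Qed.

Let abn : al - be != 0.
Proof.
have -> : al - be = 0%:~R - p%:~R / r%:R by rewrite -delE; ring.
by rewrite subr_eq0 eq_sym ratio_nonint.
Qed.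

Variables (mm : nat) (a : C) (z0 : Prop) (e : 'I_3 -> C) (l : C).
Hypothesis mm0 : (0 < mm)%N.
Hypothesis a0 : a != 0.
Hypothesis hz : z0 -> 1 - gam al be = mm%:R^-1.
Hypothesis ordE : forall x, ordinary (C := C) e x <-> ordp mm a z0 x.
Hypothesis hpE : forall u, (forall i, Ex mm a u != e i) ->
  hp al be u = mm%:R^-1 - Ex mm a u / mm%:R * (2^-1 * \sum_i (Ex mm a u - e i)^-1).
Hypothesis hqE : forall u, (forall i, Ex mm a u != e i) ->
  hq al be u = (Ex mm a u / mm%:R) ^+ 2 *
    ((l * (l + 1) * Ex mm a u) / (4 * \prod_i (Ex mm a u - e i))).

Lemma lame_presentation P y : ordinary (C := C) e P -> solution_basis (C := C) e l 0 P y ->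
  exists A B c : PGL 2 C,
  [/\ (A * A = 1)%g, (B ^+ m = 1)%g, ((A * B) ^+ r = 1)%g,
    (forall k : nat, (B ^+ k = 1)%g -> (m %| k)%N) /\
    (forall k : nat, ((A * B) ^+ k = 1)%g -> (r %| p * k)%Z) &
    projective_monodromy_group R e P y = [set (c^-1 * g * c)%g | g in gen2 A B]].
Proof.
move=> Po sy; have [N0 N0P] := Tr_first g0 g1 gn ab0 ab1 abn.
have mp : (0 < m)%N by exact: ltnW.
have rho_m : expc ((1 - gam al be) * tau R m) = 1.
  by rewrite gamE; apply/(expc_ratio 1 m mp); rewrite mul1r.
have Dm_r : expc ((be - al) * tau R r) = 1.
  by rewrite delE; apply/(expc_ratio p r r1); rewrite dvdz_mull.
have [c cE] := projective_monodromyE g0 g1 gn ab0 ab1 abn N0P mm0 a0 hz ordE hpE hqE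
  rho_m Dm_r rs Po sy.
exists (cls (A0 al be N0)), (cls (rho al be 1)), c.
have uN0 := N0_unit N0P; have uDm := Dm_unit al be.
split=> //.
- exact: (ga_sq g0 g1 gn ab0 ab1 abn N0P).
- exact: gb_pow rho_m.
- exact: (gab_pow g0 g1 gn ab0 ab1 abn N0P Dm_r).
split=> k.
  rewrite -(cls_pow (rho_unit al be) (rhoD al be)) => /(cls_eq1 (rho_unit al be _))[d /rho_nonscalar].
  by rewrite gamE => /(expc_ratio 1 k mp); rewrite mul1r.
move=> /(gab_pow_eq1 g0 g1 gn ab0 ab1 abn N0P).
by rewrite delE => /(expc_ratio p k r1).
Qed.
End Presentation.

(** * The two symmetric cubics *)

Section Cubic.
Variable C : numFieldType.
Variable e : 'I_3 -> C.
Hypothesis e_inj : injective e.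
Hypothesis e_sum : \sum_i e i = 0.

Lemma prod_cubic x : \prod_i (x - e i) = x ^+ 3 - g2 e / 4 * x - g3 e / 4.
Proof.
have := congr1 (fun p : {poly C} => p.[x]) (Lame_cubicE e_sum).
rewrite /Lame_cubic hornerZ horner_prod !(hornerD, hornerN, hornerZ, hornerXn, hornerX, hornerC) => E.
have {}E : 4 * \prod_i (x - e i) = 4 * x ^+ 3 - g2 e * x - g3 e.
  by rewrite -E; congr (_ * _); apply: eq_bigr => i _; rewrite hornerXsubC.
have n4 : (4 : C) != 0 by rewrite pnatr_eq0.
by apply: (mulfI n4); rewrite E; field.
Qed.

Lemma cubic_root i : e i ^+ 3 - g2 e / 4 * e i - g3 e / 4 = 0.
Proof. by rewrite -prod_cubic (bigD1 i) //= subrr mul0r. Qed.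

Let e0 := e ord0.
Let e1 := e (lift ord0 ord0).
Let e2 := e (lift ord0 (lift ord0 ord0)).

Lemma e2E : e2 = - e0 - e1.
Proof.
move: e_sum; rewrite !big_ord_recl big_ord0 addr0 -/e0 -/e1 -/e2 => E.
by apply/eqP; rewrite -subr_eq0 -E; apply/eqP; ring.
Qed.

Lemma e_neq : [/\ e0 - e1 != 0, e0 - e2 != 0 & e1 - e2 != 0].
Proof. by rewrite !subr_eq0 !(inj_eq e_inj). Qed.

(** Subtract the cubic equations of two distinct roots and divide by e0 - e1. *)
Lemma g2_roots : g2 e / 4 = e0 ^+ 2 + e0 * e1 + e1 ^+ 2.
Proof.
have [n01 _ _] := e_neq; apply: (mulfI n01); apply/eqP; rewrite -subr_eq0; apply/eqP.
transitivity ((e1 ^+ 3 - g2 e / 4 * e1 - g3 e / 4) - (e0 ^+ 3 - g2 e / 4 * e0 - g3 e / 4)); first by ring.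
by rewrite !cubic_root subr0.
Qed.

Lemma g3_roots : g3 e / 4 = - (e0 * e1 * (e0 + e1)).
Proof.
have := cubic_root ord0; rewrite -/e0 g2_roots => E.
by apply/eqP; rewrite -subr_eq0 -oppr_eq0 -E; apply/eqP; ring.
Qed.

(** The logarithmic derivative of the cubic. *)
Lemma sum_inv_cubic x : (forall i, x != e i) ->
  \sum_i (x - e i)^-1 = (3 * x ^+ 2 - g2 e / 4) / \prod_i (x - e i).
Proof.
move=> xe; have h i : x - e i != 0 by rewrite subr_eq0.
have := h ord0; have := h (lift ord0 ord0); have := h (lift ord0 (lift ord0 ord0)).
rewrite g2_roots !big_ord_recl !big_ord0 -/e0 -/e1 -/e2 e2E => h2 h1 h0.
by field; rewrite h0 h1 h2.
Qed.

Lemma disc_neq0 : g2 e ^+ 3 - 27 * g3 e ^+ 2 != 0.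
Proof.
have n4 : (4 : C) != 0 by rewrite pnatr_eq0.
have g2E : g2 e = 4 * (e0 ^+ 2 + e0 * e1 + e1 ^+ 2) by rewrite -g2_roots mulrC divfK.
have g3E : g3 e = - (4 * (e0 * e1 * (e0 + e1))) by rewrite -mulrN -g3_roots mulrC divfK.
have [] := e_neq; rewrite e2E => n1 n2 n3.
have -> : g2 e ^+ 3 - 27 * g3 e ^+ 2 =
    16 * ((e0 - e1) * (e0 - (- e0 - e1)) * (e1 - (- e0 - e1))) ^+ 2 by rewrite g2E g3E; ring.
by rewrite mulf_neq0 ?pnatr_eq0 // expf_neq0 // !mulf_neq0.
Qed.

Lemma ordinary_prod x : ordinary e x <-> \prod_i (x - e i) != 0.
Proof.
split=> [h|]; first by apply/prodf_neq0 => i _; rewrite subr_eq0.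
by move/prodf_neq0 => h i; rewrite -subr_eq0; exact: h.
Qed.

Lemma J1_g3 : J_invariant e = 1 -> g3 e = 0.
Proof.
rewrite /J_invariant => /(congr1 (fun z => z * (g2 e ^+ 3 - 27 * g3 e ^+ 2))).
rewrite divfK ?disc_neq0 // mul1r => E.
have : 27 * g3 e ^+ 2 = g2 e ^+ 3 - (g2 e ^+ 3 - 27 * g3 e ^+ 2) by ring.
rewrite -E subrr.
by move/eqP; rewrite mulf_eq0 pnatr_eq0 /= expf_eq0 /= => /eqP.
Qed.

Lemma J0_g2 : J_invariant e = 0 -> g2 e = 0.
Proof.
move/eqP; rewrite /J_invariant mulf_eq0 invr_eq0 (negPf disc_neq0) orbF.
by rewrite expf_eq0 /= => /eqP.
Qed.
End Cubic.

(** * Parameters in the harmonic and equianharmonic cases *)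

Section Families.
Variable R : realType.
Local Notation C := (Cx R).
Variable e : 'I_3 -> C.
Hypothesis e_inj : injective e.
Hypothesis e_sum : \sum_i e i = 0.

Lemma expc_Ex (mm : nat) (a : C) u : (0 < mm)%N -> a != 0 ->
  expc u = Ex mm a u ^+ mm / a ^+ mm.
Proof. by move=> m0 a0; rewrite ExX // mulrC mulKf // expf_neq0. Qed.

Lemma exists_nonzero_root : exists i, e i != 0.
Proof.
have [e0|] := eqVneq (e ord0) 0; last by exists ord0.
exists ord_max; apply/negP => /eqP e1.
by have := e_inj (etrans e0 (esym e1)).
Qed.

Lemma harmonic_octahedral (p : int) : g3 e = 0 -> ~~ (3 %| p)%Z ->
  forall P y, ordinary (C := C) e P ->
    solution_basis (C := C) e (2 * p%:~R / 3 - 2^-1) 0 P y ->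
  octahedral (projective_monodromy_group R e P y).
Proof.
move=> B0 p3 P y; set l := _ - _ => Po sy.
have n2 : (2 : C) != 0 by rewrite pnatr_eq0.
have [i ei] := exists_nonzero_root; pose a := e i.
have A : g2 e / 4 = a ^+ 2.
  apply: (mulIf ei); have := cubic_root e_sum i; rewrite B0 mul0r subr0 => E.
  by apply/eqP; rewrite -subr_eq0 -oppr_eq0 -E; apply/eqP; rewrite /a; ring.
have prodE x : \prod_i (x - e i) = x * (x ^+ 2 - a ^+ 2).
  by rewrite prod_cubic // A B0; ring.
(* Then be - al = (l + 1/2) / 2 = p / 3 and 1 - gam = 1/4. *)
pose al : C := - l / 4; pose be : C := (l + 1) / 4.
have ordE x : ordinary (C := C) e x <-> ordp 2 a False x.
  rewrite ordinary_prod prodE mulf_eq0 negb_or subr_eq0 /ordp /=.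
  split=> [/andP[x0 xa]|[xa x0]]; first by split=> // /eqP; rewrite (negPf x0).
  by rewrite xa andbT; apply/negP => /eqP.
have [A' [B' [c [a2 bm abr [nb nab] ->]]]] : exists A B c : PGL 2 C,
  [/\ (A * A = 1)%g, (B ^+ 4 = 1)%g, ((A * B) ^+ 3 = 1)%g,
    (forall k : nat, (B ^+ k = 1)%g -> (4 %| k)%N) /\
    (forall k : nat, ((A * B) ^+ k = 1)%g -> (3 %| p * k)%Z) &
    projective_monodromy_group R e P y = [set (c^-1 * g * c)%g | g in gen2 A B]].
  (* The second 3 inverts r = 3 modulo 4; [False] records that x = 0 is one of the roots. *)
  apply: (@lame_presentation R al be 4 3 3 p _ _ p3 _ _ _ 2 a False e l) => //.
  - by rewrite /gam /al /be; field.
  - by rewrite /al /be /l; field.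
  - move=> u /ordE[xa x0]; have xn : Ex 2 a u != 0 := Ex_neq0 2 ei u.
    rewrite sum_inv_cubic //; last by apply/ordE.
    rewrite prodE A /hp /gam /al /be (expc_Ex u (isT : 0 < 2)%N ei) -/a.
    move: (Ex 2 a u) xa xn => x xa xn; have xa' : x ^+ 2 - a ^+ 2 != 0 by rewrite subr_eq0.
    have ax' : a ^+ 2 - x ^+ 2 != 0 by rewrite subr_eq0 eq_sym.
    by field; rewrite xn xa' ax' ei.
  - move=> u /ordE[xa x0]; have xn : Ex 2 a u != 0 := Ex_neq0 2 ei u.
    rewrite prodE /hq /al /be (expc_Ex u (isT : 0 < 2)%N ei) -/a.
    move: (Ex 2 a u) xa xn => x xa xn; have xa' : x ^+ 2 - a ^+ 2 != 0 by rewrite subr_eq0.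
    have ax' : a ^+ 2 - x ^+ 2 != 0 by rewrite subr_eq0 eq_sym.
    by field; rewrite xn xa' ax' ei.
apply: isomorphic_conj; apply: octahedral_gen2_43 => //.
by apply/eqP => /nb.
Qed.

Section Equianharmonic.
Hypothesis A0 : g2 e = 0.
Variables (r s : nat) (p : int).
Hypothesis r1 : (0 < r)%N.
Hypothesis rs : (r * s = 1 %[mod 3])%N.
Hypothesis pr : ~~ (r %| p)%Z.

Lemma equianharmonic_presentation P y : ordinary (C := C) e P ->
    solution_basis (C := C) e (3 * p%:~R / r%:R - 2^-1) 0 P y ->
  exists A B c : PGL 2 C,
  [/\ (A * A = 1)%g, (B ^+ 3 = 1)%g, ((A * B) ^+ r = 1)%g,
    (forall k : nat, (B ^+ k = 1)%g -> (3 %| k)%N) /\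
    (forall k : nat, ((A * B) ^+ k = 1)%g -> (r %| p * k)%Z) &
    projective_monodromy_group R e P y = [set (c^-1 * g * c)%g | g in gen2 A B]].
Proof.
set l := _ - _ => Po sy.
have rn : r%:R != 0 :> C by rewrite pnatr_eq0 -lt0n.
have n3 : (3 : C) != 0 by rewrite pnatr_eq0.
have [i ei] := exists_nonzero_root; pose a := e i.
have B : g3 e / 4 = a ^+ 3.
  have := cubic_root e_sum i; rewrite A0 !mul0r subr0 => /eqP.
  by rewrite subr_eq0 => /eqP <-.
have prodE x : \prod_i (x - e i) = x ^+ 3 - a ^+ 3.
  by rewrite prod_cubic // A0 B; ring.
(* Then be - al = (l + 1/2) / 3 = p / r, and 1 - gam = 1/3 equals 1 / mm, as needed at the ordinary
   point x = 0. *)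
pose al : C := - l / 6; pose be : C := (l + 1) / 6.
have ordE x : ordinary (C := C) e x <-> ordp 3 a True x.
  by rewrite ordinary_prod prodE subr_eq0 /ordp /=; split=> [|[]].
apply: (@lame_presentation R al be 3 r s p _ r1 pr _ _ rs 3 a True e l) => //.
- by rewrite /gam /al /be; field.
- by rewrite /al /be /l; field; rewrite rn.
- by move=> _; rewrite /gam /al /be; field.
- move=> u /ordE[xa x0]; have xn : Ex 3 a u != 0 := Ex_neq0 3 ei u.
  rewrite sum_inv_cubic //; last by apply/ordE.
  rewrite prodE A0 /hp /gam /al /be (expc_Ex u (isT : 0 < 3)%N ei) -/a.
  move: (Ex 3 a u) xa xn => x xa xn; have xa' : x ^+ 3 - a ^+ 3 != 0 by rewrite subr_eq0.
  have ax' : a ^+ 3 - x ^+ 3 != 0 by rewrite subr_eq0 eq_sym.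
  by field; rewrite xa' ax' ei.
- move=> u /ordE[xa x0]; have xn : Ex 3 a u != 0 := Ex_neq0 3 ei u.
  rewrite prodE /hq /al /be (expc_Ex u (isT : 0 < 3)%N ei) -/a.
  move: (Ex 3 a u) xa xn => x xa xn; have xa' : x ^+ 3 - a ^+ 3 != 0 by rewrite subr_eq0.
  have ax' : a ^+ 3 - x ^+ 3 != 0 by rewrite subr_eq0 eq_sym.
  by field; rewrite xa' ax' ei.
Qed.
End Equianharmonic.

(** The hypothesis says that p is odd, which makes the test element (a b)^2 of [table34]
    nontrivial. *)
Lemma equianharmonic_octahedral (p : int) : g2 e = 0 -> ~~ (4 %| p * 2)%Z ->
  forall P y, ordinary (C := C) e P ->
    solution_basis (C := C) e (3 * p%:~R / 4 - 2^-1) 0 P y ->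
  octahedral (projective_monodromy_group R e P y).
Proof.
move=> A0 p4 P y Po sy.
have p4' : ~~ (4%N %| p)%Z by apply: contra p4; exact: dvdz_mulr.
have [A [B [c [a2 bm abr [nb nab] ->]]]] :=
  @equianharmonic_presentation A0 4 1 p isT erefl p4' P y Po sy.
apply: isomorphic_conj; apply: octahedral_gen2_34 => //.
by apply/eqP => /nab; rewrite (negPf p4).
Qed.

Lemma equianharmonic_icosahedral (p : int) : g2 e = 0 -> ~~ (5 %| p)%Z ->
  forall P y, ordinary (C := C) e P ->
    solution_basis (C := C) e (3 * p%:~R / 5 - 2^-1) 0 P y ->
  icosahedral (projective_monodromy_group R e P y).
Proof.
move=> A0 p5 P y Po sy.
have [A [B [c [a2 bm abr [nb nab] ->]]]] :=
  (* The exponent 2 inverts r = 5 modulo 3. *)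
  @equianharmonic_presentation A0 5 2 p isT erefl p5 P y Po sy.
apply: isomorphic_conj; apply: icosahedral_gen2_35 => //.
by apply/eqP => b1; have /nb : (B ^+ 1 = 1)%g by rewrite expg1.
Qed.
End Families.

Lemma eqz_mod_shift (n c d : int) : (n = c %[mod d])%Z -> exists k, n = d * k + c.
Proof.
by move/eqP; rewrite eqz_mod_dvd => /dvdzP[k E]; exists k; rewrite mulrC -E subrK.
Qed.

Lemma ndvdz_shift (d : nat) (k c : int) : ~~ (d %| c)%Z -> ~~ (d %| d%:Z * k + c)%Z.
Proof. by rewrite rpredDl // dvdz_mulr. Qed.

Theorem proposition3p4 (R : realType) (n : int) (e : 'I_3 -> R[i])
    (e_inj : injective e) (e_sum : \sum_i e i = 0) :
  (J_invariant e = 1 ->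
     ((n = 0 %[mod 2])%Z -> octahedral_Lame e (n%:~R + 1 / 6) 0) /\
     ((n = 1 %[mod 2])%Z -> octahedral_Lame e (n%:~R - 1 / 6) 0)) /\
  (J_invariant e = 0 ->
     [/\ ((n = 0 %[mod 3])%Z -> octahedral_Lame e (n%:~R + 1 / 4) 0) /\
         ((n = 2 %[mod 3])%Z -> octahedral_Lame e (n%:~R - 1 / 4) 0),
         ((n = 0 %[mod 3])%Z -> icosahedral_Lame e (n%:~R + 1 / 10) 0) /\
         ((n = 2 %[mod 3])%Z -> icosahedral_Lame e (n%:~R - 1 / 10) 0)
       & (n = 1 %[mod 3])%Z ->
           icosahedral_Lame e (n%:~R + 3 / 10) 0 /\
           icosahedral_Lame e (n%:~R - 3 / 10) 0]).
Proof.
have H43 (p : int) l : g3 e = 0 -> ~~ (3 %| p)%Z -> l = 2 * p%:~R / 3 - 2^-1 ->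
    octahedral_Lame e l 0.
  move=> B p3 ->; exact: (harmonic_octahedral (e := e : _ -> Cx R) e_inj e_sum B p3).
have H34 (p : int) l : g2 e = 0 -> ~~ (4 %| p * 2)%Z -> l = 3 * p%:~R / 4 - 2^-1 ->
    octahedral_Lame e l 0.
  move=> A p4 ->; exact: (equianharmonic_octahedral (e := e : _ -> Cx R) e_inj e_sum A p4).
have H35 (p : int) l : g2 e = 0 -> ~~ (5 %| p)%Z -> l = 3 * p%:~R / 5 - 2^-1 ->
    icosahedral_Lame e l 0.
  move=> A p5 ->; exact: (equianharmonic_icosahedral (e := e : _ -> Cx R) e_inj e_sum A p5).
split=> [J1|J0].
  have B := J1_g3 e_inj e_sum J1.
  split=> /eqz_mod_shift[k ->].
    (* For n = 2k and l = n + 1/6, (l + 1/2) / 2 = k + 1/3; for n = 2k + 1 and l = n - 1/6 it is k +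
       2/3. *)
    apply: (H43 (3%:Z * k + 1)) => //; first exact: ndvdz_shift.
    by rewrite !(intrD, intrM); field.
  apply: (H43 (3%:Z * k + 2)) => //; first exact: ndvdz_shift.
  by rewrite !(intrD, intrM); field.
have A := J0_g2 e_inj e_sum J0.
split.
- split=> /eqz_mod_shift[k ->].
    (* For n = 3k and l = n + 1/4, (l + 1/2) / 3 = k + 1/4; for n = 3k + 2 and l = n - 1/4 it is k +
       3/4. *)
    apply: (H34 (4%:Z * k + 1)) => //; first by rewrite mulrDl -mulrA; exact: ndvdz_shift.
    by rewrite !(intrD, intrM); field.
  apply: (H34 (4%:Z * k + 3)) => //; first by rewrite mulrDl -mulrA; exact: ndvdz_shift.
  by rewrite !(intrD, intrM); field.
- split=> /eqz_mod_shift[k ->].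
    (* In the same way the shifts by 1/10 give k + 1/5 and k + 4/5, and those by 3/10 below give k +
       3/5 and k + 2/5. *)
    apply: (H35 (5%:Z * k + 1)) => //; first exact: ndvdz_shift.
    by rewrite !(intrD, intrM); field.
  apply: (H35 (5%:Z * k + 4)) => //; first exact: ndvdz_shift.
  by rewrite !(intrD, intrM); field.
- move=> /eqz_mod_shift[k ->]; split.
    apply: (H35 (5%:Z * k + 3)) => //; first exact: ndvdz_shift.
    by rewrite !(intrD, intrM); field.
  apply: (H35 (5%:Z * k + 2)) => //; first exact: ndvdz_shift.
  by rewrite !(intrD, intrM); field.
Qed.
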